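(* Let $k\ge1$ be an integer, $\lambda_1,\lambda_2>0$, $0<\nu<1$ and $\eta>0$. Let $\{\mathscr{L}_{\eta,\nu}(t)\}_{t\ge0}$ be the inverse tempered stable subordinator with parameters $\eta,\nu$, independent of the Skellam process of order $k$, $\{S^{k}(t)\}_{t\ge0}$, with parameters $\lambda_1,\lambda_2$. Let $p^k(n,x)=\mathrm{Pr}\{S^k(x)=n\}$ and let $l_{\eta,\nu}(x,t)$ be the probability density function (in $x$) of $\mathscr{L}_{\eta,\nu}(t)$. For $n\in\mathbb{Z}$, the probability mass function $\bar{p}^{f_{2}}(n,t)=\mathrm{Pr}\{S^{k}(\mathscr{L}_{\eta,\nu}(t))=n\}$ solves the following differential equation: $$\begin{aligned}\left(\eta+\frac{\mathrm{d}}{\mathrm{d} t}\right)^{\nu}\bar{p}^{f_{2}}(n,t)&=p^{k}(n,x)l_{\eta,\nu}(x,t)\big|_{x=0}-k(\lambda_{1}+\lambda_{2})\bar{p}^{f_{2}}(n,t)+\lambda_{1}\sum_{j=1}^{k}\bar{p}^{f_{2}}(n-j,t)\\ &\quad+\lambda_{2}\sum_{j=1}^{k}\bar{p}^{f_{2}}(n+j,t)+\eta^{\nu}\bar{p}^{f_{2}}(n,t)-t^{-\nu}E^{1-\nu}_{1,1-\nu}(-\eta t)p^{k}(n,0),\end{aligned}$$ where $E^{1-\nu}_{1,1-\nu}(\cdot)$ is the three-parameter Mittag-Leffler function.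
   Context: Poisson process of order $k$ (PPoK) with intensity $\lambda>0$: $N^k(t)=\sum_{i=1}^{N(t)}X_i$, where $\{N(t)\}_{t\ge0}$ is a Poisson process with intensity $k\lambda$, and $\{X_i\}_{i\ge1}$ are iid, uniform on $\{1,2,\dots,k\}$, and independent of $\{N(t)\}_{t\ge0}$. Skellam process of order $k$ (SPoK): $S^k(t)=N_1^k(t)-N_2^k(t)$, where $\{N_1^k(t)\}_{t\ge0}$ and $\{N_2^k(t)\}_{t\ge0}$ are independent PPoK with intensities $\lambda_1>0$ and $\lambda_2>0$, respectively. Tempered stable subordinator (TSS): the subordinator $\{\mathscr{D}_{\eta,\nu}(t)\}_{t\ge0}$ with $\mathbb{E}(e^{-s\mathscr{D}_{\eta,\nu}(t)})=e^{-tf_2(s)}$, where $f_{2}(s)=(\eta+s)^{\nu}-\eta^{\nu}$, $s>0$. Inverse TSS: $\mathscr{L}_{\eta,\nu}(t)=\inf\{s\ge0:\mathscr{D}_{\eta,\nu}(s)>t\}$, $t\ge0$. The value of its density at $x=0$ is understood as the limit $x\to0+$. Three-parameter Mittag-Leffler function: $E_{\alpha,\beta}^{\gamma}(x)=\frac{1}{\Gamma(\gamma)}\sum_{m=0}^{\infty}\frac{\Gamma(\gamma+m)x^{m}}{m!\,\Gamma(m\alpha+\beta)}$, $x\in\mathbb{R}$, for $\alpha,\beta,\gamma>0$. Operator: for $0<\nu<1$, $\left(\eta+\frac{\mathrm{d}}{\mathrm{d}t}\right)^{\nu}u(t)=e^{-\eta t}\,\partial_t^{\nu}\left[e^{\eta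 t}u(t)\right]$, where $\partial_t^\nu v(t)=\frac{1}{\Gamma(1-\nu)}\int_0^t(t-s)^{-\nu}v'(s)\,\mathrm{d}s$ is the Caputo derivative; equivalently, its Laplace transform in $t$ is $(\eta+z)^\nu\tilde u(z)-(\eta+z)^{\nu-1}u(0)$, with $\tilde u$ the Laplace transform of $u$. *)

(* Defs.v *)
From HB Require Import structures.
From mathcomp Require Import all_boot all_order all_algebra.
From mathcomp Require Import all_classical all_reals all_analysis.

Set Implicit Arguments.
Unset Strict Implicit.
Unset Printing Implicit Defensive.
Import Order.TTheory GRing.Theory Num.Theory.
Import numFieldNormedType.Exports.

Local Open Scope classical_set_scope.
Local Open Scope ring_scope.

HB.instance Definition _ := isPointed.Build int 0.
HB.instance Definition _ := @isMeasurable.Build default_measure_display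
  int discrete_measurable discrete_measurable0
  discrete_measurableC discrete_measurableU.

Section special_functions.
Context {R : realType}.
Local Notation mu := (@lebesgue_measure R).

Definition Gamma (x : R) : R :=
  \int[mu]_(t in `]0, +oo[) (t `^ (x - 1) * expR (- t)).

Definition mittag_leffler3 (alpha beta gamma x : R) : R :=
  (Gamma gamma)^-1 *
  limn (series (fun m : nat =>
    Gamma (gamma + m%:R) * x ^+ m / (m`!%:R * Gamma (m%:R * alpha + beta)))).

Definition caputo (nu : R) (v : R -> R) (t : R) : R :=
  (Gamma (1 - nu))^-1 *
  \int[mu]_(s in `]0, t[) ((t - s) `^ (- nu) * derive1 v s).

(* [caputo] is total; this says that [v'] and the integral defining
   [caputo nu v t] exist, [v] being absolutely continuous on [0, t]. *)
Definition caputo_exists (nu : R) (v : R -> R) (t : R) : Prop :=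
  [/\ {within `[0, t], continuous v},
      forall s, 0 < s < t -> derivable v s 1
    & mu.-integrable `]0, t[
        (fun s => ((t - s) `^ (- nu) * derive1 v s)%:E)].

(* (eta + d/dt)^nu u (t) *)
Definition tempered_caputo (eta nu : R) (u : R -> R) (t : R) : R :=
  expR (- eta * t) * caputo nu (fun s => expR (eta * s) * u s) t.

Definition tempered_caputo_exists (eta nu : R) (u : R -> R) (t : R) : Prop :=
  caputo_exists nu (fun s => expR (eta * s) * u s) t.

End special_functions.

Section processes.
Context {R : realType} {d : measure_display} {T : measurableType d}.
Context (P : probability T R).

Definition generated_events {I : Type} {d' : measure_display}
    {E : measurableType d'} (D : set I) (X : I -> T -> E) : set (set T) :=
  <<s \bigcup_(i in D) preimage_set_system setT (X i) measurable >>.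

Definition independent_events (F G : set (set T)) : Prop :=
  forall A B, F A -> G B -> (P (A `&` B) = P A * P B)%E.

(* Processes are indexed by [R], but only the times [t >= 0] are relevant. *)
Definition times : set R := [set t | 0 <= t].

Definition independent_processes {d1 d2 : measure_display}
    {E1 : measurableType d1} {E2 : measurableType d2}
    (X : R -> T -> E1) (Y : R -> T -> E2) : Prop :=
  independent_events (generated_events times X) (generated_events times Y).

Definition mutually_independent {d' : measure_display}
    {E : measurableType d'} (X : nat -> T -> E) : Prop :=
  forall (J : seq nat) (B : nat -> set E), uniq J ->
    (forall i, measurable (B i)) ->
    fine (P (\big[setI/setT]_(i <- J) (X i @^-1` B i))) =
    \prod_(i <- J) fine (P (X i @^-1` B i)).

Definition independent_increments (X : R -> T -> R) : Prop :=
  forall s : nat -> R, 0 <= s 0%N -> nondecreasing_seq s ->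
    mutually_independent (fun i w => X (s i.+1) w - X (s i) w).

Record increasing_additive_process (X : R -> T -> R) : Prop := {
  iap_measurable : forall t, 0 <= t -> measurable_fun setT (X t) ;
  iap_zero : forall w, X 0 w = 0 ;
  iap_nondecreasing : forall w s t, 0 <= s -> s <= t -> X s w <= X t w ;
  iap_right_continuous : forall w t, 0 <= t ->
    X s w @[s --> t^'+] --> X t w ;
  iap_independent_increments : independent_increments X }.

Record poisson_process (lambda : R) (N : R -> T -> nat) : Prop := {
  pp_additive : increasing_additive_process (fun t w => (N t w)%:R) ;
  pp_increments : forall s t (j : nat), 0 <= s -> s < t ->
    P [set w | N t w = (N s w + j)%N] =
    (poisson_pmf (lambda * (t - s)) j)%:E }.

Definition uniform_1_to (k : nat) (X : T -> nat) : Prop :=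
  measurable_fun setT X /\
  forall j : nat, P [set w | X w = j] =
    (if (1 <= j <= k)%N then k%:R^-1 else 0)%:E.

(* The jumps X_1, X_2, ... are [X 0], [X 1], ... *)
Definition poisson_process_of_order (k : nat) (lambda : R)
    (M : R -> T -> nat) : Prop :=
  exists (N : R -> T -> nat) (X : nat -> T -> nat),
    [/\ poisson_process (k%:R * lambda) N,
        forall i, uniform_1_to k (X i),
        mutually_independent X,
        independent_events (generated_events times N)
                           (generated_events setT X)
      & forall t w, 0 <= t -> M t w = (\sum_(i < N t w) X i w)%N].

Definition skellam_process_of_order (k : nat) (lambda1 lambda2 : R)
    (S : R -> T -> int) : Prop :=
  exists M1 M2 : R -> T -> nat,
    [/\ poisson_process_of_order k lambda1 M1,
        poisson_process_of_order k lambda2 M2,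
        independent_processes M1 M2
      & forall t w, 0 <= t -> S t w = (M1 t w)%:Z - (M2 t w)%:Z].

Record subordinator (D : R -> T -> R) : Prop := {
  sub_additive : increasing_additive_process D ;
  sub_stationary : forall s h (B : set R), 0 <= s -> 0 <= h -> measurable B ->
    P [set w | B (D (s + h) w - D s w)] = P [set w | B (D h w)] }.

Record tempered_stable_subordinator (eta nu : R) (D : R -> T -> R) : Prop := {
  tss_subordinator : subordinator D ;
  tss_laplace : forall t s, 0 <= t -> 0 < s ->
    ('E_P[fun w => expR (- s * D t w)])%E =
    (expR (- t * ((eta + s) `^ nu - eta `^ nu)))%:E }.

(* The set below is nonempty almost surely; on the exceptional null event
   [inf] takes its default value 0. *)
Definition inverse_process (D : R -> T -> R) (t : R) (w : T) : R :=
  inf [set s | 0 <= s /\ t < D s w].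

Definition inverse_TSS (eta nu : R) (L : R -> T -> R) : Prop :=
  exists2 D : R -> T -> R, tempered_stable_subordinator eta nu D &
    forall t w, 0 <= t -> L t w = inverse_process D t w.

Definition probability_density (X : T -> R) (f : R -> R) : Prop :=
  [/\ measurable_fun setT f, forall x, 0 <= f x
    & forall A : set R, measurable A ->
        P (X @^-1` A) = (\int[lebesgue_measure]_(x in A) (f x)%:E)%E].

Definition process_pmf (X : R -> T -> int) (n : int) (t : R) : R :=
  fine (P [set w | X t w = n]).

End processes.

(* Main.v *)
Require Import Defs.
From HB Require Import structures.
From mathcomp Require Import all_boot all_order all_algebra.
From mathcomp Require Import all_classical all_reals all_analysis.
From mathcomp Require Import measurable_realfun lebesgue_integral_under ring lra zify.
Set Implicit Arguments.
Unset Strict Implicit.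
Unset Printing Implicit Defensive.
Import Order.TTheory GRing.Theory Num.Theory.
Import numFieldNormedType.Exports.
Local Open Scope classical_set_scope.
Local Open Scope ring_scope.

(** The idea is to compare Laplace transforms in t.  Write A for the generator
    of S, that is A phi n = jump phi n - k (lambda1 + lambda2) phi n, let
    f(z) = (eta + z)^nu - eta^nu be the exponent of the subordinator D, whose
    inverse is L, and put B = A + eta^nu.

    Since S is a walk with bounded rates, its probabilities g_n(x) =
    Pr(S x = n) satisfy g' = A g; [difference_pmf_balance] is the integrated
    form, obtained from the explicit law of the two processes of order k.
    Since S and L are independent, pbar(n, t) is the mean of g_n (L t)
    ([subordinated_pmf]), and since L t > y means D y <= t up to a null event
    ([inverse_tail]), integrating the balance equation up to time L t gives
    pbar(n, t) = [n = 0] + A H(., t) n, where H_n(t) is the integral over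
    y > 0 of g_n(y) Pr(D y <= t) ([subordinated_pmfE]).

    To see that pbar is smooth enough for the fractional derivative to exist,
    H is computed explicitly.  Its transform at z is G_n / z, where G_n is the
    transform of g_n at f(z); the resolvent equation of S says that
    (y^nu - B) G = [n = 0] for y = z + eta.  As B is bounded, G is a Neumann
    series in y^-nu when y is large, and inverting it term by term shows that
    G_n is the transform at y of the fractional power series
    W_n(t) = sum_q (B^q [n = 0]) t^(nu (q+1) - 1) / Gamma (nu (q+1)).
    By uniqueness of Laplace transforms H_n is the primitive of
    e^(-eta t) W_n(t) ([occupation_potential]), so pbar is C^1 on t > 0 with a
    derivative bounded by a multiple of t^(nu - 1) near 0.

    The boundary term l(0, t) is the limit of Pr(L t <= x) / x =
    (1 - Pr(D x <= t)) / x as x tends to 0, so that its transform is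
    f(z) / z; inverting gives the explicit [boundary_density], whose leading
    part e^(-eta t) t^-nu / Gamma (1 - nu) is exactly the Mittag-Leffler term
    of the equation ([mittag_leffler3_diag]).

    Finally, after multiplication by e^(eta t), both sides of the equation are
    continuous in t > 0 and have the same transform at every large y by the
    resolvent equation, hence they agree ([conv_tilted_rateE]). *)

(** * Affine changes of variables *)

Section affine_change.
Context {R : realType}.
Local Notation mu := (@lebesgue_measure R).

Lemma measurable_affine (a b : R) : measurable_fun setT
  (fun x : measurableTypeR R => a * x + b : measurableTypeR R).
Proof. by apply: measurable_funD => //; exact: measurable_funM. Qed.

Definition affine_image (a b : R) :=
  measure_function_pushforward__canonical__measure_function_Measure mu
    (@measurable_affine a b).

(** Both sides are measures that agree on the intervals generating the Borel
    sets, and these determine the Lebesgue measure; a negative slope reverses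
    the interval, which costs only its end points. *)
Lemma lebesgue_measure_affine (a b : R) (A : set R) : a != 0 ->
  measurable A -> mu A = mscale (NngNum (normr_ge0 a)) (affine_image a b) A.
Proof.
move=> a0 mA; apply: lebesgue_measure_unique => // X [[x y] _ <-] /=.
rewrite /mscale/= /pushforward.
have xyE : ((x < y)%R = ((x - b) / `|a| < (y - b) / `|a|)%R).
  by rewrite ltr_pM2r ?invr_gt0 ?normr_gt0// ltrD2r.
have [a1|a1] := ltP 0 a.
  have -> : (fun x => a * x + b) @^-1` `]x, y] =
      `](x - b) / a, (y - b) / a]%classic.
    apply/seteqP; split => z /=; rewrite !in_itv/=;
    by rewrite ltr_pdivrMr// ler_pdivlMr// ltrBlDr lerBrDr (mulrC z).
  rewrite !lebesgue_measure_itv/= !lte_fin xyE gtr0_norm//.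
  case: ifPn => xy; last by rewrite mule0.
  by rewrite -!EFinD -EFinM; congr _%:E; field.
have {}a1 : a < 0 by rewrite lt_neqAle a0.
have -> : (fun x => a * x + b) @^-1` `]x, y] =
    `[(y - b) / a, (x - b) / a[%classic.
  apply/seteqP; split => z /=; rewrite !in_itv/=;
  by rewrite ltr_ndivlMr// ler_ndivrMr// ltrBlDr lerBrDr (mulrC z) andbC.
rewrite !lebesgue_measure_itv/= !lte_fin xyE ltr0_norm// invrN !mulrN ltrN2.
case: ifPn => xy; last by rewrite mule0.
by rewrite -!EFinD -EFinM; congr _%:E; field.
Qed.

Lemma ge0_integral_affine (f : R -> \bar R) (a b : R) : a != 0 ->
  measurable_fun setT f -> (forall x, 0 <= f x)%E ->
  (\int[mu]_x f (a * x + b)%R = (`|a|^-1)%:E * \int[mu]_x f x)%E.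
Proof.
move=> a0 mf f0.
transitivity (\int[affine_image a b]_x f x)%E.
  by rewrite ge0_integral_pushforward//; exact: measurable_affine.
have -> : (\int[mu]_x f x = `|a|%:E * \int[affine_image a b]_x f x)%E.
  rewrite -[X in (X%:E * _)%E]/((NngNum (normr_ge0 a))%:num).
  rewrite -ge0_integral_mscale//; apply: eq_measure_integral => A mA _.
  exact: lebesgue_measure_affine.
by rewrite muleA -EFinM mulVf ?normr_eq0// mul1e.
Qed.

Lemma integral_affine (f : R -> R) (a b : R) : a != 0 ->
  mu.-integrable setT (EFin \o f) ->
  mu.-integrable setT (fun x => (f (a * x + b))%:E) /\
  (\int[mu]_x (f (a * x + b))%:E = (`|a|^-1)%:E * \int[mu]_x (f x)%:E)%E.
Proof.
move=> a0 fi; have /integrableP[mf fy] := fi.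
split.
  apply/integrableP; split.
    move/measurable_EFinP : mf => mf; apply/measurable_EFinP.
    exact: (measurableT_comp mf (@measurable_affine a b)).
  rewrite (@ge0_integral_affine (abse \o (EFin \o f))); last 3 first.
  - by [].
  - exact: measurableT_comp.
  - by move=> x; exact: abse_ge0.
  by rewrite lte_mul_pinfty// lee_fin invr_ge0.
rewrite integralE [in RHS]integralE.
have E1 := @ge0_integral_affine ((EFin \o f)^\+)%E a b a0
  (measurable_funepos mf) (fun x => funepos_ge0 _ x).
have E2 := @ge0_integral_affine ((EFin \o f)^\-)%E a b a0
  (measurable_funeneg mf) (fun x => funeneg_ge0 _ x).
transitivity ((`|a|^-1)%:E * (\int[mu]_x ((EFin \o f)^\+ x)) -
  (`|a|^-1)%:E * (\int[mu]_x ((EFin \o f)^\- x)))%E.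
  congr (_ - _)%E.
  - by apply: etrans E1; apply: eq_integral => x _; rewrite !funeposE.
  - by apply: etrans E2; apply: eq_integral => x _; rewrite !funenegE.
by symmetry; apply: muleBr => //; exact: (integrable_add_def measurableT fi).
Qed.

End affine_change.

(** * Laplace transforms and their uniqueness *)

Section laplace.
Context {R : realType}.
Local Notation mu := (@lebesgue_measure R).
Local Notation Rpos := (`](0%R : R), +oo[%classic).
Implicit Types (f g : R -> R) (z c T a b m : R).

(** Integrability is part of the definition, so that transforms can be added
    and compared without case analysis on divergent integrals. *)
Definition has_laplace f z c : Prop :=
  mu.-integrable Rpos (fun t => (expR (- z * t) * f t)%:E) /\
  (\int[mu]_(t in Rpos) (expR (- z * t) * f t)%R%:E = c%:E)%E.

Lemma measurable_expR_lin z (D : set R) :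
  measurable_fun D (fun t : R => expR (- z * t)).
Proof.
by apply: measurable_funTS; apply: measurableT_comp => //; exact: measurable_funM.
Qed.

Lemma eq_has_laplace f g z c : (forall t, 0 < t -> f t = g t) ->
  has_laplace f z c -> has_laplace g z c.
Proof.
move=> fg [fi fc].
have E : {in Rpos, (fun t => (expR (- z * t) * f t)%:E) =1
    (fun t => (expR (- z * t) * g t)%:E)}.
  by move=> t; rewrite inE/= in_itv/= andbT => /fg ->.
split; first exact: eq_integrable fi.
by rewrite -fc; apply: eq_integral => t tD; rewrite E.
Qed.

Lemma has_laplace0 z : has_laplace (fun=> 0) z 0.
Proof.
split.
  apply: (@eq_integrable _ _ _ _ _ _ (cst 0%E)) => //; last exact: integrable0.
  by move=> t _; rewrite mulr0.
by under eq_integral do rewrite mulr0; rewrite integral0.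
Qed.

Lemma has_laplaceD f g z c d : has_laplace f z c -> has_laplace g z d ->
  has_laplace (fun t => f t + g t) z (c + d).
Proof.
move=> [fi fc] [gi gd].
have E : (fun t => (expR (- z * t) * (f t + g t))%:E) =
  (fun t => (expR (- z * t) * f t)%:E) \+ (fun t => (expR (- z * t) * g t)%:E).
  by apply/funext => t /=; rewrite mulrDr EFinD.
rewrite /has_laplace E; split; first exact: integrableD.
by rewrite integralD// fc gd EFinD.
Qed.

Lemma has_laplaceZ f z c k : has_laplace f z c ->
  has_laplace (fun t => k * f t) z (k * c).
Proof.
move=> [fi fc].
have E : (fun t => (expR (- z * t) * (k * f t))%:E) =
  (fun t => k%:E * (expR (- z * t) * f t)%:E)%E.
  by apply/funext => t /=; rewrite -EFinM mulrCA.
rewrite /has_laplace E; split; first exact: integrableZl.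
by rewrite integralZl// fc EFinM.
Qed.

Lemma has_laplaceB f g z c d : has_laplace f z c -> has_laplace g z d ->
  has_laplace (fun t => f t - g t) z (c - d).
Proof.
move=> fc gd; rewrite -[- d]mulN1r.
apply: eq_has_laplace (has_laplaceD fc (has_laplaceZ (-1) gd)) => t _.
by rewrite mulN1r.
Qed.

Lemma has_laplace_sum (I : Type) (s : seq I) (F : I -> R -> R) (c : I -> R) z :
  (forall i, has_laplace (F i) z (c i)) ->
  has_laplace (fun t => \sum_(i <- s) F i t) z (\sum_(i <- s) c i).
Proof.
move=> h; elim: s => [|i s ih].
  rewrite big_nil; apply: eq_has_laplace (has_laplace0 z) => t _.
  by rewrite big_nil.
rewrite big_cons; apply: eq_has_laplace (has_laplaceD (h i) ih) => t _.
by rewrite big_cons.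
Qed.

Lemma has_laplace_shift f e z c : has_laplace f (z + e) c ->
  has_laplace (fun t => expR (- e * t) * f t) z c.
Proof.
have E : (fun t => (expR (- z * t) * (expR (- e * t) * f t))%:E) =
    (fun t => (expR (- (z + e) * t) * f t)%:E).
  by apply/funext => t; rewrite mulrA -expRD -mulrDl -opprD.
by rewrite /has_laplace E.
Qed.

Lemma has_laplace_uniq f z c d : has_laplace f z c -> has_laplace f z d -> c = d.
Proof. by move=> [_ h] [_]; rewrite h => -[]. Qed.

Lemma ge0_has_laplace f z c : measurable_fun Rpos f ->
  (forall t, 0 < t -> 0 <= f t) ->
  (\int[mu]_(t in Rpos) (expR (- z * t) * f t)%R%:E = c%:E)%E ->
  has_laplace f z c.
Proof.
move=> mf f0 h; split=> //; apply/integrableP; split.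
  by apply/measurable_EFinP; apply: measurable_funM => //; exact: measurable_expR_lin.
rewrite [X in (X < _)%E](_ : _ = c%:E) ?ltry// -h.
apply: eq_integral => t; rewrite inE/= in_itv/= andbT => t0.
by rewrite ger0_norm ?mulr_ge0 ?expR_ge0 ?f0.
Qed.

Lemma has_laplace_measurable f z c : has_laplace f z c ->
  measurable_fun Rpos f.
Proof.
move=> [/measurable_int/measurable_EFinP mf _].
apply: (eq_measurable_fun (fun t => expR (z * t) * (expR (- z * t) * f t))).
  by move=> t _; rewrite mulrA -expRD mulNr addrN expR0 mul1r.
apply: measurable_funM => //; rewrite -[z]opprK.
exact: measurable_expR_lin.
Qed.

Section uniqueness.

Lemma bernoulli_ge (x : R) n : 0 <= x <= 1 -> 1 - n%:R * x <= (1 - x) ^+ n.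
Proof.
move=> /andP[x0 x1]; elim: n => [|n ih]; first by rewrite mul0r subr0 expr0.
rewrite exprS; apply: (@le_trans _ _ ((1 - x) * (1 - n%:R * x))); last first.
  by apply: ler_wpM2l => //; rewrite subr_ge0.
have : 0 <= n%:R * x * x by rewrite !mulr_ge0.
rewrite -natr1; nra.
Qed.

Lemma bernoulli_le (x : R) n : 0 <= x <= 1 ->
  (1 - x) ^+ n * (1 + n%:R * x) <= 1.
Proof.
move=> /andP[x0 x1]; elim: n => [|n ih]; first by rewrite mul0r addr0 expr0 mulr1.
apply: le_trans ih; rewrite exprS -mulrA mulrCA.
apply: ler_wpM2l; first by rewrite exprn_ge0// subr_ge0.
have : 0 <= n%:R * x * x by rewrite !mulr_ge0.
rewrite -natr1; nra.
Qed.

(** A polynomial in e^(-t) of degree growing with n that tends to the indicator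
    of t > T: the base 1 - e^(-n t) is raised to a power close to e^(n T), so
    that Bernoulli's inequality decides which exponential wins. *)
Definition step_weight (T : R) (n : nat) (t : R) : R :=
  (1 - expR (- n%:R * t)) ^+ Num.truncn (expR (n%:R * T)).

Lemma expR_itv01 (n : nat) (t : R) : 0 <= t -> 0 <= expR (- n%:R * t) <= 1.
Proof.
by move=> t0; rewrite expR_ge0 -[leRHS]expR0 ler_expR mulNr oppr_le0 mulr_ge0.
Qed.

Lemma step_weight_itv01 T n t : 0 <= t -> 0 <= step_weight T n t <= 1.
Proof.
move=> t0; have /andP[x0 x1] := expR_itv01 n t0.
by rewrite /step_weight exprn_ge0 ?subr_ge0//= exprn_ile1 ?subr_ge0// gerBl.
Qed.

Lemma expRn_cvg0 (a : R) : 0 < a -> expR (- n%:R * a) @[n --> \oo] --> 0.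
Proof.
move=> a0; under eq_fun do rewrite mulNr -mulrN expRM_natl.
by apply: cvg_expr; rewrite ger0_norm ?expR_ge0// expR_lt1 oppr_lt0.
Qed.

Lemma step_weight_cvg1 T t : T < t -> 0 <= t ->
  step_weight T n t @[n --> \oo] --> (1 : R).
Proof.
move=> Tt t0.
apply: (@squeeze_cvgr _ _ _ _ (fun n : nat => 1 - expR (- n%:R * (t - T)))
    (fun=> 1)); last 2 first.
- by rewrite -[X in _ --> X]subr0; apply: cvgB; [exact: cvg_cst|
    apply: expRn_cvg0; rewrite subr_gt0].
- exact: cvg_cst.
near=> n; have /andP[_ ->] := step_weight_itv01 T n t0; rewrite andbT.
apply: le_trans (bernoulli_ge _ (expR_itv01 n t0)).
rewrite lerD2l lerN2 mulrBr !mulNr opprK addrC expRD.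
rewrite ler_wpM2r ?expR_ge0//.
by have /andP[] := Num.Theory.truncn_itv (expR_ge0 (n%:R * T)).
Unshelve. all: by end_near. Qed.

Lemma step_weight_cvg0 T t : t < T -> 0 <= t ->
  step_weight T n t @[n --> \oo] --> (0 : R).
Proof.
move=> tT t0.
apply: (@squeeze_cvgr _ _ _ _ (fun=> 0) (fun n : nat => expR (- n%:R * (T - t))));
  last 2 first.
- exact: cvg_cst.
- by apply: expRn_cvg0; rewrite subr_gt0.
near=> n; have /andP[w0 _] := step_weight_itv01 T n t0; rewrite w0/=.
rewrite mulNr expRN -[leRHS]mul1r ler_pdivlMr ?expR_gt0//.
apply: le_trans (bernoulli_le (Num.truncn (expR (n%:R * T))) (expR_itv01 n t0)).
apply: ler_wpM2l => //.
have /andP[_ h] := Num.Theory.truncn_itv (expR_ge0 (n%:R * T)).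
have /andP[x0 x1] := expR_itv01 n t0.
rewrite mulrBr expRD -mulNr; move: h; rewrite -natr1.
set x := expR (- _ * t) in x0 x1 *; set K := _%:R; set y := expR _ => h.
nra.
Unshelve. all: by end_near. Qed.

(** Expanding the power, f times a polynomial in e^(-n t) integrates against
    e^(-c t) to a combination of transforms of f at the points c + j, all 0. *)
Lemma has_laplace0_step f c : (forall j : nat, has_laplace f (c + j%:R) 0) ->
  forall n K j, has_laplace (fun t => (1 - expR (- n%:R * t)) ^+ K * f t)
    (c + j%:R) 0.
Proof.
move=> h n; elim=> [j|K ih j].
  by apply: eq_has_laplace (h j) => t _; rewrite expr0 mul1r.
have h1 := ih j; have := ih (j + n)%N; rewrite natrD addrA => /has_laplace_shift h2.
rewrite -[0]subr0; apply: eq_has_laplace (has_laplaceB h1 h2) => t _.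
by rewrite exprS; ring.
Qed.

Lemma cvgn_EFin (u : nat -> R) (l : R) : u n @[n --> \oo] --> l ->
  (u n)%:E @[n --> \oo] --> l%:E.
Proof. by move=> ul; apply: cvg_EFin; first exact: nearW. Qed.

(** By dominated convergence the vanishing integrals of the [step_weight]
    multiples of f tend to the integral of e^(-c t) f t over t > T. *)
Lemma laplace0_tail f c T : 0 < T ->
  (forall j : nat, has_laplace f (c + j%:R) 0) ->
  (\int[mu]_(t in `](T : R), +oo[) (expR (- c * t) * f t)%R%:E = 0)%E.
Proof.
move=> T0 h.
pose F t := expR (- c * t) * f t.
have iF : mu.-integrable Rpos (EFin \o F).
  by have [] := h 0%N; rewrite mulr0n addr0.
pose G t := \1_(`]T, +oo[%classic) t * F t.
pose Fn n t := step_weight T n t * F t.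
have mF : measurable_fun Rpos F by case/integrableP: iF => /measurable_EFinP.
have sTpos : `]T, +oo[ `<=` Rpos.
  by move=> t /=; rewrite !in_itv/= !andbT; exact: lt_trans.
have int0 n : (\int[mu]_(t in Rpos) (Fn n t)%:E = 0)%E.
  have [_] := has_laplace0_step h n (Num.truncn (expR (n%:R * T))) 0.
  rewrite mulr0n addr0 => E; rewrite -[RHS]/(0%:E) -E; apply: eq_integral => t _.
  by rewrite /Fn /F /step_weight mulrCA.
have mw n : measurable_fun Rpos (step_weight T n).
  apply: measurable_funX; apply: measurable_funB => //.
  exact: measurable_expR_lin.
have [||||||_ _] := @dominated_convergence _ _ _ mu Rpos _
    (fun n t => (Fn n t)%:E) (EFin \o G) (abse \o (EFin \o F)).
- by [].
- move=> n; apply/measurable_EFinP; rewrite /Fn; apply: measurable_funM;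
    [exact: mw|exact: mF].
- by apply/measurable_EFinP; rewrite /G; apply: measurable_funM.
- exists [set T]; split => //; first exact: lebesgue_measure_set1.
  move=> t /= /not_implyP[+ nc]; rewrite in_itv/= andbT => t0.
  apply: contrapT => tT; apply: nc; apply: cvgn_EFin.
  rewrite /G indicE; apply: cvgMl.
  case: (ltgtP t T) => [tT'|tT'|//]; last first.
  + by rewrite mem_set/= ?in_itv/= ?tT'//; exact: step_weight_cvg1 (ltW t0).
  + rewrite memNset/= ?in_itv/= ?ltNge ?(ltW tT')//.
    exact: step_weight_cvg0 (ltW t0).
- exact: integrable_abse.
- apply/aeW => t n /=; rewrite in_itv/= andbT => t0.
  rewrite lee_fin normrM ler_piMl// ger0_norm.
  + by have /andP[] := step_weight_itv01 T n (ltW t0).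
  + by have /andP[] := step_weight_itv01 T n (ltW t0).
under eq_fun do rewrite int0.
move=> /(@cvg_unique _ (@ereal_hausdorff R) _ _ _ _ (cvg_cst _)) E.
apply: etrans (esym E); rewrite -(setIidr sTpos) integral_mkcondr; apply: eq_integral => t _.
rewrite /G/= patchE indicE; case: ifPn => _ /=; by rewrite ?mul1r ?mul0r.
Qed.

Lemma laplace0_itv f c a b : 0 < a -> a < b ->
  (forall j : nat, has_laplace f (c + j%:R) 0) ->
  (\int[mu]_(t in `](a : R), b]) (expR (- c * t) * f t)%R%:E = 0)%E.
Proof.
move=> a0 ab h.
have ha := laplace0_tail a0 h; have hb := laplace0_tail (lt_trans a0 ab) h.
have mf : measurable_fun Rpos (fun t => (expR (- c * t) * f t)%:E).
  by have [/integrableP[]] := h 0%N; rewrite mulr0n addr0.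
have E : `]a, +oo[%classic = `]a, b] `|` `]b, +oo[.
  by apply: itv_bndbnd_setU; rewrite bnd_simp// ltW.
move: ha; rewrite E integral_setU//.
- by rewrite hb adde0.
- rewrite -E; apply: measurable_funS mf => // t /=.
  by rewrite !in_itv/= !andbT; exact: lt_trans.
- apply/disj_setPS => t [] /=; rewrite !in_itv/= andbT => /andP[_ tb] bt.
  by have := le_lt_trans tb bt; rewrite ltxx.
Qed.

(** Vanishing tails give vanishing integrals over intervals, which is
    impossible on an interval where f stays above a positive constant. *)
Lemma laplace0_not_above f c a b m : 0 < a -> a < b -> 0 < m ->
  (forall j : nat, has_laplace f (c + j%:R) 0) ->
  ~ (forall t, a < t <= b -> m <= f t).
Proof.
move=> a0 ab m0 h fm; have := laplace0_itv a0 ab h; apply/eqP.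
rewrite gt_eqF//.
have mf : measurable_fun `]a, b] (fun t => (expR (- c * t) * f t)%:E).
  have [/integrableP[+ _] _] := h 0%N; rewrite mulr0n addr0.
  apply: measurable_funS => // t /=.
  by rewrite !in_itv/= !andbT => /andP[+ _]; exact: lt_trans.
pose k := expR (- `|c| * b) * m.
apply: (@lt_le_trans _ _ (\int[mu]_(t in `](a : R), b]) k%:E)%E).
  rewrite integral_cst//= lebesgue_measure_itv/= lte_fin ab -EFinD -EFinM.
  by rewrite lte_fin !mulr_gt0 ?expR_gt0 ?subr_gt0.
apply: ge0_le_integral => //.
- by move=> t _; rewrite lee_fin mulr_ge0 ?expR_ge0 ?ltW.
- move=> t /=; rewrite in_itv/= => tab; rewrite lee_fin ler_pM ?expR_ge0 ?(ltW m0) ?fm//.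
  have /andP[at_ tb] := tab; have t0 : 0 < t := lt_trans a0 at_.
  rewrite ler_expR !mulNr lerN2 (le_trans (ler_norm _))// normrM (gtr0_norm t0).
  by rewrite ler_wpM2l.
Qed.

(** Monotonicity replaces continuity of f: if f and g differ at t, then by
    continuity of g and monotonicity of f they stay apart on an interval with
    end point t, to its right if f t > g t and to its left if f t < g t.  Only
    the values of the transforms along an arithmetic progression matter. *)
Lemma laplace_unique_nondecreasing f g c (d : nat -> R) :
  (forall j : nat, has_laplace f (c + j%:R) (d j)) ->
  (forall j : nat, has_laplace g (c + j%:R) (d j)) ->
  (forall s t, 0 < s -> s <= t -> f s <= f t) ->
  (forall t, 0 < t -> {for t, continuous g}) ->
  forall t, 0 < t -> f t = g t.
Proof.
move=> hf hg ndf cg t t0.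
have hfg j : has_laplace (fun t => f t - g t) (c + j%:R) 0.
  by rewrite -(subrr (d j)); exact: has_laplaceB.
have hgf j : has_laplace (fun t => g t - f t) (c + j%:R) 0.
  by rewrite -(subrr (d j)); exact: has_laplaceB.
case: (ltgtP (f t) (g t)) => // fgt; exfalso.
- pose m := (g t - f t) / 2; have m0 : 0 < m by rewrite divr_gt0 ?subr_gt0.
  have /cvgrPdist_le/(_ _ m0)/nbhs_ballP[e /= e0 he] := cg _ t0.
  pose b := Num.min (e / 2) (t / 2).
  have b0 : 0 < b by rewrite lt_min !divr_gt0.
  have bt : b < t by rewrite gt_min; apply/orP; right; lra.
  have be : b < e by rewrite gt_min; apply/orP; left; lra.
  apply: (@laplace0_not_above _ c (t - b) t m _ _ m0 hgf); [lra|lra|].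
  move=> s /andP[sb st]; have s0 : 0 < s by lra.
  have /= := he s; rewrite /ball/= => /(_ _)/wrap[].
    by rewrite ger0_norm; lra.
  rewrite ler_norml => /andP[_ h1]; have := ndf _ _ s0 st.
  by rewrite /m in h1 *; lra.
- pose m := (f t - g t) / 2; have m0 : 0 < m by rewrite divr_gt0 ?subr_gt0.
  have /cvgrPdist_le/(_ _ m0)/nbhs_ballP[e /= e0 he] := cg _ t0.
  apply: (@laplace0_not_above _ c t (t + e / 2) m _ _ m0 hfg); [lra|lra|].
  move=> s /andP[sb st].
  have /= := he s; rewrite /ball/= => /(_ _)/wrap[].
    by rewrite ltr0_norm; lra.
  rewrite ler_norml => /andP[h1 _]; have := ndf _ _ t0 (ltW sb).
  by rewrite /m in h1 *; lra.
Qed.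

Lemma laplace_unique_continuous f g c (d : nat -> R) :
  (forall j : nat, has_laplace f (c + j%:R) (d j)) ->
  (forall j : nat, has_laplace g (c + j%:R) (d j)) ->
  (forall t, 0 < t -> {for t, continuous f}) ->
  (forall t, 0 < t -> {for t, continuous g}) ->
  forall t, 0 < t -> f t = g t.
Proof.
move=> hf hg cf cg.
have h j : has_laplace (fun t => f t - g t) (c + j%:R) 0.
  by rewrite -(subrr (d j)); exact: has_laplaceB.
have h0 j : has_laplace (fun=> 0) (c + j%:R) 0 by exact: has_laplace0.
move=> t t0; apply/eqP; rewrite -subr_eq0; apply/eqP; apply/esym.
apply: (@laplace_unique_nondecreasing (fun=> 0) (fun t => f t - g t) _
  (fun=> 0) h0 h) => // s s0.
by apply: cvgB; [exact: cf|exact: cg].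
Qed.

End uniqueness.
End laplace.

(** * The Gamma function and the Riemann-Liouville kernels *)

Section gamma.
Context {R : realType}.
Local Notation mu := (@lebesgue_measure R).
Local Notation Rpos := (`](0%R : R), +oo[%classic).
Implicit Types (a b x y z t M : R).

Lemma continuous_powR_gt0 a t : 0 < t -> {for t, continuous (fun s => s `^ a)}.
Proof.
move=> t0; apply/differentiable_continuous/derivable1_diffP.
by apply: derivable_powR; rewrite in_itv/= t0.
Qed.

Lemma continuous_expR_lin z t : {for t, continuous (fun s => expR (z * s))}.
Proof. by apply: continuous_comp; [exact: mulrl_continuous|exact: continuous_expR]. Qed.

Lemma measurable_powRl a (D : set R) : measurable_fun D (fun t : R => t `^ a).
Proof. by apply: measurable_funTS; exact: measurable_powR. Qed.

Lemma integral_expR_tail z a : 0 < z ->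
  (\int[mu]_(t in `[a, +oo[) (expR (- z * t))%:E = (expR (- z * a) / z)%:E)%E.
Proof.
move=> z0.
have dF (t : R) : is_derive t 1 (fun t => - (expR (- z * t) / z)) (expR (- z * t)).
  apply: is_derive_eq.
  rewrite !scaler1 /GRing.scale/= ; field; rewrite gt_eqF//.
rewrite (@ge0_continuous_FTC2y _ _ (fun t => - (expR (- z * t) / z)) a 0).
- by rewrite -EFinB; congr _%:E; lra.
- by move=> t _; exact: expR_ge0.
- apply: continuous_subspaceT => t.
  exact: continuous_expR_lin.
- rewrite -oppr0 -(mul0r z^-1); apply: cvgN; apply: cvgMl.
  under eq_fun do rewrite mulNr.
  apply: (@cvg_comp _ _ _ (fun t => z * t) (fun s => expR (- s)) _ (+oo%R)).
    by apply: gt0_cvgMry => //; exact: cvg_id.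
  exact: cvgr_expR.
- by move=> t _; exact: ex_derive.
- apply: cvg_at_right_filter.
  have c0 : {for a, continuous (fun t => - (expR (- z * t) / z))}.
    by apply/differentiable_continuous/derivable1_diffP; exact: ex_derive.
  exact: c0.
- by move=> t _; rewrite derive1E; exact: derive_val.
Qed.

Lemma has_laplace_cst z k : 0 < z -> has_laplace (fun=> k) z (k / z).
Proof.
move=> z0; suff h : has_laplace (fun=> 1) z (1 / z).
  have := has_laplaceZ k h; rewrite mul1r; apply: eq_has_laplace => t _.
  by rewrite mulr1.
apply: ge0_has_laplace => //.
under eq_integral do rewrite mulr1.
rewrite integral_itv_obnd_cbnd; last first.
  by apply/measurable_EFinP; exact: measurable_expR_lin.
by rewrite integral_expR_tail// mulr0 expR0.
Qed.

(** The function t^a / a is a primitive of t^(a-1). *)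
Lemma integral_powR_cc_le a b e : 0 < a -> 0 < e -> e < b ->
  (\int[mu]_(t in `[e, b]) (t `^ (a - 1))%:E <= (b `^ a / a)%:E)%E.
Proof.
move=> a0 e0 eb.
have gt0 (t : R) : t \in `[e, b] -> 0 < t.
  by rewrite in_itv/= => /andP[+ _]; exact: lt_le_trans.
have dpow (t : R) : 0 < t -> is_derive t 1 (fun t => t `^ a / a) (t `^ (a - 1)).
  move=> t0; have h := is_derive1_powR a t0.
  apply: is_derive_eq; rewrite scaler0 add0r /GRing.scale/=; field.
  by rewrite gt_eqF.
have cpow (t : R) : 0 < t -> {for t, continuous (fun t => t `^ a / a)}.
  by move=> t0; apply: cvgMl; exact: continuous_powR_gt0.
rewrite (@continuous_FTC2 _ _ (fun t => t `^ a / a))//.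
- rewrite -EFinB lee_fin lerBlDr lerDl divr_ge0 ?powR_ge0 ?ltW//.
- apply: continuous_in_subspaceT => t; rewrite inE => /gt0 t0.
  exact: continuous_powR_gt0.
- split.
  + move=> t; rewrite in_itv/= => /andP[et _]; have t0 := lt_trans e0 et.
    by have h := dpow _ t0; exact: ex_derive.
  + by apply: cvg_at_right_filter; apply: cpow.
  + by apply: cvg_at_left_filter; apply: cpow; exact: lt_trans eb.
- move=> t; rewrite in_itv/= => /andP[et _]; have t0 := lt_trans e0 et.
  by rewrite derive1E; have h := dpow _ t0; rewrite derive_val.
Qed.

(** The exponent a - 1 may be negative, so the bound is first obtained away
    from the singularity at 0 and then passed to the limit. *)
Lemma integral_powR_oc_le a b : 0 < a -> 0 < b ->
  (\int[mu]_(t in `](0%R:R), b]) (t `^ (a - 1))%:E <= (b `^ a / a)%:E)%E.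
Proof.
move=> a0 b0.
pose F (i : nat) : set R := `[b / i.+2%:R, b]%classic.
have FU : \bigcup_i F i = `](0%R:R), b]%classic.
  apply/seteqP; split => [t [i _]|t]; rewrite /F/= !in_itv/=.
    by move=> /andP[h ->]; rewrite andbT (lt_le_trans _ h)// divr_gt0.
  move=> /andP[t0 tb]; exists (Num.truncn (b / t)) => //=.
  rewrite in_itv/= tb andbT ler_pdivrMr//.
  have /andP[_ h] := Num.Theory.truncn_itv (ltW (divr_gt0 b0 t0)).
  move: h; rewrite ltr_pdivrMr// mulrC => /ltW/le_trans; apply.
  by rewrite ler_pM2l// ler_nat.
rewrite -FU.
have mpow : measurable_fun setT (fun t : R => (t `^ (a - 1))%:E).
  by apply/measurable_EFinP; exact: measurable_powR.
have := @ge0_nondecreasing_set_cvg_integral _ (measurableTypeR R) R F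
  (fun t => (t `^ (a - 1))%:E) mu.
move=> /(_ _ _ _ _)/wrap[] => [m n mn|i|i|i t _|h].
- apply/subsetPset => t; rewrite /F/= !in_itv/= => /andP[h ->].
  rewrite andbT (le_trans _ h)// ler_pM2l// lef_pV2 ?posrE//.
  by rewrite ler_nat !ltnS.
- exact: measurable_itv.
- exact: measurable_funTS.
- by rewrite lee_fin powR_ge0.
rewrite -(cvg_lim (@ereal_hausdorff R) h); apply: lime_le.
  by apply/cvg_ex; eexists; exact: h.
apply: nearW => n; apply: integral_powR_cc_le => //; first by rewrite divr_gt0.
by rewrite ltr_pdivrMr// ltr_pMr// ltr1n.
Qed.

Lemma integrable_powR a b : 0 < a ->
  mu.-integrable `](0%R:R), b] (fun t => (t `^ (a - 1))%:E).
Proof.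
move=> a0; have [b0|b0] := ltP 0 b; last first.
  by rewrite set_itv_ge ?bnd_simp -?leNgt//; exact: integrable_set0.
apply/integrableP; split; first by apply/measurable_EFinP; exact: measurable_powRl.
apply: le_lt_trans (ltry (b `^ a / a)).
under eq_integral do rewrite gee0_abs ?lee_fin ?powR_ge0//.
exact: integral_powR_oc_le.
Qed.

(** For an integer power this is (t / (2 n))^n <= e^(t / 2), from
    x <= e^x. *)
Lemma powR_le_expR a : exists2 C, 0 < C & forall t, 1 <= t -> t `^ a <= C * expR (t / 2).
Proof.
have [n an] : exists n : nat, a <= n.+1%:R.
  exists (Num.truncn `|a|); apply: le_trans (ler_norm _) _.
  by have /andP[_ /ltW] := Num.Theory.truncn_itv (normr_ge0 a).
exists ((2 * n.+1%:R) ^+ n.+1); first by rewrite exprn_gt0// mulr_gt0.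
move=> t t1; apply: (@le_trans _ _ (t `^ n.+1%:R)); first exact: ler_powR.
have t0 : 0 <= t by apply: le_trans t1.
rewrite powR_mulrn//.
have -> : t / 2 = n.+1%:R * (t / (2 * n.+1%:R)).
  have N0 : (n.+1%:R : R) != 0 by rewrite pnatr_eq0.
  by move: (n.+1%:R : R) N0 => N N0; field.
rewrite expRM_natl -exprMn lerXn2r ?nnegrE ?mulr_ge0 ?expR_ge0//.
rewrite -ler_pdivrMl ?mulr_gt0//.
by apply: le_trans (expR_ge1Dx _); rewrite mulrC lerDr.
Qed.

Definition gamma_integrand a t := t `^ (a - 1) * expR (- t).

Lemma measurable_gamma_integrand a D : measurable_fun D (gamma_integrand a).
Proof.
apply: measurable_funM; first exact: measurable_powRl.
by under eq_fun do rewrite -mulN1r; exact: measurable_expR_lin.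
Qed.

Lemma gamma_integrand_ge0 a t : 0 <= gamma_integrand a t.
Proof. by rewrite mulr_ge0 ?powR_ge0 ?expR_ge0. Qed.

Lemma integrable_gamma a : 0 < a ->
  mu.-integrable Rpos (EFin \o gamma_integrand a).
Proof.
move=> a0.
have [C C0 hC] := powR_le_expR (a - 1).
have mg D : measurable_fun D (EFin \o gamma_integrand a).
  by apply/measurable_EFinP; exact: measurable_gamma_integrand.
have i1 : mu.-integrable `](0%R:R), 1] (EFin \o gamma_integrand a).
  apply: le_integrable (integrable_powR 1 a0); [by []|exact: mg|].
  move=> t /=; rewrite in_itv/= => /andP[t0 _].
  rewrite lee_fin !ger0_norm ?gamma_integrand_ge0 ?powR_ge0//.
  by rewrite /gamma_integrand ler_piMr ?powR_ge0// expR_le1 oppr_le0 ltW.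
have i2 : mu.-integrable `](1%R:R), +oo[ (EFin \o gamma_integrand a).
  have z0 : 0 < (2^-1 : R) by rewrite invr_gt0.
  have [ic _] := has_laplace_cst C z0.
  have ic1 : mu.-integrable `](1%R:R), +oo[ (fun t => (expR (- 2^-1 * t) * C)%:E).
    apply: integrableS ic => // t /=; rewrite !in_itv/= !andbT.
    exact: lt_trans.
  apply: le_integrable ic1; [by []|exact: mg|].
    move=> t /=; rewrite in_itv/= andbT => t1.
    rewrite lee_fin !ger0_norm ?gamma_integrand_ge0 ?mulr_ge0 ?expR_ge0 ?(ltW C0)//.
    apply: (@le_trans _ _ (C * expR (t / 2) * expR (- t))).
      by rewrite /gamma_integrand ler_wpM2r ?expR_ge0 ?hC ?ltW.
    by rewrite -mulrA -expRD mulrC ler_wpM2r ?(ltW C0)// ler_expR; lra.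
have -> : Rpos = `]0, 1] `|` `]1, +oo[ by apply: itv_bndbnd_setU; rewrite bnd_simp.
have [_ h1] := integrableP _ _ _ i1; have [_ h2] := integrableP _ _ _ i2.
apply/integrableP; split; first exact: mg.
rewrite ge0_integral_setU//=.
- by rewrite lte_add_pinfty.
- by apply/measurable_EFinP; apply: (measurableT_comp (@normr_measurable R setT)); exact: measurable_gamma_integrand.
- apply/disj_setPS => t [] /=; rewrite !in_itv/= andbT => /andP[_ tb] bt.
  by have := le_lt_trans tb bt; rewrite ltxx.
Qed.

Lemma Gamma_EFin a : 0 < a ->
  (\int[mu]_(t in Rpos) (gamma_integrand a t)%:E = (Gamma a)%:E)%E.
Proof.
by move=> a0; rewrite /Gamma /Rintegral fineK//; apply: integrable_fin_num => //;
  exact: integrable_gamma.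
Qed.

(** Keep only the part of the integral over M < t <= 2 M.  As M is arbitrary,
    Gamma grows faster than any geometric sequence, which is what the
    convergence of fractional power series requires. *)
Lemma Gamma_lower_bound a M : 0 < a -> 0 < M ->
  expR (- (2 * M)) * M `^ a / 2 <= Gamma a.
Proof.
move=> a0 M0; rewrite -lee_fin -Gamma_EFin//.
pose I : set R := `]M, (2 * M)]%classic.
have mI : measurable I by exact: measurable_itv.
have IR : I `<=` Rpos.
  by move=> t /=; rewrite /I/= !in_itv/= andbT => /andP[+ _]; exact: lt_trans.
apply: (@le_trans _ _ (\int[mu]_(t in I) (gamma_integrand a t)%:E)%E); last first.
  apply: ge0_subset_integral => //.
  - by apply/measurable_EFinP; exact: measurable_gamma_integrand.
  - by move=> t _; rewrite lee_fin gamma_integrand_ge0.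
apply: (@le_trans _ _ (\int[mu]_(t in I) (expR (- (2 * M)) * M `^ a / (2 * M))%:E)%E).
  rewrite integral_cst//= /I lebesgue_measure_itv/= lte_fin ltr_pMl// ltr1n.
  rewrite -EFinD -EFinM lee_fin le_eqVlt; apply/orP; left; apply/eqP.
  by field; rewrite gt_eqF.
apply: ge0_le_integral => //.
- by move=> t _; rewrite lee_fin divr_ge0 ?mulr_ge0 ?expR_ge0 ?powR_ge0 ?ltW.
- by apply/measurable_EFinP; exact: measurable_gamma_integrand.
- move=> t; rewrite /I/= in_itv/= => /andP[Mt tM].
  have t0 := lt_trans M0 Mt.
  rewrite lee_fin /gamma_integrand -mulrA mulrC ler_pM ?expR_ge0//.
  + by rewrite divr_ge0 ?powR_ge0 ?mulr_ge0 ?ltW.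
  + rewrite powRB; last by rewrite (gt_eqF t0) implybT.
    rewrite powRr1 ?(ltW t0)//; apply: ler_pM; rewrite ?powR_ge0//.
    * by rewrite invr_ge0 mulr_ge0 ?(ltW M0).
    * by rewrite ge0_ler_powR ?nnegrE ?(ltW M0) ?(ltW t0) ?(ltW a0) ?(ltW Mt).
    * by rewrite lef_pV2 ?posrE ?mulr_gt0.
  + by rewrite ler_expR lerN2.
Qed.

Lemma Gamma_gt0 a : 0 < a -> 0 < Gamma a.
Proof.
move=> a0; apply: lt_le_trans (Gamma_lower_bound a0 ltr01).
by rewrite !divr_gt0 ?mulr_gt0 ?expR_gt0 ?powR_gt0.
Qed.

(** The kernel of the fractional integral of order a; these kernels form a
    convolution semigroup, and their Laplace transforms are negative powers. *)
Definition rl_kernel a t := t `^ (a - 1) / Gamma a.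

(** The change of variables t to z t reduces the transform to the integral
    defining Gamma. *)
Lemma has_laplace_rl_kernel a z : 0 < a -> 0 < z ->
  has_laplace (rl_kernel a) z (z `^ (- a)).
Proof.
move=> a0 z0; have G0 := Gamma_gt0 a0.
apply: ge0_has_laplace.
- by apply: measurable_funM => //; exact: measurable_powRl.
- by move=> t _; rewrite divr_ge0 ?powR_ge0 ?ltW.
pose f := (EFin \o gamma_integrand a) \_ Rpos.
have f0 x : (0 <= f x)%E.
  by apply: erestrict_ge0 => t _; rewrite lee_fin gamma_integrand_ge0.
have mf : measurable_fun setT f.
  apply/(measurable_restrictT _ _).1 => //; apply/measurable_EFinP.
  exact: measurable_gamma_integrand.
have E : (\int[mu]_x f (z * x + 0)%R = z^-1%:E * (Gamma a)%:E)%E.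
  rewrite ge0_integral_affine ?gt_eqF// gtr0_norm//.
  by rewrite -integral_mkcond -Gamma_EFin.
transitivity (((z `^ (1 - a)) / Gamma a)%:E * (z^-1%:E * (Gamma a)%:E))%E; last first.
  rewrite -!EFinM; congr _%:E.
  rewrite powRB; last by rewrite (gt_eqF z0) implybT.
  rewrite powRr1 ?ltW// powRN.
  by field; rewrite !gt_eqF// powR_gt0.
rewrite -E -ge0_integralZl//; last 2 first.
- apply: measurableT_comp => //.
  by apply: measurable_funD => //; exact: measurable_funM.
- by rewrite lee_fin divr_ge0 ?powR_ge0 ?ltW.
rewrite [LHS]integral_mkcond; apply: eq_integral => t _.
rewrite addr0 /f !patchE.
have -> : (t \in Rpos) = (z * t \in Rpos).
  by apply/idP/idP; rewrite !inE/= !in_itv/= !andbT pmulr_rgt0.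
case: ifPn; last by rewrite mule0.
rewrite inE/= in_itv/= andbT pmulr_rgt0// => t0.
rewrite -EFinM /gamma_integrand /rl_kernel; congr _%:E.
rewrite powRM ?ltW// -[1 - a]opprB powRN mulNr.
by field; rewrite !gt_eqF// powR_gt0.
Qed.

End gamma.

(** * Convolution on the half-line *)

Section convolution.
Context {R : realType}.
Local Notation mu := (@lebesgue_measure R).
Local Notation Rpos := (`](0%R : R), +oo[%classic).
Implicit Types (k f : R -> R) (a b z c d t : R).

Definition conv k f t := \int[mu]_(s in `]0, t[) (k (t - s) * f s).

Lemma integrable_itv01 f x : measurable_fun Rpos f ->
  (forall y, 0 < y -> 0 <= f y <= 1) -> mu.-integrable `](0%R:R), x[ (EFin \o f).
Proof.
move=> mf f01; apply: measurable_bounded_integrable => //.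
- by rewrite /= lebesgue_measure_itv/=; case: ifP => // _; rewrite -EFinB ltry.
- by apply: measurable_funS mf => //; exact: subset_itvl.
- exists 1; split => // y y1 z /=; rewrite in_itv/= => /andP[z0 _].
  have /andP[f0 f1] := f01 z z0.
  by rewrite ger0_norm// (le_trans f1)// ltW.
Qed.

Lemma integrable_damped_patch f z c : has_laplace f z c ->
  mu.-integrable setT (EFin \o ((fun t => expR (- z * t) * f t) \_ Rpos)) /\
  (\int[mu]_t (((fun t => expR (- z * t) * f t)%R \_ Rpos) t)%:E = c%:E)%E.
Proof.
move=> [fi fc]; split.
  rewrite -restrict_EFin; apply/integrable_restrict => //; rewrite ?setTI//.
by rewrite -fc [RHS]integral_mkcond restrict_EFin.
Qed.

(** By Fubini: multiplied by its exponential weight, the convolution becomes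
    the convolution over the whole line of the weighted functions K and F,
    extended by 0. *)
Lemma has_laplace_conv k f z c d :
  has_laplace k z c -> has_laplace f z d ->
  (forall t, 0 < t -> mu.-integrable `]0, t[ (fun s => (k (t - s) * f s)%:E)) ->
  has_laplace (conv k f) z (c * d).
Proof.
move=> hk hf ikf.
pose K := (fun t => expR (- z * t) * k t) \_ Rpos.
pose F := (fun t => expR (- z * t) * f t) \_ Rpos.
have [iK intK] := integrable_damped_patch hk.
have [iF intF] := integrable_damped_patch hf.
rewrite -/K in iK intK; rewrite -/F in iF intF.
have /integrableP[/measurable_EFinP mK Ky] := iK.
have /integrableP[/measurable_EFinP mF Fy] := iF.
pose G := fun st : measurableTypeR R * measurableTypeR R => (F st.2 * K (st.1 - st.2))%:E.
have mG : measurable_fun setT G.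
  apply/measurable_EFinP; apply: measurable_funM.
    exact: (measurableT_comp mF).
  apply: (measurableT_comp mK).
  exact: measurable_funB.
have KtE (s : R) : (\int[mu]_t `|(K (t - s))%:E| = \int[mu]_t `|(K t)%:E|)%E.
  have := @ge0_integral_affine R (abse \o (EFin \o K)) 1 (- s) (oner_neq0 _).
  rewrite normr1 invr1 mul1e => <-.
  - by apply: eq_integral => t _; rewrite mul1r.
  - by apply: measurableT_comp => //; exact/measurable_EFinP.
  - by move=> x; exact: abse_ge0.
have KtE' (s : R) : (\int[mu]_t (K (t - s))%:E = c%:E)%E.
  have [_] := integral_affine (- s) (oner_neq0 _) iK.
  rewrite normr1 invr1 mul1e intK => <-.
  by apply: eq_integral => t _; rewrite mul1r.
have iG : (mu \x mu)%E.-integrable setT G.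
  apply/integrable21ltyP => //.
  rewrite (eq_integral (fun s : measurableTypeR R => (\int[mu]_t `|(K t)%:E|) * `|(F s)%:E|)%E).
    rewrite ge0_integralZl//.
    - rewrite lte_mul_pinfty//.
      + exact: integral_ge0.
      + by rewrite ge0_fin_numE//; exact: integral_ge0.
    - by apply: measurableT_comp => //; exact/measurable_EFinP.
    - exact: integral_ge0.
  move=> s _; rewrite /G/=.
  under eq_integral do rewrite normrM EFinM.
  rewrite ge0_integralZl//; first by rewrite muleC; congr (_ * _)%E; exact: KtE.
  apply/measurable_EFinP; apply: measurableT_comp => //.
  by apply: (measurableT_comp mK); exact: measurable_funB.
have E1 : (\int[mu]_s \int[mu]_t G (t, s) = (c * d)%:E)%E.
  rewrite (eq_integral (fun s : measurableTypeR R => c%:E * (F s)%:E)%E).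
    by rewrite integralZl// intF.
  move=> s _; rewrite /G/=; under eq_integral do rewrite EFinM.
  rewrite integralZl//; first by rewrite KtE' muleC.
  have [+ _] := integral_affine (- s) (oner_neq0 _) iK.
  by apply: eq_integrable => // t _; rewrite mul1r.
have E2 t : (\int[mu]_s G (t, s) =
    (((fun t => expR (- z * t) * conv k f t)%R \_ Rpos) t)%:E)%E.
  rewrite patchE; case: ifPn; last first.
    rewrite notin_setE/= in_itv/= andbT => /negP; rewrite -leNgt => t0.
    rewrite (eq_integral (cst 0%E)) ?integral0// => s _.
    rewrite /G/= /F /K !patchE; case: ifPn; last by rewrite mul0r.
    rewrite inE/= in_itv/= andbT => s0; rewrite memNset ?mulr0//=.
    rewrite in_itv/= andbT; apply/negP; rewrite -leNgt; lra.
  rewrite inE/= in_itv/= andbT => t0.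
  transitivity (\int[mu]_(s in `](0%R:R), t[) ((expR (- z * t))%:E * (k (t - s) * f s)%:E))%E.
    rewrite [RHS]integral_mkcond; apply: eq_integral => s _.
    rewrite /G/= /F /K !patchE.
    have -> : (s \in `](0%R:R), t[%classic) = (s \in Rpos) && (t - s \in Rpos).
      apply/idP/andP; rewrite !inE/= !in_itv/= !andbT subr_gt0.
        by move=> /andP[].
      by move=> [-> ->].
    case: ifPn => _ /=; last by rewrite mul0r.
    case: ifPn => _ /=; last by rewrite mulr0.
    rewrite -EFinM; congr _%:E; rewrite mulrACA -expRD mulrBr addrC subrK.
    by rewrite (mulrC (f s)).
  rewrite integralZl//; last exact: ikf.
  rewrite EFinM; congr (_ * _)%E; rewrite fineK//.
  by apply: integrable_fin_num => //; exact: ikf.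
have iH := integrable_fubini_F iG.
have iH' : mu.-integrable setT (EFin \o ((fun t => expR (- z * t) * conv k f t) \_ Rpos)).
  by apply: eq_integrable iH => // t _; rewrite /fubini_F E2.
have E3 := Fubini iG.
split.
  move: iH'; rewrite -restrict_EFin => /integrable_restrict; rewrite setTI; exact.
rewrite integral_mkcond -E1 -E3; apply: eq_integral => t _.
by rewrite E2 !patchE; case: ifP.
Qed.

(** One of the two factors is bounded by its value at t / 2, according to the
    half of ]0, t[ in which s lies. *)
Lemma powR_conv_le a b s t : 0 < a <= 1 -> 0 < b <= 1 -> 0 < s < t ->
  (t - s) `^ (a - 1) * s `^ (b - 1) <=
  (t / 2) `^ (a - 1) * s `^ (b - 1) + (t / 2) `^ (b - 1) * (t - s) `^ (a - 1).
Proof.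
move=> /andP[a0 a1] /andP[b0 b1] /andP[s0 st].
have anti x y c : c <= 1 -> 0 < x -> x <= y -> y `^ (c - 1) <= x `^ (c - 1).
  move=> c1 x0 xy; have y0 := lt_le_trans x0 xy.
  rewrite -(opprB 1) !powRN lef_pV2 ?posrE ?powR_gt0//.
  by rewrite ge0_ler_powR ?nnegrE ?subr_ge0// ltW.
have [h|h] := leP s (t / 2).
  apply: ler_wpDr; first by rewrite mulr_ge0 ?powR_ge0.
  by rewrite ler_wpM2r ?powR_ge0// anti//; lra.
apply: ler_wpDl; first by rewrite mulr_ge0 ?powR_ge0.
by rewrite mulrC ler_wpM2r ?powR_ge0// anti//; lra.
Qed.

Lemma integrable_powR_rev a t : 0 < a -> 0 < t ->
  mu.-integrable `](0%R:R), t[ (fun s => ((t - s) `^ (a - 1))%:E).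
Proof.
move=> a0 t0.
have i1 : mu.-integrable `](0%R:R), t[ (EFin \o (fun s => (s `^ (a - 1)))).
  apply: integrableS (integrable_powR t a0) => // s /=.
  by rewrite !in_itv/= => /andP[-> /ltW].
pose f := (fun s => (s `^ (a - 1))) \_ `](0%R:R), t[.
have i2 : mu.-integrable setT (EFin \o f).
  by rewrite -restrict_EFin; apply/integrable_restrict; rewrite ?setTI.
have n1 : (-1 : R) != 0 by rewrite oppr_eq0 oner_eq0.
have [i3 _] := integral_affine t n1 i2.
suff : mu.-integrable setT ((fun s => ((t - s) `^ (a - 1))%:E) \_ `](0%R:R), t[).
  by move=> /integrable_restrict; rewrite setTI; exact.
apply: eq_integrable i3 => // s _; rewrite /f !patchE mulN1r addrC.
have -> : (t - s \in `](0%R:R), t[%classic) = (s \in `](0%R:R), t[%classic).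
  by apply/idP/idP; rewrite !inE/= !in_itv/=; lra.
by case: ifP.
Qed.

Lemma integrable_powR_conv a b t : 0 < a <= 1 -> 0 < b <= 1 -> 0 < t ->
  mu.-integrable `](0%R:R), t[ (fun s => ((t - s) `^ (a - 1) * s `^ (b - 1))%:E).
Proof.
move=> ha hb t0; have /andP[a0 _] := ha; have /andP[b0 _] := hb.
have i1 : mu.-integrable `](0%R:R), t[
    (fun s => ((t / 2) `^ (a - 1))%:E * (s `^ (b - 1))%:E)%E.
  apply: integrableZl => //.
  apply: integrableS (integrable_powR t b0) => // s /=.
  by rewrite !in_itv/= => /andP[-> /ltW].
have i2 : mu.-integrable `](0%R:R), t[
    (fun s => ((t / 2) `^ (b - 1))%:E * ((t - s) `^ (a - 1))%:E)%E.
  by apply: integrableZl => //; exact: integrable_powR_rev.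
apply: le_integrable (integrableD _ i1 i2) => //.
  apply/measurable_EFinP; apply: measurable_funM; last exact: measurable_powRl.
  apply: (measurableT_comp (@measurable_powRl R (a - 1) setT)).
  exact: measurable_funB.
move=> s /=; rewrite in_itv/= => st.
rewrite -?EFinM -?EFinD /= lee_fin !ger0_norm ?addr_ge0 ?mulr_ge0 ?powR_ge0//.
exact: powR_conv_le.
Qed.

Section continuity.
Variables (a b : R) (f : R -> R).
Hypotheses (ha : 0 < a <= 1) (hb : 0 < b <= 1).
Hypothesis cf : forall t, 0 < t -> {for t, continuous f}.
Hypothesis bf : forall T, 0 < T ->
  exists C, forall t, 0 < t <= T -> `|f t| <= C * t `^ (b - 1).

Let k1 r := rl_kernel a (1 - r).

Let Ga0 : 0 < Gamma a. Proof. by apply: Gamma_gt0; case/andP: ha. Qed.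

Lemma integrable_conv t : 0 < t ->
  mu.-integrable `](0%R:R), t[ (fun s => (rl_kernel a (t - s) * f s)%:E).
Proof.
move=> t0; have [C hC] := bf t0.
apply: le_integrable (integrableZl _ (C / Gamma a) (integrable_powR_conv ha hb t0)) => //.
  apply/measurable_EFinP; apply: measurable_funM.
    apply: measurable_funTS; apply: measurable_funM => //.
    apply: (measurableT_comp (@measurable_powRl R (a - 1) setT)).
    exact: measurable_funB.
  apply: open_continuous_measurable_fun; first exact: interval_open.
  by move=> s; rewrite inE/= in_itv/= => /andP[s0 _]; exact: cf.
move=> s /=; rewrite in_itv/= => /andP[s0 st].
rewrite lee_fin normrM /rl_kernel ger0_norm ?divr_ge0 ?powR_ge0 ?(ltW Ga0)//.
apply: le_trans (ler_norm _).
have -> : C / Gamma a * ((t - s) `^ (a - 1) * s `^ (b - 1)) =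
  (t - s) `^ (a - 1) / Gamma a * (C * s `^ (b - 1)) by ring.
rewrite ler_wpM2l ?divr_ge0 ?powR_ge0 ?(ltW Ga0)//.
by apply: hC; rewrite s0 ltW.
Qed.

Let k1_ge0 r : 0 <= k1 r.
Proof. by rewrite divr_ge0 ?powR_ge0 ?(ltW Ga0). Qed.

Let measurable_k1 D : measurable_fun D k1.
Proof.
apply: measurable_funTS; apply: measurable_funM => //.
apply: (measurableT_comp (@measurable_powRl R (a - 1) setT)).
exact: measurable_funB.
Qed.

Let measurable_scaled t : 0 < t ->
  measurable_fun `](0%R:R), 1[ (fun r => k1 r * f (t * r)).
Proof.
move=> t0; apply: measurable_funM; first exact: measurable_k1.
apply: open_continuous_measurable_fun; first exact: interval_open.
move=> s; rewrite inE/= in_itv/= => /andP[s0 _].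
apply: continuous_comp; first exact: mulrl_continuous.
by apply: cf; rewrite mulr_gt0.
Qed.

Let dominator C u r := C * u `^ (b - 1) / Gamma a *
  ((1 - r) `^ (a - 1) * r `^ (b - 1)).

Let integrable_dominator C u :
  mu.-integrable `](0%R:R), 1[ (EFin \o dominator C u).
Proof.
exact: (integrableZl _ (C * u `^ (b - 1) / Gamma a)
  (integrable_powR_conv ha hb ltr01)).
Qed.

Let scaled_le T C u t r :
  (forall t, 0 < t <= T -> `|f t| <= C * t `^ (b - 1)) ->
  0 < u -> u <= t -> t <= T -> 0 < r < 1 ->
  `|k1 r * f (t * r)| <= dominator C u r.
Proof.
move=> hC u0 ut tT /andP[r0 r1]; have t0 := lt_le_trans u0 ut.
have T0 := lt_le_trans t0 tT.
have C0 : 0 <= C.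
  have := hC T; rewrite T0 lexx => /(_ isT) h.
  by rewrite -(pmulr_lge0 _ (powR_gt0 (b - 1) T0)) (le_trans _ h).
rewrite normrM ger0_norm//.
have -> : dominator C u r = k1 r * (C * (u `^ (b - 1) * r `^ (b - 1))).
  by rewrite /dominator /k1 /rl_kernel; ring.
rewrite ler_wpM2l//; apply: (@le_trans _ _ (C * (t * r) `^ (b - 1))).
  by apply: hC; rewrite mulr_gt0//= (le_trans _ tT)// ger_pMr ?ltW.
rewrite powRM ?(ltW t0) ?(ltW r0)// ler_wpM2l// ler_wpM2r ?powR_ge0//.
rewrite -(opprB 1) !powRN lef_pV2 ?posrE ?powR_gt0//.
have /andP[_ b1] := hb.
by rewrite ge0_ler_powR ?nnegrE ?subr_ge0// ?(ltW u0) ?(ltW t0).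
Qed.

Let integrable_scaled t : 0 < t ->
  mu.-integrable `](0%R:R), 1[ (EFin \o (fun r => k1 r * f (t * r))).
Proof.
move=> t0; have [C hC] := bf t0.
apply: le_integrable (integrable_dominator C t) => //.
  by apply/measurable_EFinP; exact: measurable_scaled.
move=> r /=; rewrite in_itv/= => r01; rewrite lee_fin.
by apply: le_trans (ler_norm _); exact: (scaled_le hC t0 (lexx t) (lexx t) r01).
Qed.

Let conv_scale t : 0 < t -> conv (rl_kernel a) f t =
  t `^ a * \int[mu]_(r in `]0, 1[) (k1 r * f (t * r)).
Proof.
move=> t0; pose h := (fun s => rl_kernel a (t - s) * f s) \_ `](0%R:R), t[.
have ih : mu.-integrable setT (EFin \o h).
  rewrite -restrict_EFin; apply/integrable_restrict; rewrite ?setTI//.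
  exact: integrable_conv.
have tn0 : t != 0 by rewrite gt_eqF.
have [ih1] := integral_affine 0 tn0 ih.
rewrite gtr0_norm// => /(congr1 (fun x => t%:E * x)%E).
rewrite muleA -EFinM mulfV// mul1e => E.
have -> : conv (rl_kernel a) f t = fine (\int[mu]_x (h x)%:E)%E.
  by rewrite /conv /Rintegral integral_mkcond restrict_EFin.
rewrite -E fineM//; last exact: integrable_fin_num.
rewrite -[in RHS](mulr_powRB1 (ltW t0)); last by case/andP: ha.
rewrite -mulrA; congr (_ * _).
rewrite -RintegralZl//; last exact: integrable_scaled.
rewrite /Rintegral [in RHS]integral_mkcond; congr fine.
apply: eq_integral => r _; rewrite addr0 /h !patchE.
have -> : (t * r \in `](0%R:R), t[%classic) = (r \in `](0%R:R), 1[%classic).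
  apply/idP/idP; rewrite !inE/= !in_itv/= pmulr_rgt0// gtr_pMr//.
case: ifPn => //.
rewrite inE/= in_itv/= => /andP[r0 r1].
congr _%:E; rewrite /k1 /rl_kernel.
have -> : t - t * r = t * (1 - r) by ring.
rewrite powRM ?subr_ge0 ?ltW//; ring.
Qed.

(** Rescaling s to t s turns the convolution into t^a times an integral over
    the fixed interval ]0, 1[, whose integrand is continuous in t and dominated
    by a Beta integrand locally uniformly in t. *)
Lemma continuous_conv_rl_kernel t : 0 < t ->
  {for t, continuous (conv (rl_kernel a) f)}.
Proof.
move=> t0; pose g t := t `^ a * \int[mu]_(r in `]0, 1[) (k1 r * f (t * r)).
have gE : \near t, g t = conv (rl_kernel a) f t.
  by near=> s; rewrite conv_scale//; near: s; exact: lt_nbhsr.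
have gt : g t = conv (rl_kernel a) f t by exact: (nbhs_singleton gE).
suff : {for t, continuous g}.
  by move=> cg; rewrite /prop_for/continuous_at -gt; apply: cvg_trans cg; exact: near_eq_cvg.
apply: cvgM; first exact: continuous_powR_gt0.
have T0 : 0 < 2 * t by rewrite mulr_gt0.
have u0 : 0 < t / 2 by rewrite divr_gt0.
have [C hC] := bf T0.
apply: (@continuity_under_integral R _ _ mu (fun x r => k1 r * f (x * r))
  `](0%R:R), 1[ _ (t / 2) (2 * t) _ _ (dominator C (t / 2))).
- by [].
- move=> x /=; rewrite in_itv/= => /andP[ux _]; apply: integrable_scaled.
  exact: lt_trans ux.
- apply/aeW => r /=; rewrite in_itv/= => /andP[r0 _] x.
  rewrite inE/= in_itv/= => /andP[ux _]; apply: cvgM; first exact: cvg_cst.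
  apply: continuous_comp; first exact: mulrr_continuous.
  by apply: cf; rewrite mulr_gt0// (lt_trans _ ux).
- exact: integrable_dominator.
- move=> x /=; rewrite in_itv/= => /andP[ux xT]; apply/aeW => r /=.
  by rewrite in_itv/= => r01; apply: scaled_le hC _ _ _ r01; rewrite // ltW.
- rewrite inE/= in_itv/=; apply/andP; split; lra.
Unshelve. all: by end_near. Qed.

End continuity.

End convolution.

(** * Fractional power series *)

Section entire.
Context {R : realType}.

Lemma eq_cvgn (v w : nat -> R) (l : R) : v =1 w ->
  v @ \oo --> l -> w @ \oo --> l.
Proof. by move=> /funext ->. Qed.

Implicit Types (c u : nat -> R) (x : R).

(** Coefficients of a power series that converges everywhere: boundedness of
    c_q x^q for every x is equivalent to it and is easier to verify. *)
Definition entire c := forall x, 0 < x ->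
  exists B, forall q, `|c q| * x ^+ q <= B.

Lemma entire_cvg c x : entire c -> cvgn (pseries (fun q => `|c q|) `|x|).
Proof.
move=> ec; have x0 : 0 < 2 * (`|x| + 1) by rewrite mulr_gt0// ltr_wpDl.
have [B hB] := ec _ x0.
apply: (@series_le_cvg _ _ (geometric B 2^-1)).
- by move=> q; rewrite mulr_ge0 ?exprn_ge0.
- move=> q; rewrite /= mulr_ge0 ?exprn_ge0//.
  by apply: le_trans (hB 0%N); rewrite mulr_ge0 ?exprn_ge0 ?(ltW x0).
- move=> q; rewrite /= exprVn ler_pdivlMr ?exprn_gt0//.
  apply: le_trans (hB q); rewrite -mulrA ler_wpM2l// exprMn mulrC.
  by rewrite ler_wpM2l ?exprn_ge0// lerXn2r ?nnegrE ?addr_ge0// lerDl.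
- by apply: is_cvg_geometric_series; rewrite gtr0_norm ?invf_lt1 ?ltr1n.
Qed.

Lemma entire_norm_cvg c x : entire c -> cvgn [normed (pseries c x)].
Proof.
move=> ec; suff -> : [normed (pseries c x)] = pseries (fun q => `|c q|) `|x|.
  exact: entire_cvg.
apply/funext => n; apply: eq_bigr => q _ /=.
by rewrite normrM normrX.
Qed.

Lemma entire_pseries_cvg c x : entire c -> cvgn (pseries c x).
Proof. by move=> ec; apply: normed_cvg; exact: entire_norm_cvg. Qed.

Lemma entire_pseries_diffs c : entire c -> entire (pseries_diffs c).
Proof.
move=> ec x x0; have [B hB] := ec (2 * x) ltac:(by rewrite mulr_gt0).
exists (B / x) => q; rewrite /pseries_diffs normrM normr_nat.
rewrite ler_pdivlMr// -mulrA -exprSr mulrAC -[X in X <= _]mulrC.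
apply: le_trans (hB q.+1); rewrite ler_wpM2l// exprMn.
rewrite ler_wpM2r ?exprn_ge0 ?(ltW x0)// -natrX ler_nat.
exact/ltnW/ltn_expl.
Qed.

Lemma entire_continuous c : entire c -> continuous (fun x => limn (pseries c x)).
Proof.
move=> ec x; have ed := entire_pseries_diffs ec.
have edd := entire_pseries_diffs ed.
apply/differentiable_continuous/derivable1_diffP.
have xx : `|x| < `|(`|x| + 1)| by rewrite [ltRHS]ger0_norm ?addr_ge0// ltrDl.
have h := @pseries_snd_diffs R c (`|x| + 1) x (@entire_pseries_cvg _ _ ec)
  (@entire_pseries_cvg _ _ ed) (@entire_pseries_cvg _ _ edd) xx.
exact: ex_derive.
Qed.

End entire.

Section rl_series.
Context {R : realType}.
Variables (nu C : R).
Hypotheses (nu0 : 0 < nu) (C0 : 0 < C).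
Implicit Types (u : nat -> R).

Lemma rl_exponent_gt0 q : 0 < nu * q.+1%:R. Proof. by rewrite mulr_gt0. Qed.

Definition rl_coeff u q := u q / Gamma (nu * q.+1%:R).

(** The sum over q of u_q t^(nu (q+1) - 1) / Gamma (nu (q+1)), written as an
    entire function of t^nu times the only factor singular at 0. *)
Definition rl_series u (t : R) : R :=
  t `^ (nu - 1) * limn (pseries (rl_coeff u) (t `^ nu)).

(** In [Gamma_lower_bound] the choice M^nu = C x makes the geometric growth of
    u_q x^q cancel exactly. *)
Lemma entire_rl_coeff u : (forall q, `|u q| <= C ^+ q) -> entire (rl_coeff u).
Proof.
move=> hu x x0; pose M := (C * x) `^ nu^-1.
have M0 : 0 < M by rewrite powR_gt0 ?mulr_gt0.
have MnuE : M `^ nu = C * x.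
  by rewrite /M -powRrM mulVf ?gt_eqF// powRr1// mulr_ge0 ?ltW.
exists (2 * expR (2 * M) / M `^ nu) => q.
rewrite /rl_coeff normrM normfV (gtr0_norm (Gamma_gt0 (rl_exponent_gt0 q))).
have h := Gamma_lower_bound (rl_exponent_gt0 q) M0.
apply: (@le_trans _ _ (C ^+ q / (expR (- (2 * M)) * M `^ (nu * q.+1%:R) / 2) * x ^+ q)).
  rewrite ler_wpM2r ?exprn_ge0 ?(ltW x0)//; apply: ler_pM => //.
    by rewrite invr_ge0 ltW// Gamma_gt0// rl_exponent_gt0.
  have E0 : 0 < expR (- (2 * M)) * M `^ (nu * q.+1%:R) / 2.
    by apply: divr_gt0 => //; apply: mulr_gt0; [exact: expR_gt0|exact: powR_gt0].
  have G0 := Gamma_gt0 (rl_exponent_gt0 q).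
  by rewrite lef_pV2 ?posrE.
rewrite powRrM MnuE powR_mulrn; last by rewrite mulr_ge0 ?ltW.
rewrite le_eqVlt; apply/orP; left; apply/eqP; rewrite expRN exprS exprMn.
have := expR_gt0 (2 * M); have := exprn_gt0 q C0; have := exprn_gt0 q x0.
move: (C ^+ q) (x ^+ q) (expR _) => y z e y0 z0 e0.
by field; rewrite !gt_eqF.
Qed.

Section bounded.
Variable u : nat -> R.
Hypothesis hu : forall q, `|u q| <= C ^+ q.

Lemma rl_series_cvg t : 0 < t ->
  series (fun q => u q * rl_kernel (nu * q.+1%:R) t) @ \oo --> rl_series u t.
Proof.
move=> t0; rewrite /rl_series.
have -> : series (fun q => u q * rl_kernel (nu * q.+1%:R) t) =
  (fun n => t `^ (nu - 1) * pseries (rl_coeff u) (t `^ nu) n).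
  apply/funext => n; rewrite /pseries /series/= mulr_sumr; apply: eq_bigr => q _.
  rewrite /rl_coeff /rl_kernel -powR_mulrn ?powR_ge0// -powRrM.
  have -> : t `^ (nu * q.+1%:R - 1) = t `^ (nu - 1) * t `^ (nu * q%:R).
    rewrite -powRD; last by rewrite (gt_eqF t0) implybT.
    by congr (_ `^ _); rewrite -natr1; ring.
  by ring.
by apply: cvgMr; apply: entire_pseries_cvg; exact: entire_rl_coeff.
Qed.

Lemma continuous_rl_series t : 0 < t -> {for t, continuous (rl_series u)}.
Proof.
move=> t0; apply: cvgM; first exact: continuous_powR_gt0.
apply: (@continuous_comp _ _ _ (fun t : R => t `^ nu)
  (fun x => limn (pseries (rl_coeff u) x))).
  exact: continuous_powR_gt0.
by apply: entire_continuous; exact: entire_rl_coeff.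
Qed.

Lemma rl_series_bound T : 0 < T ->
  exists B, forall t, 0 < t <= T -> `|rl_series u t| <= B * t `^ (nu - 1).
Proof.
move=> T0; have eu := entire_rl_coeff hu.
exists (limn (pseries (fun q => `|rl_coeff u q|) (T `^ nu))) => t /andP[t0 tT].
rewrite normrM ger0_norm ?powR_ge0// mulrC ler_wpM2r ?powR_ge0//.
apply: le_trans (lim_series_norm (@entire_norm_cvg _ _ _ eu)) _.
apply: lim_series_le.
- exact: entire_norm_cvg.
- by have := @entire_cvg _ _ (T `^ nu) eu; rewrite ger0_norm ?powR_ge0.
- move=> q /=; rewrite normrM ler_wpM2l// normrX ger0_norm ?powR_ge0//.
  apply: lerXn2r; rewrite ?nnegrE ?powR_ge0//.
  by apply: ge0_ler_powR; rewrite ?nnegrE ?(ltW nu0) ?(ltW t0) ?(ltW T0).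
Qed.

End bounded.

Lemma nneseries_EFin (a : nat -> R) (l : R) : series a @ \oo --> l ->
  (\sum_(0 <= q <oo) (a q)%:E = l%:E)%E.
Proof.
move=> al; apply/cvg_lim => //.
under eq_fun do rewrite sumEFin.
exact: cvgn_EFin.
Qed.

(** With nonnegative terms the transform may be taken term by term, by monotone
    convergence. *)
Lemma ge0_has_laplace_rl_series u y l : (forall q, 0 <= u q <= C ^+ q) -> 0 < y ->
  series (fun q => u q * (y `^ nu)^-1 ^+ q.+1) @ \oo --> l ->
  has_laplace (rl_series u) y l.
Proof.
move=> hu y0 hl; have u0 q : 0 <= u q by case/andP: (hu q).
have hu' q : `|u q| <= C ^+ q by rewrite ger0_norm//; case/andP: (hu q).
have kq0 q t : 0 <= rl_kernel (nu * q.+1%:R) t.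
  by rewrite divr_ge0 ?powR_ge0// ltW// Gamma_gt0// rl_exponent_gt0.
apply: ge0_has_laplace.
- apply: open_continuous_measurable_fun; first exact: interval_open.
  by move=> t; rewrite inE/= in_itv/= andbT; exact: continuous_rl_series.
- move=> t t0; have := rl_series_cvg hu' t0; move=> /(cvg_lim (@Rhausdorff R)) <-.
  apply: limr_ge; first by apply/cvg_ex; eexists; exact: rl_series_cvg.
  by apply: nearW => n; apply: sumr_ge0 => q _; rewrite mulr_ge0.
rewrite -(nneseries_EFin hl).
pose g q t := (expR (- y * t) * (u q * rl_kernel (nu * q.+1%:R) t))%:E.
transitivity (\int[lebesgue_measure]_(t in `](0%R:R), +oo[) \sum_(0 <= q <oo) g q t)%E.
  apply: eq_integral => t; rewrite inE/= in_itv/= andbT => t0.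
  apply/esym/nneseries_EFin.
  apply: eq_cvgn (cvgM (cvg_cst (expR (- y * t))) (rl_series_cvg hu' t0)) => n.
  by rewrite /series/= mulr_sumr.
rewrite integral_nneseries//; last 2 first.
- move=> q; apply/measurable_EFinP; apply: measurable_funM; first exact: measurable_expR_lin.
  by apply: measurable_funM => //; apply: measurable_funM => //; exact: measurable_powRl.
- by move=> q t _; rewrite lee_fin mulr_ge0 ?expR_ge0// mulr_ge0.
apply: eq_eseriesr => q _.
have [_] := has_laplaceZ (u q) (has_laplace_rl_kernel (rl_exponent_gt0 q) y0).
by rewrite powRN powRrM powR_mulrn ?powR_ge0// exprVn.
Qed.

Lemma rl_series_summable u y : (forall q, `|u q| <= C ^+ q) -> 0 < y -> C < y `^ nu ->
  cvgn (series (fun q => u q * (y `^ nu)^-1 ^+ q.+1)).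
Proof.
move=> hu y0 Cy; set th := y `^ nu in Cy *.
have th0 : 0 < th by exact: lt_trans Cy.
apply: normed_cvg.
apply: (@series_le_cvg _ _ (geometric th^-1 (C / th))).
- by move=> q /=.
- by move=> q; rewrite /= mulr_ge0 ?exprn_ge0 ?divr_ge0 ?invr_ge0 ?ltW.
- move=> q /=; rewrite normrM normrX [`|th^-1|]gtr0_norm ?invr_gt0// exprS exprMn mulrCA.
  by rewrite ler_wpM2l ?invr_ge0 ?(ltW th0)// ler_wpM2r ?exprn_ge0 ?invr_ge0 ?(ltW th0).
- apply: is_cvg_geometric_series; rewrite gtr0_norm ?divr_gt0//.
  by rewrite ltr_pdivrMr// mul1r.
Qed.

(** Splitting u into positive and negative parts reduces to the nonnegative
    case; the bound C < y^nu makes both transformed series converge. *)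
Lemma has_laplace_rl_series u y l : (forall q, `|u q| <= C ^+ q) -> 0 < y ->
  C < y `^ nu ->
  series (fun q => u q * (y `^ nu)^-1 ^+ q.+1) @ \oo --> l ->
  has_laplace (rl_series u) y l.
Proof.
move=> hu y0 Cy hl; set th := y `^ nu in Cy hl *.
pose p q := (`|u q| + u q) / 2; pose m q := (`|u q| - u q) / 2.
have upm q : u q = p q - m q by rewrite /p /m; field.
have abs_bounds q : - `|u q| <= u q <= `|u q| by rewrite -ler_norml.
have hp q : 0 <= p q <= C ^+ q.
  by rewrite /p; move: (hu q) (abs_bounds q); lra.
have hm q : 0 <= m q <= C ^+ q.
  by rewrite /m; move: (hu q) (abs_bounds q); lra.
have np q : `|p q| <= C ^+ q by case/andP: (hp q) => p0 ?; rewrite ger0_norm.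
have nm q : `|m q| <= C ^+ q by case/andP: (hm q) => p0 ?; rewrite ger0_norm.
have cp := rl_series_summable np y0 Cy; have cm := rl_series_summable nm y0 Cy.
have hB := has_laplaceB (ge0_has_laplace_rl_series hp y0 cp) (ge0_has_laplace_rl_series hm y0 cm).
have lE : l = limn (series (fun q => p q * (y `^ nu)^-1 ^+ q.+1)) -
              limn (series (fun q => m q * (y `^ nu)^-1 ^+ q.+1)).
  apply: (cvg_unique _ hl) => //; apply: eq_cvgn (cvgB cp cm) => n.
  rewrite ?fctE /series/= -sumrB; apply: eq_bigr => q _.
  by rewrite (upm q) mulrBl.
rewrite lE; apply: eq_has_laplace hB => t t0.
apply/esym; apply: (cvg_unique _ (rl_series_cvg hu t0)) => //.
apply: eq_cvgn (cvgB (rl_series_cvg np t0) (rl_series_cvg nm t0)) => n.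
rewrite ?fctE /series/= -sumrB; apply: eq_bigr => q _.
by rewrite (upm q) mulrBl.
Qed.

End rl_series.

(** * The jump operator and its resolvent *)

Section jump_operator.
Context {R : realType}.
Variables (k : nat) (lambda1 lambda2 : R).
Hypotheses (lambda1_ge0 : 0 <= lambda1) (lambda2_ge0 : 0 <= lambda2).
Implicit Types (phi psi : int -> R) (n : int).

(** The gain part of the generator of S, whose jumps +1, ..., +k occur at rate
    lambda1 each and -1, ..., -k at rate lambda2 each. *)
Definition jump phi n : R :=
  lambda1 * \sum_(1 <= j < k.+1) phi (n - j%:Z) +
  lambda2 * \sum_(1 <= j < k.+1) phi (n + j%:Z).

(** The total rate of jumps, so that the generator of S is
    phi n |-> jump phi n - jump_rate * phi n. *)
Definition jump_rate : R := k%:R * (lambda1 + lambda2).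

Lemma jump_rate_ge0 : 0 <= jump_rate.
Proof. by rewrite mulr_ge0// addr_ge0. Qed.

Lemma eq_jump phi psi n : phi =1 psi -> jump phi n = jump psi n.
Proof. by move=> /funext ->. Qed.

Lemma jumpD phi psi n : jump (fun m => phi m + psi m) n = jump phi n + jump psi n.
Proof. by rewrite /jump !big_split/=; ring. Qed.

Lemma jumpZ a phi n : jump (fun m => a * phi m) n = a * jump phi n.
Proof. by rewrite /jump -!mulr_sumr; ring. Qed.

Lemma jump_norm_le phi n M : (forall m, `|phi m| <= M) -> `|jump phi n| <= jump_rate * M.
Proof.
move=> h; have sum_le (f : nat -> int) : `|\sum_(1 <= j < k.+1) phi (f j)| <= k%:R * M.
  apply: le_trans (ler_norm_sum _ _ _) _.
  apply: (@le_trans _ _ (\sum_(1 <= j < k.+1) M)); first exact: ler_sum.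
  by rewrite big_const_nat subSS subn0 iter_addr_0 mulr_natl.
apply: le_trans (ler_normD _ _) _; rewrite !normrM (ger0_norm lambda1_ge0) (ger0_norm lambda2_ge0).
apply: (@le_trans _ _ (lambda1 * (k%:R * M) + lambda2 * (k%:R * M))).
  apply: lerD; apply: ler_wpM2l => //.
by rewrite le_eqVlt; apply/orP; left; apply/eqP; rewrite /jump_rate; ring.
Qed.

Lemma has_laplace_jump (F : int -> R -> R) (c : int -> R) z n :
  (forall m, has_laplace (F m) z (c m)) ->
  has_laplace (fun t => jump (F ^~ t) n) z (jump c n).
Proof.
move=> h; apply: has_laplaceD; apply: has_laplaceZ; exact: has_laplace_sum.
Qed.

Lemma cvg_sum_seq {T : Type} (G : set_system T) {FG : Filter G} (I : Type)
    (s : seq I) (F : I -> T -> R) (c : I -> R) :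
  (forall i, F i x @[x --> G] --> c i) ->
  \sum_(i <- s) F i x @[x --> G] --> \sum_(i <- s) c i.
Proof.
move=> h; elim: s => [|i s ih].
  by rewrite big_nil; under eq_fun do rewrite big_nil; exact: cvg_cst.
by rewrite big_cons; under eq_fun do rewrite big_cons; exact: cvgD.
Qed.

Lemma cvg_jump {T : Type} (G : set_system T) {FG : Filter G} (F : int -> T -> R)
    (c : int -> R) n :
  (forall m, F m x @[x --> G] --> c m) -> jump (F ^~ x) n @[x --> G] --> jump c n.
Proof.
by move=> h; apply: cvgD; apply: cvgM; try exact: cvg_cst; exact: cvg_sum_seq.
Qed.

Section resolvent.
Variable (kappa : R).

(** With kappa = eta^nu - jump_rate this is the generator of S plus eta^nu, the
    operator whose resolvent at (eta + z)^nu is that of the generator at the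
    exponent (eta + z)^nu - eta^nu of the subordinator. *)
Definition shifted_jump phi n := jump phi n + kappa * phi n.

Definition unit_mass (n : int) : R := (n == 0)%:R.

Definition walk_coeff (q : nat) : int -> R := iter q shifted_jump unit_mass.

Definition walk_bound := jump_rate + `|kappa| + 1.

Lemma walk_bound_gt0 : 0 < walk_bound.
Proof. by rewrite ltr_wpDl// addr_ge0// jump_rate_ge0. Qed.

Lemma iter_shifted_jump_le q phi n M : 0 <= M -> (forall m, `|phi m| <= M) ->
  `|iter q shifted_jump phi n| <= walk_bound ^+ q * M.
Proof.
move=> M0 h; elim: q n => [|q ih] n; first by rewrite expr0 mul1r.
rewrite iterS; apply: le_trans (ler_normD _ _) _.
have N0 : 0 <= walk_bound ^+ q * M by rewrite mulr_ge0// exprn_ge0// ltW// walk_bound_gt0.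
rewrite exprS -mulrA; set N := _ * M in ih N0 *.
rewrite /walk_bound !mulrDl mul1r; apply: ler_wpDr => //.
apply: lerD; first exact: jump_norm_le.
by rewrite normrM ler_wpM2l.
Qed.

Lemma walk_coeff_le q n : `|walk_coeff q n| <= walk_bound ^+ q.
Proof.
rewrite -[leRHS]mulr1; apply: iter_shifted_jump_le => // m.
by rewrite /unit_mass; case: (m == 0); rewrite ?normr1 ?normr0.
Qed.

Lemma iter_shifted_jumpD q phi psi n :
  iter q shifted_jump (fun m => phi m + psi m) n =
  iter q shifted_jump phi n + iter q shifted_jump psi n.
Proof.
elim: q n => [//|q ih] n; rewrite !iterS {1}/shifted_jump.
by rewrite (eq_jump _ ih) ih jumpD /shifted_jump; ring.
Qed.

Lemma iter_shifted_jumpZ q a phi n :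
  iter q shifted_jump (fun m => a * phi m) n = a * iter q shifted_jump phi n.
Proof.
elim: q n => [//|q ih] n; rewrite !iterS {1}/shifted_jump.
by rewrite (eq_jump _ ih) ih jumpZ /shifted_jump; ring.
Qed.

(** Iterating the equation N times expresses G n as a partial sum of the Neumann
    series plus theta^-N times the N-th iterate of G, which vanishes in the
    limit because the operator has sup norm below theta.  In particular the
    resolvent equation has no other bounded solution. *)
Lemma resolvent_expansion theta (G : int -> R) M :
  walk_bound < theta -> (forall m, `|G m| <= M) ->
  (forall m, theta * G m = unit_mass m + shifted_jump G m) ->
  forall n, series (fun q => walk_coeff q n * theta^-1 ^+ q.+1) @ \oo --> G n.
Proof.
move=> bt hM hG n.
have th0 : 0 < theta := lt_trans walk_bound_gt0 bt.
have M0 : 0 <= M := le_trans (normr_ge0 _) (hM 0).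
have partial N : G n = series (fun q => walk_coeff q n * theta^-1 ^+ q.+1) N +
    theta^-1 ^+ N * iter N shifted_jump G n.
  elim: N => [|N ih]; first by rewrite /series/= big_nil add0r expr0 mul1r.
  rewrite {}[LHS]ih seriesSr -addrA; congr (_ + _).
  have GE : G = fun m => theta^-1 * (unit_mass m + shifted_jump G m).
    by apply/funext => m; rewrite -hG mulKf// gt_eqF.
  rewrite {1}GE iter_shifted_jumpZ iter_shifted_jumpD -iterSr exprS.
  by rewrite /walk_coeff; ring.
apply/cvgrPdist_le => e e0.
have cv : (walk_bound / theta) ^+ N * M @[N --> \oo] --> 0.
  rewrite -(mul0r M); apply: cvgMl; apply: cvg_expr.
  by rewrite gtr0_norm ?divr_gt0 ?walk_bound_gt0// ltr_pdivrMr// mul1r.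
move/cvgrPdist_le : cv => /(_ e e0); apply: filterS => N.
rewrite sub0r normrN => h; rewrite {1}(partial N) addrAC subrr add0r.
apply: le_trans _ h; rewrite normrM ger0_norm ?exprn_ge0 ?invr_ge0 ?(ltW th0)//.
rewrite [leRHS]ger0_norm; last first.
  by rewrite mulr_ge0 ?exprn_ge0 ?divr_ge0 ?(ltW th0) ?(ltW walk_bound_gt0).
rewrite exprMn [leRHS]mulrAC [leRHS]mulrC ler_wpM2l ?exprn_ge0 ?invr_ge0 ?(ltW th0)//.
exact: iter_shifted_jump_le.
Qed.

End resolvent.
End jump_operator.

(** * Sums of independent uniform variables *)

Section generated_events.
Context {R : realType} {d : measure_display} {T : measurableType d}.
Context (P : probability T R).

Section closure.
Context {I : Type} {d' : measure_display} {E : measurableType d'}.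
Variables (D : set I) (X : I -> T -> E).
Local Notation Ev := (generated_events D X).

Lemma generated_events_preimage i (B : set E) : D i -> measurable B ->
  Ev (X i @^-1` B).
Proof.
move=> Di mB; apply: sub_sigma_algebra; exists i => //.
by exists B => //; rewrite setTI.
Qed.

Lemma generated_events_bigcup (F : (set T)^nat) :
  (forall i, Ev (F i)) -> Ev (\bigcup_i F i).
Proof. exact: sigma_algebra_bigcup. Qed.

Lemma generated_eventsC A : Ev A -> Ev (~` A).
Proof. exact: sigma_algebraC. Qed.

Lemma generated_eventsI A B : Ev A -> Ev B -> Ev (A `&` B).
Proof.
move=> EA EB; rewrite -(setCK (A `&` B)) setCI; apply: generated_eventsC.
rewrite -bigcup2E; apply: generated_events_bigcup => i; rewrite /bigcup2.
case: ifP => _; first exact: generated_eventsC.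
case: ifP => _; first exact: generated_eventsC.
exact: sigma_algebra0.
Qed.

Lemma generated_events0 : Ev set0.
Proof. exact: sigma_algebra0. Qed.

Lemma generated_events_measurable : (forall i, D i -> measurable_fun setT (X i)) ->
  Ev `<=` measurable.
Proof.
move=> mX; apply: smallest_sub; first exact: sigma_algebra_measurable.
move=> A [i Di [B mB <-]]; exact: mX.
Qed.

End closure.

Lemma probability_indic (A : set T) : measurable A ->
  P A = (\int[P]_w (\1_A w)%:E)%E.
Proof. by move=> mA; rewrite integral_indic// setIT. Qed.

(** Conditioning on a variable with values in nat. *)
Lemma measure_split_nat (Y : T -> nat) (A : set T) : measurable A ->
  (forall j, measurable [set w | Y w = j]) ->
  (P A = \sum_(0 <= j <oo) P (A `&` [set w | Y w = j]))%E.
Proof.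
move=> mA mY.
have mF j : measurable (A `&` [set w | Y w = j]) by exact: measurableI.
rewrite -measure_semi_bigcup//.
- rewrite -setI_bigcupr; congr (P _).
  by apply/seteqP; split => [w Aw|w []//]; split => //; exists (Y w).
- by apply/trivIsetP => i j _ _ /eqP ij; apply/seteqP; split => // w /=
    [[_ h1] [_ h2]]; apply: ij; rewrite -h1 -h2.
- by apply: bigcup_measurable => j _; exact: mF.
Qed.

Lemma nneseries_finite (f : nat -> \bar R) N : (forall j, 0 <= f j)%E ->
  (forall j, (N <= j)%N -> f j = 0%E) ->
  (\sum_(0 <= j <oo) f j = \sum_(0 <= j < N) f j)%E.
Proof.
move=> f0 fN; rewrite (nneseries_split 0 N)// add0n eseries0 ?adde0//.
by move=> j Nj _; exact: fN.
Qed.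

End generated_events.

Section compound_sums.
Context {R : realType} {d : measure_display} {T : measurableType d}.
Context (P : probability T R).
Variables (k : nat) (X : nat -> T -> nat).
Hypotheses (k_gt0 : (0 < k)%N).
Hypothesis uX : forall i, uniform_1_to P k (X i).
Hypothesis iX : mutually_independent P X.

Definition sum_event (j m : nat) : set T :=
  [set w | (\sum_(i < j) X i w)%N = m].

(** The law of X 0 + ... + X (j-1) for the uniform steps, extended by 0 to the
    negative integers so that its recursion needs no boundary case. *)
Fixpoint sum_law (j : nat) (n : int) : R :=
  if j is j'.+1 then k%:R^-1 * \sum_(1 <= i < k.+1) sum_law j' (n - i%:Z)
  else (n == 0)%:R.

Lemma sum_law_ge0 j n : 0 <= sum_law j n.
Proof.
elim: j n => [|j ih] n /=; first by case: (n == 0).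
by rewrite mulr_ge0 ?invr_ge0// sumr_ge0.
Qed.

Lemma sum_law_eq0 j n : n < j%:Z -> sum_law j n = 0.
Proof.
elim: j n => [|j ih] n nj /=; first by case: eqP nj => // ->.
rewrite big_nat big1 ?mulr0// => i /andP[i1 _]; apply: ih.
by move: nj i1; lia.
Qed.

Lemma measurable_X_event i (B : set nat) : measurable (X i @^-1` B).
Proof. by have [mX _] := uX i; rewrite -[_ @^-1` _]setTI; exact: mX. Qed.

Lemma sum_event_recr j m a :
  sum_event j.+1 m `&` [set w | X j w = a] =
  if (a <= m)%N then sum_event j (m - a) `&` [set w | X j w = a] else set0.
Proof.
apply/seteqP; split => w; rewrite /sum_event/=.
  by rewrite big_ord_recr/= => -[<- Xa]; rewrite Xa leq_addl/= addnK.
by case: ifP => //= am [h Xa]; rewrite big_ord_recr/= h Xa subnK.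
Qed.

Lemma sum_event_generated j m : generated_events setT X (sum_event j m).
Proof.
elim: j m => [|j ih] m.
  have [->|m0] := eqVneq m 0%N.
    rewrite (_ : sum_event _ _ = ~` set0); last first.
      by rewrite setC0; apply/seteqP; split => // w _; rewrite /sum_event/= big_ord0.
    by apply: generated_eventsC; exact: generated_events0.
  rewrite (_ : sum_event _ _ = set0); first exact: generated_events0.
  apply/seteqP; split => // w; rewrite /sum_event/= big_ord0 => h.
  by rewrite -h eqxx in m0.
rewrite (_ : sum_event _ _ = \bigcup_a (sum_event j.+1 m `&` [set w | X j w = a])).
  apply: generated_events_bigcup => a; rewrite sum_event_recr.
  case: ifP => _; last exact: generated_events0.
  apply: generated_eventsI => //.
  exact: (generated_events_preimage (D := setT) (X := X) (i := j) (B := [set a])).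
by apply/seteqP; split => [w h|w [a _ []]//]; exists (X j w).
Qed.

Lemma measurable_sum_event j m : measurable (sum_event j m).
Proof.
apply: (generated_events_measurable _ (sum_event_generated j m)).
by move=> i _; have [] := uX i.
Qed.

Definition future_event (J : seq nat) (B : nat -> set nat) : set T :=
  \big[setI/setT]_(i <- J) (X i @^-1` B i).

Lemma measurable_future_event J B : measurable (future_event J B).
Proof.
by rewrite /future_event; elim/big_ind: _ => // [? ?|i _]; [exact: measurableI|exact: measurable_X_event].
Qed.

(** Mutual independence is applied to the indices j :: J, with the sets B
    modified to the singleton of a at j. *)
Lemma future_event_cons j a J B : uniq (j :: J) ->
  P ([set w | X j w = a] `&` future_event J B) =
  (P [set w | X j w = a] * P (future_event J B))%E.
Proof.
move=> /= /andP[jJ uJ].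
pose B' i := if i == j then [set a] else B i.
have EJ : future_event J B' = future_event J B.
  rewrite /future_event; apply: eq_big_seq => i iJ; rewrite /B'.
  by case: eqP => // ij; rewrite -ij iJ in jJ.
have h0 := iX uJ (fun i => (I : measurable (B i))).
have h1 := @iX (j :: J) B' _ (fun i => (I : measurable (B' i))).
move: h1; rewrite /= jJ uJ => /(_ isT).
rewrite !big_cons -/(future_event J B') EJ {1 2}/B' eqxx => h1.
have Pr : \prod_(i <- J) fine (P (X i @^-1` B' i)) = fine (P (future_event J B)).
  rewrite /future_event h0; apply: eq_big_seq => i iJ; rewrite /B'.
  by case: eqP => // ij; rewrite -ij iJ in jJ.
rewrite Pr -fineM ?fin_num_measure// in h1; last first.
- exact: measurable_future_event.
- exact: measurable_X_event.
have mA := @measurable_X_event j [set a].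
have mE := measurable_future_event J B.
rewrite -[LHS]fineK ?h1 ?fineK ?fin_numM ?fin_num_measure//.
exact: measurableI.
Qed.

(** Independence of a partial sum from later steps.  It is proved together with
    the formula for the law of the sum: splitting on the value of the last step
    moves that step from the sum to the future event, which is why the
    induction needs an arbitrary future event. *)
Lemma probability_sum_future_event j m J B : uniq J -> all (leq j) J ->
  P (sum_event j m `&` future_event J B) =
  ((sum_law j m%:Z)%:E * P (future_event J B))%E.
Proof.
elim: j m J B => [|j ih] m J B uJ jJ.
  rewrite /sum_event /=; have [->|m0] := eqVneq m 0%N.
    rewrite mul1e; congr (P _).
    by apply/seteqP; split => [w []//|w h]; split => //=; rewrite big_ord0.
  rewrite [_%:Z == 0](_ : _ = false) ?mul0e; last by apply/negbTE.
  rewrite (_ : _ `&` _ = set0) ?measure0//.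
  by apply/seteqP; split => // w /= [h _]; rewrite big_ord0 in h; rewrite -h eqxx in m0.
have jnJ : j \notin J by apply/negP => /(allP jJ); rewrite ltnn.
have ujJ : uniq (j :: J) by rewrite /= jnJ.
have mE := measurable_future_event J B.
have mXj a : measurable [set w | X j w = a] by exact: (@measurable_X_event j [set a]).
rewrite (@measure_split_nat _ _ _ P (X j))//; last first.
  by apply: measurableI => //; exact: measurable_sum_event.
have key a : P (sum_event j.+1 m `&` future_event J B `&` [set w | X j w = a]) =
    ((sum_law j (m%:Z - a%:Z) * (if (1 <= a <= k)%N then k%:R^-1 else 0))%:E *
     P (future_event J B))%E.
  rewrite setIAC sum_event_recr; case: ifPn => am; last first.
    rewrite set0I measure0 sum_law_eq0 ?mul0r ?mul0e//.
    by move: am; rewrite -ltnNge; lia.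
  pose B' i := if i == j then [set a] else B i.
  have -> : sum_event j (m - a) `&` [set w | X j w = a] `&` future_event J B =
      sum_event j (m - a) `&` future_event (j :: J) B'.
    rewrite -setIA; congr (_ `&` _).
    rewrite /future_event big_cons /B' eqxx; congr (_ `&` _).
    by apply: eq_big_seq => i iJ; case: eqP => // ij; rewrite -ij iJ in jnJ.
  rewrite ih//; last first.
    rewrite /= leqnn/=; apply: sub_all jJ => i; exact: ltnW.
  have -> : future_event (j :: J) B' = [set w | X j w = a] `&` future_event J B.
    rewrite /future_event big_cons /B' eqxx; congr (_ `&` _).
    by apply: eq_big_seq => i iJ; case: eqP => // ij; rewrite -ij iJ in jnJ.
  rewrite future_event_cons//; have [_ ->] := uX j.
  by rewrite muleA -EFinM subzn.
under eq_eseriesr do rewrite key.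
rewrite (@nneseries_finite _ _ k.+1); last 2 first.
- move=> a; rewrite mule_ge0// lee_fin mulr_ge0 ?sum_law_ge0//.
  by case: ifP => // _; rewrite invr_ge0.
- by move=> a ka; rewrite [(a <= k)%N]leqNgt ka/= andbF mulr0 mul0e.
rewrite -ge0_sume_distrl; last first.
  move=> a _; rewrite lee_fin mulr_ge0 ?sum_law_ge0//.
  by case: ifP => // _; rewrite invr_ge0.
congr (_ * _)%E; rewrite sumEFin; congr _%:E => /=.
rewrite big_nat_recl// mulr0 add0r mulr_sumr big_add1/= !big_mkord.
apply: eq_bigr => i _; rewrite /= ltn_ord mulrC; congr (_ * _).
Qed.

Lemma probability_sum_event j m : P (sum_event j m) = (sum_law j m%:Z)%:E.
Proof.
have := @probability_sum_future_event j m [::] (fun=> setT) isT isT.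
by rewrite /future_event big_nil setIT probability_setT mule1.
Qed.

End compound_sums.

(** * Forward equation of a pair of processes of order k *)

Section order_k_density.
Context {R : realType}.
Variable (k : nat).
Hypothesis k_gt0 : (0 < k)%N.
Implicit Types (x lambda : R) (n : int).

(** The value of [poisson_pmf] at rate a * x when this rate is positive, as a
    smooth function of x without positivity tests. *)
Definition pois (a : R) (j : nat) (x : R) : R :=
  (a * x) ^+ j / j`!%:R * expR (- a * x).

Lemma pois_ge0 a j x : 0 <= a -> 0 <= x -> 0 <= pois a j x.
Proof. by move=> a0 x0; rewrite mulr_ge0 ?expR_ge0// divr_ge0// exprn_ge0// mulr_ge0. Qed.

Lemma pois0 a j : pois a j 0 = (j == 0%N)%:R.
Proof.
rewrite /pois !mulr0 expR0 mulr1; case: j => [|j]; last by rewrite expr0n mul0r.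
by rewrite expr0 fact0 divr1.
Qed.

Lemma is_derive_pois a j x : is_derive x 1 (pois a j)
  (a * ((if j is j'.+1 then pois a j' x else 0) - pois a j x)).
Proof.
have dexp : is_derive x 1 (fun x => expR (- a * x)) (- a * expR (- a * x)).
  by apply: is_derive_eq; rewrite /GRing.scale/=; ring.
have dlin : is_derive x 1 (fun x => a * x) a.
  by apply: is_derive_eq; rewrite /GRing.scale/=; ring.
case: j => [|j].
  rewrite (_ : pois a 0 = fun x => expR (- a * x)); last first.
    by apply/funext => y; rewrite /pois expr0 fact0 divr1 mul1r.
  by apply: is_derive_eq; ring.
rewrite /pois.
have dpow : is_derive x 1 (fun x => (a * x) ^+ j.+1) (j.+1%:R * a * (a * x) ^+ j).
  rewrite (_ : (fun x => (a * x) ^+ j.+1) = (fun x => a * x) ^+ j.+1); last first.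
    by apply/funext => y; rewrite fctE.
  apply: is_derive_eq; rewrite /GRing.scale/=; ring.
apply: is_derive_eq; rewrite /GRing.scale/= factS natrM.
have f0 : (j`!%:R : R) != 0 by rewrite pnatr_eq0 -lt0n fact_gt0.
have j0 : (j.+1%:R : R) != 0 by rewrite pnatr_eq0.
rewrite exprS; move: (j.+1%:R) (j`!%:R) j0 f0 ((a * x) ^+ j) (expR _) => A B A0 B0 C D.
field; rewrite A0 B0//.
Qed.

(** The pmf of a process of order k at time x: j jumps of total size n.  The
    terms with j > n vanish because every jump is at least 1. *)
Definition order_pmf lambda n x : R :=
  \sum_(j < `|n|.+1) pois (k%:R * lambda) j x * sum_law k j n.

(** Truncating the sum further away allows all the shifted arguments in
    the forward equation to share one range of summation. *)
Lemma order_pmf_wide lambda N n x : (`|n| < N)%N ->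
  order_pmf lambda n x = \sum_(j < N) pois (k%:R * lambda) j x * sum_law k j n.
Proof.
move=> nN; rewrite /order_pmf.
rewrite -(big_mkord xpredT (fun j => pois (k%:R * lambda) j x * sum_law k j n)).
rewrite -(big_mkord xpredT (fun j => pois (k%:R * lambda) j x * sum_law k j n)).
rewrite (big_cat_nat _ (n := `|n|.+1) (p := N))//=.
rewrite [X in _ = _ + X](_ : _ = 0) ?addr0//.
rewrite big_nat big1// => j /andP[nj _].
by rewrite sum_law_eq0 ?mulr0//; move: nj; lia.
Qed.

Lemma order_pmf_ge0 lambda n x : 0 <= lambda -> 0 <= x -> 0 <= order_pmf lambda n x.
Proof.
move=> l0 x0; apply: sumr_ge0 => j _; rewrite mulr_ge0 ?sum_law_ge0//.
by rewrite pois_ge0// mulr_ge0.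
Qed.

Lemma order_pmf_neg lambda n x : n < 0 -> order_pmf lambda n x = 0.
Proof.
move=> n0; rewrite /order_pmf big1// => j _; rewrite sum_law_eq0 ?mulr0//.
exact: lt_le_trans n0 _.
Qed.

Lemma order_pmf0 lambda n : order_pmf lambda n 0 = (n == 0)%:R.
Proof.
rewrite /order_pmf big_ord_recl pois0 mul1r big1 ?addr0// => j _.
by rewrite pois0 mul0r.
Qed.

(** The derivative of the Poisson weight lowers the number of jumps by one, and
    the recursion of [sum_law] interprets the lost jump as a shift of n by a
    uniform step. *)
Lemma is_derive_order_pmf lambda n x : is_derive x 1 (order_pmf lambda n)
  (lambda * \sum_(1 <= i < k.+1) order_pmf lambda (n - i%:Z) x -
   k%:R * lambda * order_pmf lambda n x).
Proof.
(* large enough for n and for all the shifts n - i with i <= k *)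
pose N := (`|n| + k).+2.
have -> : order_pmf lambda n =
    \sum_(j < N.+1) (fun x => pois (k%:R * lambda) j x * sum_law k j n).
  by apply/funext => y; rewrite (@order_pmf_wide _ N.+1) ?fct_sumE//; lia.
have dterm (j : 'I_N.+1) : is_derive x 1 (fun x => pois (k%:R * lambda) j x * sum_law k j n)
   ((k%:R * lambda * ((if (j : nat) is j'.+1 then pois (k%:R * lambda) j' x else 0) - pois (k%:R * lambda) j x)) * sum_law k j n).
  have h := is_derive_pois (k%:R * lambda) j x.
  by apply: is_derive_eq; rewrite /GRing.scale/=; ring.
apply: is_derive_eq.
under eq_bigr do rewrite -mulrA mulrBl.
rewrite -mulr_sumr sumrB -(@order_pmf_wide _ N.+1); last by rewrite /N; lia.
rewrite mulrBr; congr (_ - _); last first.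
  by rewrite (@order_pmf_wide _ N.+1) ?fct_sumE//; lia.
rewrite big_ord_recl/= mul0r add0r.
rewrite (@eq_big_nat _ _ _ 1 k.+1 _ (fun i : nat => \sum_(j < N)
    pois (k%:R * lambda) j x * sum_law k j (n - i%:Z))); last first.
  by move=> i /andP[i1 ik]; apply: order_pmf_wide; rewrite /N; lia.
rewrite exchange_big/= [X in X * _]mulrC -mulrA; congr (_ * _).
rewrite mulr_sumr; apply: eq_bigr => i _; rewrite add0n.
rewrite -mulr_sumr mulrCA; congr (_ * _).
by rewrite mulrA mulfV ?mul1r// pnatr_eq0 -lt0n.
Qed.

Lemma continuous_order_pmf lambda n : continuous (order_pmf lambda n).
Proof.
move=> x; apply/differentiable_continuous/derivable1_diffP.
by have h := is_derive_order_pmf lambda n x; exact: ex_derive.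
Qed.

Section joint.
Variables (lambda1 lambda2 : R).
Hypotheses (l1 : 0 <= lambda1) (l2 : 0 <= lambda2).
Local Notation mu := (@lebesgue_measure R).

Definition joint_pmf (a b : int) x := order_pmf lambda1 a x * order_pmf lambda2 b x.

Lemma joint_pmf_ge0 a b x : 0 <= x -> 0 <= joint_pmf a b x.
Proof. by move=> x0; rewrite mulr_ge0// order_pmf_ge0. Qed.

Lemma continuous_joint_pmf a b : continuous (joint_pmf a b).
Proof. by move=> x; apply: cvgM; exact: continuous_order_pmf. Qed.

(** The gain term of the forward equation of the pair of independent
    processes. *)
Definition joint_inflow (a b : int) x :=
  lambda1 * \sum_(1 <= i < k.+1) joint_pmf (a - i%:Z) b x +
  lambda2 * \sum_(1 <= i < k.+1) joint_pmf a (b - i%:Z) x.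

Lemma is_derive_joint_pmf a b x : is_derive x 1 (joint_pmf a b)
  (joint_inflow a b x - jump_rate k lambda1 lambda2 * joint_pmf a b x).
Proof.
have h1 := is_derive_order_pmf lambda1 a x.
have h2 := is_derive_order_pmf lambda2 b x.
rewrite /joint_pmf; apply: is_derive_eq; rewrite /GRing.scale/=.
rewrite /joint_inflow /joint_pmf -mulr_suml -mulr_sumr /jump_rate; ring.
Qed.

Lemma continuous_joint_inflow a b : continuous (joint_inflow a b).
Proof.
by move=> x; apply: cvgD; apply: cvgM; try exact: cvg_cst;
  apply: cvg_sum_seq => i; exact: continuous_joint_pmf.
Qed.

Lemma measurable_joint_pmf a b D : measurable_fun D (EFin \o joint_pmf a b).
Proof.
apply/measurable_EFinP/measurable_funTS.
by apply: continuous_measurable_fun; exact: continuous_joint_pmf.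
Qed.

(** The expected time spent in state (a, b) before x.  It is kept in the
    extended reals because it is summed over all states below. *)
Definition joint_time (x : R) (a b : int) : \bar R :=
  (\int[mu]_(y in `](0%R:R), x[) (joint_pmf a b y)%:E)%E.

Lemma joint_time_ge0 x a b : (0 <= joint_time x a b)%E.
Proof.
apply: integral_ge0 => y /=; rewrite in_itv/= => /andP[y0 _].
by rewrite lee_fin joint_pmf_ge0// ltW.
Qed.

(** The integrated forward equation, with the loss term on the left so that all
    terms are nonnegative and the equation may be summed over states. *)
Lemma joint_pmf_balance a b x : 0 < x ->
  ((joint_pmf a b x)%:E + (jump_rate k lambda1 lambda2)%:E * joint_time x a b =
   (joint_pmf a b 0)%:E +
   (lambda1%:E * \sum_(1 <= i < k.+1) joint_time x (a - i%:Z) b +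
    lambda2%:E * \sum_(1 <= i < k.+1) joint_time x a (b - i%:Z)))%E.
Proof.
move=> x0.
have icont (f : R -> R) : continuous f -> mu.-integrable `](0%R:R), x[ (EFin \o f).
  move=> cf; apply: (@integrableS _ _ _ mu `[0%R, x]) => //.
    by apply: subset_itv; rewrite bnd_simp.
  apply: continuous_compact_integrable; first exact: segment_compact.
  exact: continuous_subspaceT.
have ij a' b' := icont _ (@continuous_joint_pmf a' b').
have cjr : continuous (fun y => joint_inflow a b y - jump_rate k lambda1 lambda2 * joint_pmf a b y).
  move=> y; apply: cvgB; first exact: continuous_joint_inflow.
  by apply: cvgM; [exact: cvg_cst|exact: continuous_joint_pmf].
have cj y : {for y, continuous (joint_pmf a b)} by exact: continuous_joint_pmf.
have := @continuous_FTC2 R _ (joint_pmf a b) 0 x x0 (continuous_subspaceT cjr).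
move=> /(_ _ _)/wrap[||FTC].
- split.
  + by move=> y _; have h := is_derive_joint_pmf a b y; exact: ex_derive.
  + exact: cvg_at_right_filter (cj 0).
  + exact: cvg_at_left_filter (cj x).
- by move=> y _; rewrite derive1E; have h := is_derive_joint_pmf a b y; rewrite derive_val.
have jT a' b' : joint_time x a' b' \is a fin_num.
  by apply: integrable_fin_num => //; exact: ij.
have jP a' b' y : `](0%R:R), x[%classic y -> (0 <= (joint_pmf a' b' y)%:E)%E.
  by rewrite /= in_itv/= => /andP[y0 _]; rewrite lee_fin joint_pmf_ge0// ltW.
have inflowE : (\int[mu]_(y in `](0%R:R), x[) (joint_inflow a b y)%:E =
    lambda1%:E * \sum_(1 <= i < k.+1) joint_time x (a - i%:Z) b +
    lambda2%:E * \sum_(1 <= i < k.+1) joint_time x a (b - i%:Z))%E.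
  rewrite /joint_inflow; under eq_integral do rewrite EFinD !EFinM -!sumEFin.
  have ms (f : nat -> int * int) : measurable_fun `](0%R:R), x[
      (fun y => \sum_(1 <= i < k.+1) (joint_pmf (f i).1 (f i).2 y)%:E)%E.
    by apply: emeasurable_sum => i; exact: measurable_joint_pmf.
  have ps (f : nat -> int * int) y : `](0%R:R), x[%classic y ->
      (0 <= \sum_(1 <= i < k.+1) (joint_pmf (f i).1 (f i).2 y)%:E)%E.
    by move=> yx; apply: sume_ge0 => i _; exact: jP yx.
  have m1 := ms (fun i => (a - i%:Z, b)); have m2 := ms (fun i => (a, b - i%:Z)).
  have p1 := ps (fun i => (a - i%:Z, b)); have p2 := ps (fun i => (a, b - i%:Z)).
  rewrite ge0_integralD//; last 4 first.
  - by move=> y yx; rewrite mule_ge0//; exact: p1.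
  - exact: emeasurable_funM.
  - by move=> y yx; rewrite mule_ge0//; exact: p2.
  - exact: emeasurable_funM.
  rewrite !ge0_integralZl// !ge0_integral_sum//.
  - by move=> i; exact: measurable_joint_pmf.
  - by move=> i y yx; exact: jP yx.
  - by move=> i; exact: measurable_joint_pmf.
  - by move=> i y yx; exact: jP yx.
have lossE : (\int[mu]_(y in `](0%R:R), x[)
      (joint_inflow a b y - jump_rate k lambda1 lambda2 * joint_pmf a b y)%:E =
    \int[mu]_(y in `](0%R:R), x[) (joint_inflow a b y)%:E -
    (jump_rate k lambda1 lambda2)%:E * joint_time x a b)%E.
  have iin := icont _ (@continuous_joint_inflow a b).
  have iout : mu.-integrable `](0%R:R), x[
      (fun y => (jump_rate k lambda1 lambda2)%:E * (joint_pmf a b y)%:E)%E.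
    by apply: integrableZl => //; exact: ij.
  rewrite (@integralB_EFin _ _ _ mu _ (joint_inflow a b)
    (fun y => jump_rate k lambda1 lambda2 * joint_pmf a b y))//.
  by congr (_ - _)%E; rewrite /joint_time -integralZl//; exact: ij.
move: FTC; rewrite (@integral_itv_bndoo _ 0 x _ true false); last first.
  by apply/measurable_EFinP/measurable_funTS; exact: continuous_measurable_fun.
rewrite lossE inflowE; set I := (X in (X - _ = _)%E -> _).
have sf (f : nat -> \bar R) : (forall i, f i \is a fin_num) ->
    (\sum_(1 <= i < k.+1) f i)%E \is a fin_num.
  by move=> ff; elim/big_ind: _ => // y z fy fz; rewrite fin_numD fy fz.
have If : I \is a fin_num.
  by rewrite fin_numD; apply/andP; split; apply: fin_numM => //; exact: sf.
rewrite -(fineK If) -(fineK (jT a b)).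
rewrite -!EFinM -!EFinB => -[] h.
by rewrite -/I -(fineK If) -!EFinD; congr _%:E; lra.
Qed.

End joint.

End order_k_density.

(** * Balance equation of the Skellam process of order k *)

Section difference_law.
Context {R : realType}.
Variables (k : nat) (lambda1 lambda2 : R).
Hypotheses (k_gt0 : (0 < k)%N) (l1 : 0 <= lambda1) (l2 : 0 <= lambda2).
Local Notation mu := (@lebesgue_measure R).
Local Notation rho := (jump_rate k lambda1 lambda2).
Local Notation joint := (joint_pmf k lambda1 lambda2).
Local Notation jtime := (joint_time k lambda1 lambda2).

Variable g : int -> R -> R.
Hypothesis g_le1 : forall n x, 0 <= x -> 0 <= g n x <= 1.
Hypothesis gE : forall n x, 0 <= x ->
  ((g n x)%:E = \sum_(0 <= b <oo) (joint (n + b%:Z) b%:Z x)%:E)%E.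

Lemma difference_pmf0 n : g n 0 = unit_mass n.
Proof.
have := gE n (lexx 0); rewrite (@nneseries_finite _ _ 1).
- rewrite big_nat1 /joint_pmf !order_pmf0 addr0 eqxx mulr1 => -[->].
  by [].
- by move=> b; rewrite lee_fin joint_pmf_ge0.
- move=> b b0; rewrite /joint_pmf !order_pmf0.
  by rewrite [b%:Z == 0](_ : _ = false) ?mulr0//; move: b0; case: b.
Qed.

Lemma measurable_difference_pmf n : measurable_fun `](0%R:R), +oo[ (g n).
Proof.
apply/measurable_EFinP.
apply: (eq_measurable_fun (fun x => \sum_(b <oo | b \in predT)
    (joint (n + b%:Z) b%:Z x)%:E)%E).
  move=> x; rewrite inE/= in_itv/= andbT => x0; rewrite /= gE ?(ltW x0)//.
apply: ge0_emeasurable_sum => [b x|b _]; last exact: measurable_joint_pmf.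
by rewrite /= in_itv/= andbT => x0 _; rewrite lee_fin joint_pmf_ge0// ltW.
Qed.

Lemma integrable_difference_pmf n x :
  mu.-integrable `](0%R:R), x[ (EFin \o g n).
Proof.
apply: integrable_itv01; first exact: measurable_difference_pmf.
by move=> y y0; apply: g_le1; exact: ltW.
Qed.

Lemma difference_time n x :
  (\int[mu]_(y in `](0%R:R), x[) (g n y)%:E =
   \sum_(0 <= b <oo) jtime x (n + b%:Z) b%:Z)%E.
Proof.
rewrite /joint_time -integral_nneseries//.
- by apply: eq_integral => y; rewrite inE/= in_itv/= => /andP[y0 _]; rewrite gE// ltW.
- by move=> b; exact: measurable_joint_pmf.
- move=> b y; rewrite /= in_itv/= => /andP[y0 _].
  by rewrite lee_fin joint_pmf_ge0// ltW.
Qed.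

(** A shift of both coordinates leaves the difference unchanged; the first i
    terms vanish since the second coordinate is negative there. *)
Lemma difference_time_shift n x (i : nat) :
  (\sum_(0 <= b <oo) jtime x (n + b%:Z) (b%:Z - i%:Z) =
   \int[mu]_(y in `](0%R:R), x[) (g (n + i%:Z) y)%:E)%E.
Proof.
have jt0 a b : (0 <= jtime x a b)%E by exact: joint_time_ge0.
rewrite difference_time (nneseries_split 0 i)// add0n [X in (X + _)%E](_ : _ = 0%E).
  rewrite add0e -(nneseries_addn _)//; apply: eq_eseriesr => b _.
  by congr jtime; rewrite PoszD; ring.
rewrite big_nat big1// => b /andP[_ bi]; rewrite /joint_time.
rewrite (eq_integral (cst 0%E)) ?integral0// => y _.
by rewrite /joint_pmf [X in _ * X]order_pmf_neg ?mulr0//; move: bi; lia.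
Qed.

(** Sum [joint_pmf_balance] over the states (n + b, b).  The integrated form is
    used because nonnegative series may be summed and integrated freely, while
    differentiating the series would need uniform estimates. *)
Lemma difference_pmf_balance n x : 0 < x ->
  g n x + rho * conv (fun=> 1) (g n) x =
  unit_mass n + jump k lambda1 lambda2 (fun m => conv (fun=> 1) (g m) x) n.
Proof.
move=> x0.
have jt0 a b : (0 <= jtime x a b)%E by exact: joint_time_ge0.
have j0 a b : (0 <= (joint a b x)%:E)%E by rewrite lee_fin joint_pmf_ge0// ltW.
have rho0 : (0 <= rho%:E)%E by rewrite lee_fin jump_rate_ge0.
have convE m : (conv (fun=> 1) (g m) x)%:E =
    (\int[mu]_(y in `](0%R:R), x[) (g m y)%:E)%E.
  rewrite /conv /Rintegral; under eq_integral do rewrite mul1r.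
  by rewrite fineK//; apply: integrable_fin_num => //; exact: integrable_difference_pmf.
have E b := joint_pmf_balance k_gt0 l1 l2 (n + b%:Z) b%:Z x0.
have : (\sum_(0 <= b <oo) ((joint (n + b%:Z) b%:Z x)%:E + rho%:E * jtime x (n + b%:Z) b%:Z) =
  \sum_(0 <= b <oo) ((joint (n + b%:Z) b%:Z 0)%:E +
   (lambda1%:E * \sum_(1 <= i < k.+1) jtime x (n + b%:Z - i%:Z) b%:Z +
    lambda2%:E * \sum_(1 <= i < k.+1) jtime x (n + b%:Z) (b%:Z - i%:Z))))%E.
  by apply: eq_eseriesr => b _; exact: E.
rewrite nneseriesD//; last by move=> b _; rewrite mule_ge0.
rewrite nneseriesZl// -gE ?(ltW x0)// -difference_time -convE.
rewrite nneseriesD//; last 2 first.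
- by move=> b _; rewrite lee_fin joint_pmf_ge0.
- by move=> b *; apply: adde_ge0; apply: mule_ge0; rewrite ?lee_fin//; exact: sume_ge0.
rewrite -gE// difference_pmf0 nneseriesD//; last 2 first.
- by move=> b *; apply: mule_ge0; rewrite ?lee_fin//; exact: sume_ge0.
- by move=> b *; apply: mule_ge0; rewrite ?lee_fin//; exact: sume_ge0.
rewrite !nneseriesZl//; last 2 first.
- by move=> b *; exact: sume_ge0.
- by move=> b *; exact: sume_ge0.
rewrite !nneseries_sum_nat//.
rewrite [X in (_ + (_ * X + _))%E](eq_bigr (fun i : nat => (conv (fun=> 1) (g (n - i%:Z)) x)%:E)); last first.
  move=> i _; rewrite convE difference_time; apply: eq_eseriesr => b _.
  by congr jtime; ring.
rewrite [X in (_ + (_ + _ * X))%E](eq_bigr (fun i : nat => (conv (fun=> 1) (g (n + i%:Z)) x)%:E)); last first.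
  by move=> i _; rewrite convE difference_time_shift.
by rewrite !sumEFin -!EFinM -!EFinD => -[].
Qed.

End difference_law.

(** * Laws of the processes of order k *)

Section process_pmf.
Context {R : realType} {d : measure_display} {T : measurableType d}.

Lemma process_pmf_le1 (P : probability T R) (S : R -> T -> int) n x :
  (forall y m, 0 <= y -> measurable [set w | S y w = m]) ->
  0 <= x -> 0 <= process_pmf P S n x <= 1.
Proof.
move=> mS x0; rewrite /process_pmf fine_ge0//= -lee_fin fineK ?fin_num_measure//.
  by apply: probability_le1; exact: mS.
exact: mS.
Qed.

End process_pmf.

Section order_k_processes.
Context {R : realType} {d : measure_display} {T : measurableType d}.
Context (P : probability T R).
Variable k : nat.
Hypothesis k_gt0 : (0 < k)%N.

Lemma poisson_process0 lambda (N : R -> T -> nat) w :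
  poisson_process P lambda N -> N 0 w = 0%N.
Proof.
move=> [hN _]; have := iap_zero hN w => /eqP.
by rewrite pnatr_eq0 => /eqP.
Qed.

Lemma measurable_poisson_process_event lambda (N : R -> T -> nat) x j :
  poisson_process P lambda N -> 0 <= x -> measurable [set w | N x w = j].
Proof.
move=> [hN _] x0; have mN := iap_measurable hN x0.
rewrite (_ : [set w | _] = setT `&` (fun w => (N x w)%:R : R) @^-1` [set j%:R]).
  exact: mN.
apply/seteqP; split => w /=; first by move=> ->.
by move=> [_ /eqP]; rewrite eqr_nat => /eqP.
Qed.

Lemma poisson_process_law lambda (N : R -> T -> nat) x j :
  0 < lambda -> poisson_process P lambda N -> 0 <= x ->
  P [set w | N x w = j] = (pois lambda j x)%:E.
Proof.
move=> l0 hN; rewrite le_eqVlt => /predU1P[<-|x0].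
  rewrite pois0; have [->|j0] := eqVneq j 0%N.
    rewrite (_ : [set w | _] = setT) ?probability_setT//.
    by apply/seteqP; split => // w _; exact: poisson_process0 hN.
  rewrite (_ : [set w | _] = set0) ?measure0//.
  apply/seteqP; split => // w /=; rewrite (poisson_process0 w hN) => h.
  by rewrite h eqxx in j0.
have [_ /(_ 0 x j (lexx 0) x0)] := hN.
rewrite subr0 /poisson_pmf mulr_gt0// /pois mulNr => <-.
congr (P _); apply/seteqP; split => w /=; by rewrite (poisson_process0 w hN) add0n.
Qed.

(** Right-continuity of an integer-valued path. *)
Lemma poisson_process_right_constant lambda (N : R -> T -> nat) w t :
  poisson_process P lambda N -> 0 <= t -> \forall s \near t^'+, N s w = N t w.
Proof.
move=> [hN _] t0; have /cvgrPdist_lt/(_ 1 ltr01) := (@iap_right_continuous _ _ _ _ _ hN w _ t0).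
apply: filterS => s; rewrite ltr_norml => /andP[h1 h2].
apply/eqP; rewrite eqn_leq -ltnS -[X in _ && X]ltnS -!(ltr_nat R) -!natr1.
by apply/andP; split; lra.
Qed.

Section one_process.
Variables (lambda : R) (M : R -> T -> nat).
Hypothesis lambda_gt0 : 0 < lambda.
Hypothesis hM : poisson_process_of_order P k lambda M.

(** Condition on the number of jumps, which is independent of their sizes. *)
Lemma order_process_law x m : 0 <= x ->
  measurable [set w | M x w = m] /\
  P [set w | M x w = m] = (order_pmf k lambda m%:Z x)%:E.
Proof.
move=> x0; have [N [X [hN uX iX iNX ME]]] := hM.
have kl0 : 0 < k%:R * lambda by rewrite mulr_gt0// ltr0n.
have mN j := measurable_poisson_process_event j hN x0.
have mA j := measurable_sum_event uX j m.
have E j : [set w | M x w = m] `&` [set w | N x w = j] =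
    [set w | N x w = j] `&` sum_event X j m.
  apply/seteqP; split => w /=; rewrite /sum_event/= ME//.
    by move=> [h <-].
  by move=> [-> h].
have mM : measurable [set w | M x w = m].
  rewrite (_ : [set w | _] = \bigcup_j ([set w | M x w = m] `&` [set w | N x w = j])).
    by apply: bigcup_measurable => j _; rewrite E; exact: measurableI.
  by apply/seteqP; split => [w h|w [j _ []]//]; exists (N x w).
split=> //; rewrite (@measure_split_nat _ _ _ P (N x))//.
have key j : P ([set w | M x w = m] `&` [set w | N x w = j]) =
    (pois (k%:R * lambda) j x * sum_law k j m%:Z)%:E.
  rewrite E iNX.
  - by rewrite (poisson_process_law j kl0 hN x0) (probability_sum_event k_gt0 uX iX).
  - exact: (generated_events_preimage (D := times) (X := N) (i := x) (B := [set j])).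
  - exact: sum_event_generated.
under eq_eseriesr do rewrite key.
rewrite (@nneseries_finite _ _ m.+1).
- by rewrite sumEFin big_mkord.
- by move=> j; rewrite lee_fin mulr_ge0 ?sum_law_ge0 ?pois_ge0 ?(ltW kl0).
- by move=> j mj; rewrite sum_law_eq0 ?mulr0//; move: mj; lia.
Qed.

Lemma order_process_right_constant w t : 0 <= t ->
  \forall s \near t^'+, M s w = M t w.
Proof.
move=> t0; have [N [X [hN _ _ _ ME]]] := hM.
have := poisson_process_right_constant w hN t0; apply: filter_app.
near=> s => Ns; rewrite !ME// ?Ns//.
by apply: le_trans t0 _; apply: ltW; near: s; exact: nbhs_right_gt.
Unshelve. all: by end_near. Qed.

End one_process.

Section difference.
Variables (lambda1 lambda2 : R) (S : R -> T -> int).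
Hypotheses (l1 : 0 < lambda1) (l2 : 0 < lambda2).
Hypothesis hS : skellam_process_of_order P k lambda1 lambda2 S.

Lemma skellam_right_constant w t : 0 <= t -> \forall s \near t^'+, S s w = S t w.
Proof.
move=> t0; have [M1 [M2 [h1 h2 _ SE]]] := hS.
have c1 := order_process_right_constant h1 w t0.
have c2 := order_process_right_constant h2 w t0.
have c0 : \forall s \near t^'+, t < s by exact: nbhs_right_gt.
apply: filterS3 c0 c1 c2 => s ts e1 e2.
by rewrite !SE ?e1 ?e2// (le_trans t0)// ltW.
Qed.

(** Condition on the value b of the negative component. *)
Lemma skellam_law x n : 0 <= x ->
  measurable [set w | S x w = n] /\
  P [set w | S x w = n] =
    (\sum_(0 <= b <oo) (joint_pmf k lambda1 lambda2 (n + b%:Z) b%:Z x)%:E)%E.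
Proof.
move=> x0; have [M1 [M2 [h1 h2 i12 SE]]] := hS.
have m1 a := (order_process_law l1 h1 a x0).1.
have m2 a := (order_process_law l2 h2 a x0).1.
have E b : [set w | S x w = n] `&` [set w | M2 x w = b] =
    (if 0 <= n + b%:Z then [set w | M1 x w = absz (n + b%:Z)] else set0) `&`
    [set w | M2 x w = b].
  apply/seteqP; split => w /=; rewrite SE//.
    by move=> [h hb]; split => //; case: ifPn => /=; lia.
  by case: ifPn => // nb [/= h hb]; split => //; lia.
have mE b : measurable ([set w | S x w = n] `&` [set w | M2 x w = b]).
  by rewrite E; apply: measurableI => //; case: ifP.
have mS : measurable [set w | S x w = n].
  rewrite (_ : [set w | _] = \bigcup_b ([set w | S x w = n] `&` [set w | M2 x w = b])).
    by apply: bigcup_measurable => b _.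
  by apply/seteqP; split => [w h|w [j _ []]//]; exists (M2 x w).
split=> //; rewrite (@measure_split_nat _ _ _ P (M2 x))//.
apply: eq_eseriesr => b _; rewrite E.
have [_ P2] := order_process_law l2 h2 b x0.
case: ifPn => nb; last first.
  rewrite set0I measure0 /joint_pmf order_pmf_neg ?mul0r//.
  by rewrite ltNge.
have [_ P1] := order_process_law l1 h1 (absz (n + b%:Z)) x0.
rewrite i12.
- by rewrite P1 P2 /joint_pmf gez0_abs// EFinM.
- exact: (generated_events_preimage (D := times) (X := M1) (i := x) (B := [set _])).
- exact: (generated_events_preimage (D := times) (X := M2) (i := x) (B := [set _])).
Qed.

Lemma skellam_pmfE x n : 0 <= x ->
  ((process_pmf P S n x)%:E =
   \sum_(0 <= b <oo) (joint_pmf k lambda1 lambda2 (n + b%:Z) b%:Z x)%:E)%E.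
Proof.
move=> x0; have [mS <-] := skellam_law n x0.
by rewrite /process_pmf fineK// fin_num_measure.
Qed.

Lemma process_pmf_itv01 n x : 0 <= x -> 0 <= process_pmf P S n x <= 1.
Proof.
move=> x0; apply: process_pmf_le1 => // y m y0.
by have [] := skellam_law m y0.
Qed.

End difference.
End order_k_processes.

(** * The resolvent equation *)

Section laplace_primitive.
Context {R : realType}.
Local Notation mu := (@lebesgue_measure R).
Implicit Types (f : R -> R) (z c : R).

Lemma has_laplace_primitive f z c : 0 < z -> has_laplace f z c ->
  (forall t, 0 < t -> mu.-integrable `](0%R:R), t[ (EFin \o f)) ->
  has_laplace (conv (fun=> 1) f) z (c / z).
Proof.
move=> z0 hf fi; rewrite [c / z](_ : _ = 1 / z * c); last by ring.
apply: has_laplace_conv => //; first exact: has_laplace_cst.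
by move=> t t0; apply: eq_integrable (fi t t0) => // s _; rewrite mul1r.
Qed.

Section balance_resolvent.
Variables (k : nat) (lambda1 lambda2 : R).
Hypotheses (l1 : 0 <= lambda1) (l2 : 0 <= lambda2).
Local Notation rho := (jump_rate k lambda1 lambda2).
Variable g : int -> R -> R.
Hypothesis g_le1 : forall n x, 0 <= x -> 0 <= g n x <= 1.
Hypothesis mg : forall n, measurable_fun `](0%R:R), +oo[ (g n).
Hypothesis ig : forall n x, mu.-integrable `](0%R:R), x[ (EFin \o g n).
Hypothesis balance : forall n x, 0 < x ->
  g n x + rho * conv (fun=> 1) (g n) x =
  unit_mass n + jump k lambda1 lambda2 (fun m => conv (fun=> 1) (g m) x) n.

Definition laplace_value f s : R :=
  \int[mu]_(x in `]0, +oo[) (expR (- s * x) * f x).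

Lemma has_laplace_pmf n s : 0 < s -> has_laplace (g n) s (laplace_value (g n) s).
Proof.
move=> s0; have [i1 _] := has_laplace_cst 1 s0.
have i : mu.-integrable `](0%R:R), +oo[ (fun x => (expR (- s * x) * g n x)%:E).
  apply: le_integrable i1 => //.
    by apply/measurable_EFinP; apply: measurable_funM; [exact: measurable_expR_lin|exact: mg].
  move=> x /=; rewrite in_itv/= andbT => x0.
  have /andP[g0 g1] := g_le1 n (ltW x0).
  by rewrite lee_fin !ger0_norm ?mulr_ge0 ?expR_ge0// ler_wpM2l ?expR_ge0.
by split => //; rewrite /laplace_value /Rintegral fineK//; exact: integrable_fin_num.
Qed.

Lemma laplace_value_le n s : 0 < s -> `|laplace_value (g n) s| <= s^-1.
Proof.
move=> s0; have [i1 v1] := has_laplace_cst 1 s0; have [i2 v2] := has_laplace_pmf n s0.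
rewrite ger0_norm; last first.
  apply: Rintegral_ge0 => x; rewrite /= in_itv/= andbT => x0.
  by rewrite mulr_ge0 ?expR_ge0//; case/andP: (g_le1 n (ltW x0)).
rewrite -lee_fin -v2 -[s^-1]mul1r -v1; apply: ge0_le_integral => //.
- move=> x; rewrite /= in_itv/= andbT => x0.
  by rewrite lee_fin mulr_ge0 ?expR_ge0//; case/andP: (g_le1 n (ltW x0)).
- by case/integrableP: i2.
- by case/integrableP: i1.
- move=> x; rewrite /= in_itv/= andbT => x0.
  by rewrite lee_fin ler_wpM2l ?expR_ge0//; case/andP: (g_le1 n (ltW x0)).
Qed.

(** The Laplace transform of the balance equation, multiplied by s. *)
Lemma laplace_value_resolvent n s : 0 < s ->
  (s + rho) * laplace_value (g n) s =
  unit_mass n + jump k lambda1 lambda2 (fun m => laplace_value (g m) s) n.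
Proof.
move=> s0.
have hc m : has_laplace (conv (fun=> 1) (g m)) s (laplace_value (g m) s / s).
  by apply: has_laplace_primitive => //; exact: has_laplace_pmf.
have h1 := has_laplaceD (has_laplace_pmf n s0) (has_laplaceZ rho (hc n)).
have h2 := has_laplaceD (has_laplace_cst (unit_mass n) s0)
  (has_laplace_jump k lambda1 lambda2 n hc).
have h1' := eq_has_laplace (fun x x0 => balance n x0) h1.
have := has_laplace_uniq h1' h2.
have -> : jump k lambda1 lambda2 (fun m => laplace_value (g m) s / s) n =
    jump k lambda1 lambda2 (fun m => laplace_value (g m) s) n / s.
  rewrite [RHS]mulrC -jumpZ; apply: eq_jump => m; exact: mulrC.
move=> /(congr1 (fun x => s * x)); rewrite !mulrDr !(mulrCA s) mulfV ?gt_eqF//.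
by rewrite !mulr1 => <-; ring.
Qed.

End balance_resolvent.
End laplace_primitive.

(** * The tempered stable subordinator *)

Section subordinator.
Context {R : realType} {d : measure_display} {T : measurableType d}.
Context (P : probability T R).
Local Notation mu := (@lebesgue_measure R).
Variables (eta nu : R) (D : R -> T -> R).
Hypotheses (eta_gt0 : 0 < eta) (nu_gt0 : 0 < nu).
Hypothesis hD : tempered_stable_subordinator P eta nu D.

Definition tempered_exponent (z : R) : R := (eta + z) `^ nu - eta `^ nu.

Let hI : increasing_additive_process P D := sub_additive (tss_subordinator hD).

Definition sub_cdf (y t : R) : R := fine (P [set w | D y w <= t]).

Lemma tempered_exponent_gt0 z : 0 < z -> 0 < tempered_exponent z.
Proof.
move=> z0; rewrite subr_gt0 gt0_ltr_powR ?nnegrE ?addr_ge0 ?(ltW eta_gt0) ?(ltW z0)//.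
by rewrite ltrDl.
Qed.

Lemma subordinator_ge0 y w : 0 <= y -> 0 <= D y w.
Proof. by move=> y0; rewrite -(iap_zero hI w); exact: (iap_nondecreasing hI). Qed.

Lemma measurable_subordinator_le y t : 0 <= y -> measurable [set w | D y w <= t].
Proof.
move=> y0; have mD := iap_measurable hI y0.
rewrite (_ : [set w | _] = setT `&` D y @^-1` `]-oo, t]%classic).
  by apply: mD => //; exact: measurable_itv.
by apply/seteqP; split => w /=; rewrite in_itv/=; [|case].
Qed.

Lemma sub_cdfE y t : 0 <= y -> P [set w | D y w <= t] = (sub_cdf y t)%:E.
Proof.
move=> y0; rewrite /sub_cdf fineK// fin_num_measure//.
exact: measurable_subordinator_le.
Qed.

Lemma sub_cdf_itv01 y t : 0 <= y -> 0 <= sub_cdf y t <= 1.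
Proof.
move=> y0; rewrite -!lee_fin -sub_cdfE// measure_ge0/=.
by apply: probability_le1; exact: measurable_subordinator_le.
Qed.

Lemma sub_cdf_nondecreasing y s t : 0 <= y -> s <= t -> sub_cdf y s <= sub_cdf y t.
Proof.
move=> y0 st; rewrite -lee_fin -!sub_cdfE//; apply: le_measure.
- by rewrite inE; exact: measurable_subordinator_le.
- by rewrite inE; exact: measurable_subordinator_le.
- by move=> w /=; move/le_trans; exact.
Qed.

Lemma sub_cdf_nonincreasing x y t : 0 <= x -> x <= y -> sub_cdf y t <= sub_cdf x t.
Proof.
move=> x0 xy; have y0 := le_trans x0 xy.
rewrite -lee_fin -!sub_cdfE//; apply: le_measure.
- by rewrite inE; exact: measurable_subordinator_le.
- by rewrite inE; exact: measurable_subordinator_le.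
- by move=> w /=; apply: le_trans; exact: (iap_nondecreasing hI).
Qed.

Lemma sub_cdf_lt0 y t : 0 <= y -> t < 0 -> sub_cdf y t = 0.
Proof.
move=> y0 t0; rewrite /sub_cdf (_ : [set w | _] = set0) ?measure0//.
apply/seteqP; split => // w /= h.
by have := le_lt_trans (le_trans (subordinator_ge0 w y0) h) t0; rewrite ltxx.
Qed.

Lemma subordinator_laplace y z : 0 <= y -> 0 < z ->
  (\int[P]_w (expR (- z * D y w))%:E = (expR (- y * tempered_exponent z))%:E)%E.
Proof. by move=> y0 z0; have := tss_laplace hD y0 z0; rewrite unlock. Qed.

Lemma measurable_subordinator_expR y z : 0 <= y ->
  measurable_fun setT (fun w => expR (- z * D y w)).
Proof.
move=> y0; apply: measurableT_comp => //; apply: measurable_funM => //.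
exact: (iap_measurable hI y0).
Qed.

(** Exponential Markov inequality.  It gives the integrability in y needed for
    the occupation integral, and the behaviour as y or z tends to infinity. *)
Lemma sub_cdf_le_expR y t z : 0 <= y -> 0 < z ->
  sub_cdf y t <= expR (z * t) * expR (- y * tempered_exponent z).
Proof.
move=> y0 z0; rewrite -lee_fin -sub_cdfE// EFinM -subordinator_laplace//.
have mE := measurable_subordinator_expR z y0.
have mA := measurable_subordinator_le t y0.
rewrite -ge0_integralZl//; last exact/measurable_EFinP.
rewrite (probability_indic P mA); apply: ge0_le_integral => //.
- by apply/measurable_EFinP; exact: measurable_indic.
- by apply: emeasurable_funM => //; exact/measurable_EFinP.
- move=> w _; rewrite -EFinM lee_fin indicE -expRD.
  case: (boolP (w \in _)) => [|_]; last by rewrite expR_ge0.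
  rewrite inE/= => h; rewrite -expR0 ler_expR mulNr -mulrBr.
  by rewrite mulr_ge0 ?subr_ge0// ltW.
Qed.

(** Exchange the integral in t with the mean: for a fixed outcome the integral
    of e^(-z t) over t >= D y is e^(-z D y) / z. *)
Lemma has_laplace_sub_cdf y z : 0 <= y -> 0 < z ->
  has_laplace (sub_cdf y) z (expR (- y * tempered_exponent z) / z).
Proof.
move=> y0 z0; apply: ge0_has_laplace.
- apply: nondecreasing_measurable => // s t st; exact: sub_cdf_nondecreasing.
- by move=> t _; case/andP: (sub_cdf_itv01 t y0).
pose h := fun tw : measurableTypeR R * T =>
  (if D y tw.2 <= tw.1 then expR (- z * tw.1) else 0)%:E.
have mh : measurable_fun setT h.
  apply/measurable_EFinP; apply: measurable_fun_ifT => //.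
  - apply: measurable_fun_ler => //.
    exact: (measurableT_comp (iap_measurable hI y0)).
  - by apply: (measurableT_comp (@measurable_expR_lin R z setT)).
have h0 tw : (0 <= h tw)%E by rewrite /h lee_fin; case: ifP => // _; exact: expR_ge0.
have inner t : (\int[P]_w h (t, w) = (expR (- z * t) * sub_cdf y t)%:E)%E.
  rewrite /h/= EFinM -sub_cdfE//.
  have mA := measurable_subordinator_le t y0.
  rewrite (probability_indic P mA) -ge0_integralZl//; last first.
    by apply/measurable_EFinP; exact: measurable_indic.
  apply: eq_integral => w _; rewrite -EFinM indicE; congr _%:E.
  case: ifPn => hw; first by rewrite mem_set ?mulr1.
  by rewrite memNset ?mulr0//=; exact/negP.
have outer w : (\int[mu]_t h (t, w) = (z^-1)%:E * (expR (- z * D y w))%:E)%E.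
  transitivity (\int[mu]_(t in `[D y w, +oo[) (expR (- z * t))%:E)%E.
    rewrite [RHS]integral_mkcond; apply: eq_integral => t _.
    rewrite /h patchE/=.
    have -> : (t \in `[D y w, +oo[%classic) = (D y w <= t).
      by apply/idP/idP; rewrite inE/= in_itv/= andbT.
    by case: ifP.
  by rewrite integral_expR_tail// -EFinM mulrC.
transitivity (\int[mu]_t \int[P]_w h (t, w))%E.
  rewrite integral_itv_obnd_cbnd; last first.
    apply/measurable_EFinP; apply: measurable_funM; first exact: measurable_expR_lin.
    apply: nondecreasing_measurable => // s t st; exact: sub_cdf_nondecreasing.
  rewrite integral_mkcond; apply: eq_integral => t _; rewrite inner patchE.
  case: ifPn => //; rewrite notin_setE/= in_itv/= andbT => /negP; rewrite -ltNge => t0.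
  by rewrite sub_cdf_lt0 ?mulr0.
rewrite (fubini_tonelli h mh h0)//=.
under eq_integral do rewrite outer.
rewrite ge0_integralZl//.
- by rewrite subordinator_laplace// -EFinM mulrC.
- by apply/measurable_EFinP; exact: measurable_subordinator_expR.
- by rewrite lee_fin invr_ge0 ltW.
Qed.

End subordinator.

(** * Occupation of the subordinator *)

Section discretization.
Context {R : realType}.

Definition grid_index (m : nat) (t : R) : nat := Num.truncn (m.+1%:R * t).

(** The right end point of the grid cell [j, j+1[ / (m+1).  The approximation of
    t through it is strictly from the right, as right-continuity of paths
    requires. *)
Definition grid (m j : nat) : R := j.+1%:R / m.+1%:R.

Lemma grid_ge0 m j : 0 <= grid m j. Proof. by rewrite divr_ge0. Qed.

Lemma grid_index_itv m t : 0 <= t ->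
  t < grid m (grid_index m t) <= t + m.+1%:R^-1.
Proof.
move=> t0; have mt0 : 0 <= m.+1%:R * t by rewrite mulr_ge0.
have /andP[h1 h2] := Num.Theory.truncn_itv mt0.
have m0 : 0 < (m.+1%:R : R) by rewrite ltr0n.
rewrite /grid ltr_pdivlMr// mulrC h2/= ler_pdivrMr// mulrDl mulVf ?gt_eqF//.
by rewrite -natr1 lerD2r mulrC.
Qed.

Lemma grid_cvg t : 0 <= t -> grid m (grid_index m t) @[m --> \oo] --> t^'+.
Proof.
move=> t0.
have c : grid m (grid_index m t) @[m --> \oo] --> t.
  apply: (@squeeze_cvgr _ _ _ _ (fun=> t) (fun m => t + m.+1%:R^-1)).
  - by apply: nearW => m; have /andP[/ltW -> ->] := grid_index_itv m t0.
  - exact: cvg_cst.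
  - rewrite -[X in _ --> X]addr0; apply: cvgD; first exact: cvg_cst.
    exact: cvg_harmonic.
move=> A /= [e e0 he].
have /cvgrPdist_lt/(_ e e0) := c; apply: filterS => m h.
by apply: he => //=; have /andP[] := grid_index_itv m t0.
Qed.

Lemma measurable_grid_index m j : measurable [set t : R | grid_index m t = j].
Proof.
have md : measurable_fun setT (fun t : R => (grid_index m t)%:R : R).
  apply: nondecreasing_measurable => // s t st; rewrite ler_nat.
  by apply: Num.Theory.le_truncn; rewrite ler_wpM2l.
rewrite (_ : [set t | _] = setT `&` (fun t : R => (grid_index m t)%:R : R) @^-1` [set j%:R]).
  exact: md.
apply/seteqP; split => w /=; first by move=> ->.
by move=> [_ /eqP]; rewrite eqr_nat => /eqP.
Qed.

Lemma measurable_fun_nat_index {d d'} {X : measurableType d} {E : measurableType d'}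
    (u : nat -> X -> E) (Y : X -> nat) :
  (forall j, measurable_fun setT (u j)) -> (forall j, measurable [set x | Y x = j]) ->
  measurable_fun setT (fun x => u (Y x) x).
Proof.
move=> mu_ mY _ B mB; rewrite setTI.
rewrite (_ : _ @^-1` B = \bigcup_j ([set x | Y x = j] `&` (setT `&` u j @^-1` B))).
  by apply: bigcup_measurable => j _; apply: measurableI => //; exact: mu_.
apply/seteqP; split => x /=; first by move=> h; exists (Y x).
by move=> [j _ [<- []]].
Qed.

End discretization.

Section occupation.
Context {R : realType} {d : measure_display} {T : measurableType d}.
Context (P : probability T R).
Local Notation mu := (@lebesgue_measure R).
Local Notation Rpos := (`](0%R : R), +oo[%classic).
Variables (eta nu : R) (D : R -> T -> R).
Hypotheses (eta_gt0 : 0 < eta) (nu_gt0 : 0 < nu).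
Hypothesis hD : tempered_stable_subordinator P eta nu D.
Local Notation F := (sub_cdf P D).

Let hI : increasing_additive_process P D := sub_additive (tss_subordinator hD).

Lemma probability_cvg_indic (A : nat -> set T) (B : set T) :
  (forall m, measurable (A m)) -> measurable B ->
  (forall w, \forall m \near \oo, (w \in A m) = (w \in B)) ->
  P (A m) @[m --> \oo] --> P B.
Proof.
move=> mA mB AB.
rewrite probability_indic//; under eq_fun do rewrite probability_indic//.
have [|||||_ _] := @dominated_convergence _ _ _ P setT measurableT
  (fun m w => (\1_(A m) w : R)%:E) (fun w => (\1_B w)%:E) (cst 1%E).
- by move=> m; apply/measurable_EFinP; exact: measurable_indic.
- by apply/measurable_EFinP; exact: measurable_indic.
- apply/aeW => w _; apply: cvgn_EFin; apply: cvg_near_cst.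
  by move: (AB w); apply: filterS => m h; rewrite !indicE h.
- exact: finite_measure_integrable_cst.
- by apply/aeW => w m _ /=; rewrite lee_fin indicE; case: (_ \in _); rewrite ?normr1 ?normr0.
exact.
Qed.

(** A distribution function is right-continuous: if D y > t then D y exceeds
    the approximations of t eventually. *)
Lemma sub_cdf_grid_cvg y t : 0 <= y -> 0 <= t ->
  F y (grid m (grid_index m t)) @[m --> \oo] --> F y t.
Proof.
move=> y0 t0; apply/fine_cvg; rewrite /= -(sub_cdfE hD)//.
apply: probability_cvg_indic.
- by move=> m; exact: (measurable_subordinator_le hD).
- exact: (measurable_subordinator_le hD).
move=> w; have [Dt|tD] := leP (D y w) t.
  apply: nearW => m; rewrite !mem_set//=.
  by have /andP[/ltW h _] := grid_index_itv m t0; exact: le_trans Dt h.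
have Dnear : \forall s \near t^'+, s < D y w by exact: nbhs_right_lt.
have : \forall m \near \oo, grid m (grid_index m t) < D y w.
  exact: (grid_cvg t0 Dnear).
apply: filterS => m /= h.
by rewrite !memNset//=; apply/negP; rewrite -ltNge.
Qed.

(** The distribution function of D y at t, extended to the whole plane so
    that joint measurability can be stated on a product of types. *)
Definition clamped_cdf (y t : R) : R := F (Num.max y 0) (Num.max t 0).

(** A function monotone in y and right-continuous in t is jointly measurable:
    it is the pointwise limit of functions which depend on t only through its
    grid cell and are monotone in y on each cell. *)
Lemma measurable_clamped_cdf :
  measurable_fun setT (fun ty : measurableTypeR R * measurableTypeR R =>
    clamped_cdf ty.2 ty.1).
Proof.
pose u m j (ty : measurableTypeR R * measurableTypeR R) :=
  F (Num.max ty.2 0) (grid m j) : R.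
pose Y m (ty : measurableTypeR R * measurableTypeR R) :=
  grid_index m (Num.max ty.1 0).
have max0 (y : R) : 0 <= Num.max y 0 by rewrite le_max lexx orbT.
apply: (@measurable_fun_cvg _ _ R _ (fun m ty => u m (Y m ty) ty)).
- move=> m; apply: measurable_fun_nat_index => j.
  + rewrite /u; apply: (@measurableT_comp _ _ _ _ _ _
      (fun y : R => F (Num.max y 0) (grid m j)) _ snd) => //.
    apply: nonincreasing_measurable => // x y xy.
    apply: (sub_cdf_nonincreasing hD) => //.
    by rewrite ge_max !le_max xy lexx orbT.
  + rewrite (_ : [set x | _] = setT `&` (fun ty => Num.max ty.1 0) @^-1` [set t : R | grid_index m t = j]).
      apply: (measurable_maxr _ _) => //.
      exact: measurable_grid_index.
    by rewrite setTI.
- by move=> ty _; apply: sub_cdf_grid_cvg.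
Qed.

Variable g : R -> R.
Hypothesis mg : measurable_fun Rpos g.
Hypothesis g_itv01 : forall y, 0 < y -> 0 <= g y <= 1.

(** The mean of the integral of g up to the inverse time L t; see
    [has_mean_occupation]. *)
Definition occupation (t : R) : R := \int[mu]_(y in `]0, +oo[) (g y * F y t).

Lemma measurable_sub_cdf_l t : measurable_fun Rpos (F ^~ t).
Proof.
apply: (eq_measurable_fun (fun y : R => F (Num.max y 0) t)).
  by move=> y; rewrite inE/= in_itv/= andbT => y0; rewrite max_l// ltW.
apply: nonincreasing_measurable => // x y xy; apply: (sub_cdf_nonincreasing hD).
  by rewrite le_max lexx orbT.
by rewrite ge_max !le_max xy lexx orbT.
Qed.

Lemma integrable_occupation t :
  mu.-integrable Rpos (fun y => (g y * F y t)%:E).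
Proof.
have [ie _] := has_laplace_cst (expR t) (tempered_exponent_gt0 eta_gt0 nu_gt0 ltr01).
apply: le_integrable ie => //.
  by apply/measurable_EFinP; apply: measurable_funM => //; exact: measurable_sub_cdf_l.
move=> y /=; rewrite in_itv/= andbT => y0.
have /andP[g0 g1] := g_itv01 y0; have /andP[F0 F1] := sub_cdf_itv01 hD t (ltW y0).
rewrite lee_fin !ger0_norm ?mulr_ge0 ?expR_ge0//.
apply: (@le_trans _ _ (F y t)); first by rewrite ler_piMl.
apply: le_trans (sub_cdf_le_expR hD t (ltW y0) ltr01) _.
by rewrite mul1r mulrC !mulNr (mulrC y).
Qed.

Lemma occupationE t :
  (\int[mu]_(y in Rpos) (g y * F y t)%:E)%E = (occupation t)%:E.
Proof.
rewrite /occupation /Rintegral fineK//; apply: integrable_fin_num => //.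
exact: integrable_occupation.
Qed.

Lemma occupation_nondecreasing s t : s <= t -> occupation s <= occupation t.
Proof.
move=> st; rewrite -lee_fin -!occupationE; apply: ge0_le_integral => //.
- move=> y; rewrite /= in_itv/= andbT => y0.
  by rewrite lee_fin mulr_ge0//; [case/andP: (g_itv01 y0)|case/andP: (sub_cdf_itv01 hD s (ltW y0))].
- by case/integrableP: (integrable_occupation s).
- by case/integrableP: (integrable_occupation t).
- move=> y; rewrite /= in_itv/= andbT => y0; rewrite lee_fin.
  rewrite ler_wpM2l//; first by case/andP: (g_itv01 y0).
  exact: (sub_cdf_nondecreasing hD (ltW y0)).
Qed.

Lemma occupation_ge0 t : 0 <= occupation t.
Proof.
apply: Rintegral_ge0 => y; rewrite /= in_itv/= andbT => y0.
by rewrite mulr_ge0//; [case/andP: (g_itv01 y0)|case/andP: (sub_cdf_itv01 hD t (ltW y0))].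
Qed.

(** By Tonelli, integrating [has_laplace_sub_cdf] against g turns
    e^(-y f(z)) / z into the transform of g at f(z), divided by z. *)
Lemma has_laplace_occupation z c : 0 < z ->
  has_laplace g (tempered_exponent eta nu z) c ->
  has_laplace occupation z (c / z).
Proof.
move=> z0 hg; have [ip vp] := integrable_damped_patch hg.
have F0 y t : 0 < y -> 0 <= F y t.
  by move=> y0; case/andP: (sub_cdf_itv01 hD t (ltW y0)).
have g0 y : 0 < y -> 0 <= g y by move=> y0; case/andP: (g_itv01 y0).
apply: ge0_has_laplace.
- apply: nondecreasing_measurable => // s t; exact: occupation_nondecreasing.
- by move=> t _; exact: occupation_ge0.
pose e := (fun t : R => expR (- z * t)) \_ Rpos.
pose G := g \_ Rpos.
pose h (ty : measurableTypeR R * measurableTypeR R) :=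
  (e ty.1 * (G ty.2 * clamped_cdf ty.2 ty.1))%:E.
have me : measurable_fun setT e.
  by apply/(measurable_restrictT _ _).1 => //; exact: measurable_expR_lin.
have mG : measurable_fun setT G by apply/(measurable_restrictT _ _).1.
have mh : measurable_fun setT h.
  apply/measurable_EFinP; apply: measurable_funM; first exact: (measurableT_comp me).
  apply: measurable_funM; first exact: (measurableT_comp mG).
  exact: measurable_clamped_cdf.
have e0 t : 0 <= e t by apply: restrict_ge0 => s _; exact: expR_ge0.
have G0 y : 0 <= G y.
  by apply: restrict_ge0 => s; rewrite /= in_itv/= andbT; exact: g0.
have h0 ty : (0 <= h ty)%E.
  have max0 : 0 <= Num.max ty.2 0 by rewrite le_max lexx orbT.
  have /andP[c0 _] := sub_cdf_itv01 hD (Num.max ty.1 0) max0.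
  by rewrite lee_fin; apply: mulr_ge0 => //; exact: mulr_ge0.
have inner t : (\int[mu]_y h (t, y) =
    (((fun t => expR (- z * t) * occupation t) \_ Rpos) t)%:E)%E.
  rewrite /h/= patchE /e patchE; case: ifPn; last first.
    by move=> _; under eq_integral do rewrite mul0r; rewrite integral0.
  rewrite inE/= in_itv/= andbT => t0.
  rewrite EFinM -occupationE -ge0_integralZl//; last 2 first.
  - by case/integrableP: (integrable_occupation t).
  - by move=> y; rewrite /= in_itv/= andbT => y0; rewrite lee_fin mulr_ge0 ?g0 ?F0.
  rewrite [RHS]integral_mkcond; apply: eq_integral => y _.
  rewrite /G !patchE; case: ifPn; last by rewrite mul0r mulr0.
  rewrite inE/= in_itv/= andbT => y0.
  by rewrite /clamped_cdf !max_l ?(ltW y0) ?(ltW t0)// EFinM.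
have outer y : (\int[mu]_t h (t, y) =
    (z^-1)%:E * (((fun y => expR (- tempered_exponent eta nu z * y) * g y)%R \_ Rpos) y)%:E)%E.
  rewrite /h/= patchE /G patchE; case: ifPn; last first.
    move=> _; under eq_integral do rewrite mul0r mulr0.
    by rewrite integral0 mule0.
  rewrite inE/= in_itv/= andbT => y0.
  have [ic vc] := has_laplace_sub_cdf hD (ltW y0) z0.
  transitivity ((g y)%:E * (expR (- y * tempered_exponent eta nu z) / z)%:E)%E; last first.
    by rewrite -!EFinM mulNr mulrC (mulrC y) -mulNr; congr _%:E; ring.
  rewrite -vc -ge0_integralZl//; last 3 first.
  - by case/integrableP: ic.
  - by move=> t _; rewrite lee_fin mulr_ge0 ?expR_ge0 ?F0.
  - by rewrite lee_fin g0.
  rewrite [RHS]integral_mkcond; apply: eq_integral => t _.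
  rewrite /e !patchE; case: ifPn; last by rewrite mul0r.
  rewrite inE/= in_itv/= andbT => t0.
  by rewrite /clamped_cdf !max_l ?(ltW y0) ?(ltW t0)// -EFinM; congr _%:E; ring.
transitivity (\int[mu]_t \int[mu]_y h (t, y))%E.
  rewrite integral_mkcond; apply: eq_integral => t _.
  by rewrite inner !patchE; case: ifP.
rewrite (fubini_tonelli h mh h0)/=.
under eq_integral do rewrite outer.
by rewrite integralZl// vp -EFinM mulrC.
Qed.

End occupation.

(** * The inverse subordinator *)

Section inverse.
Context {R : realType} {d : measure_display} {T : measurableType d}.
Context (P : probability T R).
Variables (eta nu : R) (D : R -> T -> R).
Hypotheses (eta_gt0 : 0 < eta) (nu_gt0 : 0 < nu).
Hypothesis hD : tempered_stable_subordinator P eta nu D.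
Local Notation F := (sub_cdf P D).

Let hI : increasing_additive_process P D := sub_additive (tss_subordinator hD).

Definition passage_set (t : R) (w : T) : set R := [set s | 0 <= s /\ t < D s w].

(** The null event on which D stays below t forever and the infimum takes its
    default value. *)
Definition no_passage (t : R) : set T := \bigcap_m [set w | D m%:R w <= t].

Lemma passage_set_lb t w : lbound (passage_set t w) 0.
Proof. by move=> s []. Qed.

Lemma inverse_processE t w : inverse_process D t w = inf (passage_set t w).
Proof. by []. Qed.

Lemma inverse_process_ge0 t w : 0 <= inverse_process D t w.
Proof.
rewrite inverse_processE.
have [ne|ne] := pselect (nonempty (passage_set t w)).
  by apply: lb_le_inf => //; exact: passage_set_lb.
by rewrite inf_out// => -[].
Qed.

Lemma lt_inverse_process t y w : 0 <= y -> y < inverse_process D t w -> D y w <= t.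
Proof.
move=> y0 yL; rewrite leNgt; apply/negP => tD.
have : inverse_process D t w <= y.
  by apply: ge_inf; [exists 0; exact: passage_set_lb|].
by rewrite leNgt yL.
Qed.

Lemma passage_nonempty t w : ~ no_passage t w -> nonempty (passage_set t w).
Proof.
move=> h; apply: contrapT => ne; apply: h => m _ /=.
rewrite leNgt; apply/negP => tD; apply: ne; exists m%:R; split => //.
Qed.

Lemma le_inverse_process t y w : ~ no_passage t w ->
  (forall s, 0 <= s -> s < y -> D s w <= t) -> y <= inverse_process D t w.
Proof.
move=> /passage_nonempty ne h; apply: lb_le_inf => // s [s0 tD].
by rewrite leNgt; apply/negP => /(h s s0); rewrite leNgt tD.
Qed.

Lemma no_passage_inverse t w : no_passage t w -> inverse_process D t w = 0.
Proof.
move=> h; rewrite /inverse_process [X in inf X](_ : _ = set0) ?inf0//.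
apply/seteqP; split => // s [s0 tD].
have /andP[_ sm] := Num.Theory.truncn_itv s0.
have := h (Num.truncn s).+1 I => /=.
by rewrite leNgt (lt_le_trans tD)//; apply: (iap_nondecreasing hI) => //; exact: ltW.
Qed.

Lemma measurable_no_passage t : measurable (no_passage t).
Proof.
by apply: bigcap_measurable => // m _; exact: (measurable_subordinator_le hD).
Qed.

(** Outside of the event [no_passage], the inverse process is at least x if and
    only if D stays below t before x, and by monotonicity it suffices to test
    this at countably many times tending to x. *)
Lemma measurable_inverse_process t : measurable_fun setT (inverse_process D t).
Proof.
apply: (measurability (@RGenCInfty.G R)) => [|/= _ [_] [x] -> <-].
  exact: RGenCInfty.measurableE.
rewrite setTI; have [x0|x0] := leP x 0.
  rewrite (_ : _ @^-1` _ = setT)//; apply/seteqP; split => // w _ /=.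
  by rewrite in_itv/= andbT (le_trans x0)// inverse_process_ge0.
pose xm (m : nat) := Num.max (x - m.+1%:R^-1) 0.
have xm0 m : 0 <= xm m by rewrite le_max lexx orbT.
have xmx m : xm m < x by rewrite gt_max x0 andbT ltrBlDr ltrDl invr_gt0.
rewrite (_ : _ @^-1` _ = (\bigcap_m [set w | D (xm m) w <= t]) `&` ~` no_passage t).
  apply: measurableI; last exact/measurableC/measurable_no_passage.
  by apply: bigcap_measurable => // m _; exact: (measurable_subordinator_le hD).
apply/seteqP; split => w /=; rewrite in_itv/= andbT.
  move=> xL; split.
    by move=> m _ /=; apply: lt_inverse_process => //; exact: lt_le_trans xL.
  by move=> /no_passage_inverse h; move: xL; rewrite h leNgt x0.
move=> [h np]; apply: le_inverse_process => // s s0 sx.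
pose m := Num.truncn (x - s)^-1.
have sm : s <= xm m.
  have /andP[_ hm] := Num.Theory.truncn_itv (ltW (ltac:(by rewrite invr_gt0 subr_gt0) : 0 < (x - s)^-1)).
  rewrite le_max; apply/orP; left; rewrite lerBrDr -lerBrDl.
  rewrite -[leRHS]invrK lef_pV2 ?posrE ?invr_gt0 ?subr_gt0//.
  exact: ltW.
by apply: le_trans (h m I); exact: (iap_nondecreasing hI).
Qed.

Lemma sub_cdf_cvg0 t : F m%:R t @[m --> \oo] --> 0.
Proof.
have f1 := tempered_exponent_gt0 eta_gt0 nu_gt0 ltr01.
apply: (@squeeze_cvgr _ _ _ _ (fun=> 0)
  (fun m => expR (1 * t) * expR (- m%:R * tempered_exponent eta nu 1))).
- apply: nearW => m; have /andP[-> _]/= := sub_cdf_itv01 hD t (ler0n R m).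
  exact: (sub_cdf_le_expR hD t (ler0n R m) ltr01).
- exact: cvg_cst.
- by rewrite -(mulr0 (expR (1 * t))); apply: cvgMr; exact: expRn_cvg0.
Qed.

Lemma probability_no_passage t : P (no_passage t) = 0%E.
Proof.
have mN := measurable_no_passage t.
have le0 : fine (P (no_passage t)) <= 0.
  apply: (@cvgr_to_ge _ _ _ _ (fun m => F m%:R t) _ _ (@sub_cdf_cvg0 t)); apply: nearW => m.
  rewrite -lee_fin -(sub_cdfE hD)// fineK ?fin_num_measure//.
  apply: le_measure; rewrite ?inE//; first exact: (measurable_subordinator_le hD).
  by move=> w /(_ m I).
apply/eqP; rewrite eq_le measure_ge0 andbT -[leLHS]fineK ?fin_num_measure//.
Qed.

(** Unboundedness of the exponent means that D jumps immediately. *)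
Lemma tempered_exponent_unbounded A : exists2 z, 0 < z & A <= tempered_exponent eta nu z.
Proof.
pose B := `|A| + eta `^ nu.
have B0 : 0 < B by rewrite ltr_wpDl// powR_gt0.
exists (B `^ nu^-1); first exact: powR_gt0.
rewrite /tempered_exponent lerBrDr; apply: (@le_trans _ _ B).
  by rewrite lerD2r ler_norm.
apply: (@le_trans _ _ ((B `^ nu^-1) `^ nu)).
  by rewrite -powRrM mulVf ?gt_eqF// powRr1// ltW.
have Bp := powR_ge0 B nu^-1.
have e0 := ltW eta_gt0; have s0 : 0 <= eta + B `^ nu^-1 by exact: addr_ge0.
apply: ge0_ler_powR; rewrite ?nnegrE ?(ltW nu_gt0)//.
by rewrite -[leLHS]add0r lerD2r.
Qed.

Lemma sub_cdf0 y : 0 < y -> F y 0 = 0.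
Proof.
move=> y0; have /andP[F0 _] := sub_cdf_itv01 hD 0 (ltW y0).
apply/eqP; rewrite eq_le F0 andbT; apply/ler_addgt0Pr => e e0; rewrite add0r.
have [z z0 hz] := tempered_exponent_unbounded (- ln e / y).
apply: le_trans (sub_cdf_le_expR hD 0 (ltW y0) z0) _.
rewrite mulr0 expR0 mul1r -[leRHS]lnK ?posrE// ler_expR.
by rewrite mulNr lerNl -ler_pdivrMl// mulrC.
Qed.

End inverse.

(** * Subordination by the inverse process *)

Section mean.
Context {R : realType} {d : measure_display} {T : measurableType d}.
Context (P : probability T R).
Implicit Types (f g : T -> R).

(** As for Laplace transforms, integrability is kept with the value. *)
Definition has_mean f (c : R) : Prop :=
  P.-integrable setT (EFin \o f) /\ (\int[P]_w (f w)%:E = c%:E)%E.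

Lemma has_meanD f g a b : has_mean f a -> has_mean g b ->
  has_mean (fun w => f w + g w) (a + b).
Proof.
move=> [fi fa] [gi gb]; split.
  rewrite (_ : EFin \o _ = (EFin \o f) \+ (EFin \o g))%E//; exact: integrableD.
by under eq_integral do rewrite EFinD; rewrite integralD// fa gb EFinD.
Qed.

Lemma has_meanZ k f a : has_mean f a -> has_mean (fun w => k * f w) (k * a).
Proof.
move=> [fi fa]; split.
  rewrite (_ : EFin \o _ = fun w => k%:E * (f w)%:E)%E//; exact: integrableZl.
by under eq_integral do rewrite EFinM; rewrite integralZl// fa EFinM.
Qed.

Lemma has_mean_cst a : has_mean (fun=> a) a.
Proof.
split; first exact: finite_measure_integrable_cst.
by rewrite integral_cst//= probability_setT mule1.
Qed.

Lemma has_mean_sum (I : Type) (s : seq I) (f : I -> T -> R) (a : I -> R) :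
  (forall i, has_mean (f i) (a i)) ->
  has_mean (fun w => \sum_(i <- s) f i w) (\sum_(i <- s) a i).
Proof.
move=> h; elim: s => [|i s ih].
  by rewrite big_nil; under eq_fun do rewrite big_nil; exact: has_mean_cst.
by rewrite big_cons; under eq_fun do rewrite big_cons; exact: has_meanD.
Qed.

Lemma has_mean_jump k l1 l2 (f : int -> T -> R) (a : int -> R) n :
  (forall m, has_mean (f m) (a m)) ->
  has_mean (fun w => jump k l1 l2 (f ^~ w) n) (jump k l1 l2 a n).
Proof.
by move=> h; apply: has_meanD; apply: has_meanZ; exact: has_mean_sum.
Qed.

Lemma has_mean_uniq f a b : has_mean f a -> has_mean f b -> a = b.
Proof. by move=> [_ h] [_]; rewrite h => -[]. Qed.

End mean.

Section subordination.
Context {R : realType} {d : measure_display} {T : measurableType d}.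
Context (P : probability T R).
Local Notation mu := (@lebesgue_measure R).
Local Notation Rpos := (`](0%R : R), +oo[%classic).
Variables (eta nu : R) (D : R -> T -> R).
Hypotheses (eta_gt0 : 0 < eta) (nu_gt0 : 0 < nu).
Hypothesis hD : tempered_stable_subordinator P eta nu D.
Local Notation F := (sub_cdf P D).
Variable L : R -> T -> R.
Hypothesis LE : forall t w, 0 <= t -> L t w = inverse_process D t w.
Hypothesis L_diffuse : forall t y, 0 < t -> P [set w | L t w = y] = 0%E.

Lemma L_ge0 t w : 0 <= t -> 0 <= L t w.
Proof. by move=> t0; rewrite LE//; exact: inverse_process_ge0. Qed.

Lemma measurable_L t : 0 <= t -> measurable_fun setT (L t).
Proof.
move=> t0; rewrite (_ : L t = inverse_process D t); last by apply/funext => w; exact: LE.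
exact: (measurable_inverse_process hD).
Qed.

Lemma measurable_L_event t (B : set R) : 0 <= t -> measurable B ->
  measurable (L t @^-1` B).
Proof.
by move=> t0 mB; rewrite -[_ @^-1` _]setTI; exact: (measurable_L t0).
Qed.

Lemma measurable_L_gt t y : 0 <= t -> measurable [set w | y < L t w].
Proof.
move=> t0; rewrite (_ : [set w | y < L t w] = L t @^-1` `]y, +oo[).
  exact: (measurable_L_event t0 (measurable_itv _)).
by apply/seteqP; split => w /=; rewrite in_itv/= andbT.
Qed.

(** The two events differ at most by the outcomes at which L t equals y or D
    never passes t, and both have probability 0. *)
Lemma inverse_tail t y : 0 <= t -> 0 < y -> P [set w | y < L t w] = (F y t)%:E.
Proof.
move=> t0 y0; rewrite -(sub_cdfE hD _ (ltW y0)).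
have mgt := measurable_L_gt y t0.
have mD := measurable_subordinator_le hD t (ltW y0).
have le1 : (P [set w | (y < L t w)%R] <= P [set w | (D y w <= t)%R])%E.
  apply: le_measure; rewrite ?inE// => w /=; rewrite LE//.
  exact: lt_inverse_process (ltW y0).
apply/eqP; rewrite eq_le le1/=.
have [t1|] := ltP 0 t; last first.
  move=> tle; have -> : t = 0 by apply/eqP; rewrite eq_le tle.
  by rewrite (sub_cdfE hD _ (ltW y0)) (sub_cdf0 eta_gt0 nu_gt0 hD).
have meq : measurable [set w | L t w = y] by exact: (measurable_L_event t0 (measurable_set1 y)).
have mno := measurable_no_passage hD t.
apply: (@le_trans _ _ (P ([set w | y < L t w] `|` ([set w | L t w = y] `|` no_passage D t)))).
  apply: le_measure; rewrite ?inE//.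
    by apply: measurableU => //; exact: measurableU.
  move=> w /= Dt; have [np|np] := pselect (no_passage D t w); first by right; right.
  have : y <= L t w.
    rewrite LE//; apply: (le_inverse_process np) => s s0 sy.
    by apply: le_trans Dt; apply: (iap_nondecreasing (sub_additive (tss_subordinator hD))) => //; exact: ltW.
  by rewrite le_eqVlt => /predU1P[->|]; [right; left|left].
apply: le_trans (measureU2 _ _ _) _ => //; first exact: measurableU.
apply: (@le_trans _ _ (P [set w | (y < L t w)%R] + (P [set w | L t w = y] + P (no_passage D t)))%E).
  by rewrite leeD2l// measureU2.
by rewrite (L_diffuse _ t1) (probability_no_passage eta_gt0 nu_gt0 hD) !adde0.
Qed.

Section occupation_mean.
Variable g : R -> R.
Hypothesis mg : measurable_fun Rpos g.
Hypothesis g_itv01 : forall y, 0 < y -> 0 <= g y <= 1.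

(** By Tonelli, from the tail probabilities of [inverse_tail]. *)
Lemma has_mean_occupation t : 0 <= t ->
  has_mean P (fun w => conv (fun=> 1) g (L t w)) (occupation P D g t).
Proof.
move=> t0.
have ig y := integrable_itv01 y mg g_itv01.
pose G := g \_ Rpos.
have mG : measurable_fun setT G by apply/(measurable_restrictT _ _).1.
have G0 y : 0 <= G y.
  by apply: restrict_ge0 => s; rewrite /= in_itv/= andbT => s0; case/andP: (g_itv01 s0).
pose h (wy : T * measurableTypeR R) := (if wy.2 < L t wy.1 then G wy.2 else 0)%:E.
have mh : measurable_fun setT h.
  apply/measurable_EFinP; apply: measurable_fun_ifT => //.
  - apply: measurable_fun_ltr => //.
    exact: (measurableT_comp (measurable_L t0)).
  - exact: (measurableT_comp mG).
have h0 wy : (0 <= h wy)%E by rewrite /h lee_fin; case: ifP.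
have inner w : (\int[mu]_y h (w, y) = (conv (fun=> 1) g (L t w))%:E)%E.
  rewrite /conv /Rintegral; under [in RHS]eq_integral do rewrite mul1r.
  rewrite fineK; last by apply: integrable_fin_num => //; exact: ig.
  rewrite [RHS]integral_mkcond; apply: eq_integral => y _.
  rewrite /h/= /G !patchE !mem_setE/= !in_itv/= andbT.
  by case: (0 < y) => /=; case: (y < L t w).
have outer y : (\int[P]_w h (w, y) = ((fun y => (g y * F y t)%:E) \_ Rpos) y)%E.
  rewrite /h/= /G [RHS]patchE; case: ifPn => yD; last first.
    rewrite (eq_integral (cst 0%E)) ?integral0// => w _.
    by rewrite patchE (negbTE yD) if_same.
  have y0 : 0 < y by move: yD; rewrite inE/= in_itv/= andbT.
  have g0 : 0 <= g y by case/andP: (g_itv01 y0).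
  have mA := measurable_L_gt y t0.
  have PE : (F y t)%:E = (\int[P]_w (\1_[set w | (y < L t w)%R] w)%:E)%E.
    by rewrite -probability_indic//; apply/esym; exact: inverse_tail.
  rewrite EFinM PE -ge0_integralZl//; last by apply/measurable_EFinP; exact: measurable_indic.
  apply: eq_integral => w _; rewrite patchE yD -EFinM indicE; congr _%:E.
  case: ifPn => hw; first by rewrite mem_set ?mulr1.
  by rewrite memNset ?mulr0//=; exact/negP.
have E : (\int[P]_w (conv (fun=> 1) g (L t w))%:E = (occupation P D g t)%:E)%E.
  transitivity (\int[P]_w \int[mu]_y h (w, y))%E.
    by apply: eq_integral => w _; rewrite inner.
  rewrite (fubini_tonelli h mh h0)/= -(occupationE eta_gt0 nu_gt0 hD mg g_itv01).
  by rewrite [RHS]integral_mkcond; apply: eq_integral => y _; rewrite outer.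
split => //; apply/integrableP; split.
  have := measurable_fun_fubini_tonelli_F (m2 := mu) h mh h0.
  by apply: eq_measurable_fun => w _; rewrite /fubini_F inner.
rewrite [X in (X < _)%E](_ : _ = (occupation P D g t)%:E) ?ltry// -E.
apply: eq_integral => w _ /=; rewrite ger0_norm//.
apply: Rintegral_ge0 => y; rewrite /= in_itv/= => /andP[y0 _].
by rewrite mul1r; case/andP: (g_itv01 y0).
Qed.

End occupation_mean.

Section independent_subordination.
Variable S : R -> T -> int.
Hypothesis mS : forall x n, 0 <= x -> measurable [set w | S x w = n].
Hypothesis rS : forall w x, 0 <= x -> \forall s \near x^'+, S s w = S x w.
Hypothesis iSL : independent_processes P S L.

Lemma process_pmf_grid_cvg n x : 0 <= x ->
  process_pmf P S n (grid m (grid_index m x)) @[m --> \oo] --> process_pmf P S n x.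
Proof.
move=> x0; apply/fine_cvg; rewrite /= /process_pmf fineK ?fin_num_measure//; last exact: mS.
apply: probability_cvg_indic.
- by move=> m; apply: mS; exact: grid_ge0.
- exact: mS.
- move=> w; have : \forall m \near \oo, S (grid m (grid_index m x)) w = S x w.
    exact: (grid_cvg x0 (rS w x0)).
  apply: filterS => m h.
  by apply/idP/idP; rewrite !inE/= h.
Qed.

(** For a time with countably many values this is independence of the two
    processes at fixed times.  The time L t is approximated from the right by
    its grid points, along which S is eventually constant; both sides pass to
    the limit by dominated convergence. *)
Lemma subordinated_pmf n t : 0 <= t ->
  has_mean P (fun w => process_pmf P S n (L t w))
    (process_pmf P (fun t w => S (L t w) w) n t).
Proof.
move=> t0.
have mI m j : measurable [set w | grid_index m (L t w) = j].
  exact: (measurable_L_event t0 (measurable_grid_index m j)).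
pose A m := [set w | S (grid m (grid_index m (L t w))) w = n].
pose B := [set w | S (L t w) w = n].
have AE m j : A m `&` [set w | grid_index m (L t w) = j] =
    [set w | S (grid m j) w = n] `&` [set w | grid_index m (L t w) = j].
  by apply/seteqP; split => w /=; rewrite /A/= => -[+ h]; rewrite h.
have mA m : measurable (A m).
  rewrite (_ : A m = \bigcup_j (A m `&` [set w | grid_index m (L t w) = j])).
    apply: bigcup_measurable => j _; rewrite AE; apply: measurableI => //.
    exact/mS/grid_ge0.
  by apply/seteqP; split => [w h|w [j _ []]//]; exists (grid_index m (L t w)).
have AB w : \forall m \near \oo, (w \in A m) = (w \in B).
  have Lw0 := L_ge0 w t0.
  have : \forall m \near \oo, S (grid m (grid_index m (L t w))) w = S (L t w) w.
    exact: (grid_cvg Lw0 (rS w Lw0)).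
  by apply: filterS => m h; apply/idP/idP; rewrite !inE/A/B/= h.
have mB : measurable B.
  apply/measurable_indicP.
  apply: (@measurable_fun_cvg _ _ R _ (fun m => \1_(A m))).
    by move=> m; exact/measurable_indicP.
  move=> w _; apply: cvg_near_cst; move: (AB w); apply: filterS => m h.
  by rewrite !indicE h.
have mgrid m : measurable_fun setT (fun w => process_pmf P S n (grid m (grid_index m (L t w)))).
  exact: (measurable_fun_nat_index (u := fun j (w : T) => process_pmf P S n (grid m j))
    (Y := fun w => grid_index m (L t w))).
have PA m : P (A m) = (\int[P]_w (process_pmf P S n (grid m (grid_index m (L t w))))%:E)%E.
  rewrite (@measure_split_nat _ _ _ P (fun w => grid_index m (L t w)))//.
  have TU : [set: T] = \bigcup_j [set w | grid_index m (L t w) = j].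
    by apply/seteqP; split => // w _; exists (grid_index m (L t w)).
  rewrite TU ge0_integral_bigcup//.
  - apply: eq_eseriesr => j _.
    rewrite AE iSL.
    + rewrite (eq_integral (fun=> (process_pmf P S n (grid m j))%:E)); last first.
        by move=> w; rewrite inE/= => ->.
      rewrite integral_cst// /process_pmf fineK// fin_num_measure//.
      exact/mS/grid_ge0.
    + exact: (generated_events_preimage (D := times) (X := S) (i := grid m j) (B := [set n]) (grid_ge0 _ _)).
    + exact: (generated_events_preimage (D := times) (X := L) (i := t)
        (B := [set x | grid_index m x = j]) t0 (measurable_grid_index m j)).
  - by apply/measurable_EFinP; apply: measurable_funTS; exact: mgrid.
  - by move=> w _; rewrite lee_fin; case/andP: (process_pmf_le1 P n mS (grid_ge0 m (grid_index m (L t w)))).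
  - by apply/trivIsetP => i j _ _ /eqP ij; apply/seteqP; split => // w /= [h1 h2]; apply: ij; rewrite -h1.
have cA := probability_cvg_indic (P := P) mA mB AB.
have c w := @process_pmf_grid_cvg n _ (L_ge0 w t0).
have [|||||i _ c2] := @dominated_convergence _ _ _ P setT measurableT
  (fun m w => (process_pmf P S n (grid m (grid_index m (L t w))))%:E)
  (fun w => (process_pmf P S n (L t w))%:E) (cst 1%E).
- by move=> m; exact/measurable_EFinP.
- apply/measurable_EFinP; apply: (@measurable_fun_cvg _ _ R _ _ _ mgrid).
  by move=> w _; exact: c.
- by apply/aeW => w _; apply: cvgn_EFin; exact: c.
- exact: finite_measure_integrable_cst.
- apply/aeW => w m _ /=; rewrite lee_fin.
  by have /andP[h0 h1] := process_pmf_le1 P n mS (grid_ge0 m (grid_index m (L t w))); rewrite ger0_norm.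
split; first exact: i.
rewrite /process_pmf fineK ?fin_num_measure//.
move: c2; under eq_fun do rewrite /= -PA.
by move=> /(@cvg_unique _ (@ereal_hausdorff R) _ _ _ _ cA).
Qed.

End independent_subordination.
End subordination.

(** * The density of the inverse process at the origin *)

Section primitive.
Context {R : realType}.
Local Notation mu := (@lebesgue_measure R).
Local Notation Rpos := (`](0%R : R), +oo[%classic).

Lemma is_derive_primitive (f : R -> R) t : 0 < t ->
  (forall T, mu.-integrable `](0%R:R), T] (EFin \o f)) ->
  {for t, continuous f} -> is_derive t 1 (conv (fun=> 1) f) (f t).
Proof.
move=> t0 fi cf.
have [] := @continuous_FTC1 R f (BRight 0) t (t + 1) _ (fi (t + 1)) _ cf.
- by rewrite ltrDl.
- exact: t0.
set G := (fun x => _) => dG G't.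
have convE : conv (fun=> 1) f = G.
  apply/funext => x; rewrite /conv /G /Rintegral; congr fine.
  under eq_integral do rewrite mul1r.
  apply: integral_itv_bndo_bndc.
  apply: measurable_funS (measurable_int _ (fi x)) => //.
  by apply: subset_itvl; rewrite bnd_simp.
by rewrite convE; split => //; rewrite -derive1E.
Qed.

Lemma continuous_primitive (f : R -> R) t : 0 < t ->
  (forall T, mu.-integrable `](0%R:R), T] (EFin \o f)) ->
  {for t, continuous f} -> {for t, continuous (conv (fun=> 1) f)}.
Proof.
move=> t0 fi cf; have h := is_derive_primitive t0 fi cf.
by apply/differentiable_continuous/derivable1_diffP; exact: ex_derive.
Qed.

Lemma integrable_powR_bound (f : R -> R) a C t : 0 < a ->
  (forall s, 0 < s -> {for s, continuous f}) ->
  (forall s, 0 < s <= t -> `|f s| <= C * s `^ (a - 1)) ->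
  mu.-integrable `](0%R:R), t] (EFin \o f).
Proof.
move=> a0 cf bf; have i := integrable_powR t a0.
apply: le_integrable (integrableZl _ C i) => //.
  apply/measurable_EFinP; apply: (@measurable_funS _ _ _ _ Rpos) => //.
    by apply: subset_itvl; rewrite bnd_simp.
  apply: open_continuous_measurable_fun; first exact: interval_open.
  by move=> s; rewrite inE/= in_itv/= andbT; exact: cf.
move=> s /=; rewrite in_itv/= => h.
by rewrite lee_fin; apply: le_trans (ler_norm _); exact: bf.
Qed.

Lemma has_laplace_le (f g : R -> R) z c d : has_laplace f z c -> has_laplace g z d ->
  (forall t, 0 < t -> f t <= g t) -> c <= d.
Proof.
move=> [fi fc] [gi gd] fg; rewrite -lee_fin -fc -gd.
apply: le_integral => // t; rewrite inE/= in_itv/= andbT => t0.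
by rewrite lee_fin ler_wpM2l ?expR_ge0 ?fg.
Qed.

Lemma has_laplace_before t z : 0 < t -> 0 < z ->
  has_laplace (fun s : R => (if s < t then 1 else 0) : R) z ((1 - expR (- z * t)) / z).
Proof.
move=> t0 z0.
have h : has_laplace (fun s : R => (if t <= s then 1 else 0) : R) z (expR (- z * t) / z).
  apply: ge0_has_laplace.
  - by apply: measurable_funTS; apply: measurable_fun_ifT => //; exact: measurable_fun_ler.
  - by move=> s _; case: ifP.
  rewrite -integral_expR_tail// [LHS]integral_mkcond [RHS]integral_mkcond.
  apply: eq_integral => s _; rewrite !patchE !mem_setE !in_itv/= !andbT.
  case: (leP t s) => ts; last by rewrite mulr0; case: ifP.
  by rewrite (lt_le_trans t0 ts) mulr1.
rewrite mulrBl; apply: eq_has_laplace (has_laplaceB (has_laplace_cst 1 z0) h) => s _.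
by case: (leP t s); rewrite ?subrr ?subr0.
Qed.

End primitive.

Section boundary_density.
Context {R : realType} {d : measure_display} {T : measurableType d}.
Context (P : probability T R).
Local Notation mu := (@lebesgue_measure R).
Local Notation Rpos := (`](0%R : R), +oo[%classic).
Variables (eta nu : R) (D : R -> T -> R).
Hypotheses (eta_gt0 : 0 < eta) (nu_gt0 : 0 < nu) (nu_lt1 : nu < 1).
Hypothesis hD : tempered_stable_subordinator P eta nu D.
Local Notation F := (sub_cdf P D).
Local Notation phi := (tempered_exponent eta nu).

(** The mean density of L t over ]0, x], as Pr(L t > x) = Pr(D x <= t); its
    limit as x tends to 0 is the density of L t at 0. *)
Definition entrance_rate (x t : R) : R := (1 - F x t) / x.

(** Concavity of the power nu < 1, written with the two fractions of eta + a. *)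
Lemma powR_subadditive a : 0 < a -> phi a <= a `^ nu.
Proof.
move=> a0; have s0 : 0 < eta + a by rewrite addr_gt0.
have frac (b : R) : 0 < b -> b <= eta + a -> b / (eta + a) * (eta + a) `^ nu <= b `^ nu.
  move=> b0 ba; have q1 : 0 < b / (eta + a) <= 1.
    by rewrite divr_gt0//= ler_pdivrMr// mul1r.
  have h := ger1_powR q1 (ltW nu_lt1).
  have -> : b `^ nu = (b / (eta + a)) `^ nu * (eta + a) `^ nu.
    by rewrite -powRM ?divr_ge0 ?(ltW b0) ?(ltW s0)// divfK// gt_eqF.
  by rewrite ler_wpM2r ?powR_ge0.
rewrite /tempered_exponent lerBlDr.
have -> : (eta + a) `^ nu = a / (eta + a) * (eta + a) `^ nu + eta / (eta + a) * (eta + a) `^ nu.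
  by field; rewrite gt_eqF.
by apply: lerD; apply: frac => //; rewrite ?lerDl ?lerDr ltW.
Qed.

Lemma has_laplace_entrance_rate x z : 0 < x -> 0 < z ->
  has_laplace (entrance_rate x) z ((1 - expR (- x * phi z)) / (x * z)).
Proof.
move=> x0 z0.
have h := has_laplaceZ x^-1 (has_laplaceB (has_laplace_cst 1 z0) (has_laplace_sub_cdf hD (ltW x0) z0)).
rewrite [_ / (x * z)](_ : _ = x^-1 * (1 / z - expR (- x * phi z) / z)); last first.
  by field; rewrite !gt_eqF.
by apply: eq_has_laplace h => t _; rewrite mulrC.
Qed.

Lemma entrance_rate_ge0 x t : 0 < x -> 0 <= entrance_rate x t.
Proof.
move=> x0; rewrite divr_ge0 ?(ltW x0)// subr_ge0.
by case/andP: (sub_cdf_itv01 hD t (ltW x0)).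
Qed.

Lemma entrance_rate_nonincreasing x s t : 0 < x -> s <= t ->
  entrance_rate x t <= entrance_rate x s.
Proof.
move=> x0 st; rewrite ler_wpM2r ?invr_ge0 ?(ltW x0)// lerD2l lerN2.
exact: (sub_cdf_nondecreasing hD (ltW x0)).
Qed.

Lemma entrance_laplace_le x z : 0 < x -> 0 < z ->
  (1 - expR (- x * phi z)) / (x * z) <= phi z / z.
Proof.
move=> x0 z0; rewrite invfM mulrA ler_wpM2r ?invr_ge0 ?(ltW z0)// ler_pdivrMr//.
have := expR_ge1Dx (- x * phi z); rewrite mulNr (mulrC x); lra.
Qed.

(** A bound uniform in x.  The rate is nonincreasing in t, so its transform
    controls it: compare with the constant [entrance_rate x t] on ]0, t[ and
    take z = 1 / t. *)
Lemma entrance_rate_le x t : 0 < x -> 0 < t ->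
  entrance_rate x t <= t `^ (- nu) / (1 - expR (- 1)).
Proof.
move=> x0 t0; pose z := t^-1; have z0 : 0 < z by rewrite invr_gt0.
have e1 : 0 < 1 - expR (- 1 : R) by rewrite subr_gt0 expR_lt1 oppr_lt0.
have hb := has_laplaceZ (entrance_rate x t) (has_laplace_before t0 z0).
have := has_laplace_le hb (has_laplace_entrance_rate x0 z0) _.
move=> /(_ _)/wrap[s s0|].
  case: ltP => [st|_]; first by rewrite mulr1 entrance_rate_nonincreasing// ltW.
  by rewrite mulr0 entrance_rate_ge0.
move=> /le_trans/(_ (entrance_laplace_le x0 z0)).
rewrite mulrA ler_pM2r ?invr_gt0// mulNr mulVf ?gt_eqF// => h.
rewrite ler_pdivlMr//; apply: le_trans h _.
apply: le_trans (powR_subadditive z0) _.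
by rewrite /z -powR_inv1 ?(ltW t0)// -powRrM mulN1r.
Qed.

Variable l0 : R -> R.
Hypothesis l0_lim : forall t, 0 < t ->
  entrance_rate n.+1%:R^-1 t @[n --> \oo] --> l0 t.

Let xn (n : nat) : R := n.+1%:R^-1.
Let xn0 n : 0 < xn n. Proof. by rewrite invr_gt0. Qed.

Lemma l0_nonincreasing s t : 0 < s -> s <= t -> l0 t <= l0 s.
Proof.
move=> s0 st; have t0 := lt_le_trans s0 st.
apply: (ler_cvg_to (l0_lim t0) (l0_lim s0)).
by apply: nearW => n; exact: entrance_rate_nonincreasing.
Qed.

(** The limit is the derivative of 1 - e^(-x f(z)) at x = 0, divided by z. *)
Lemma entrance_laplace_cvg z : 0 < z ->
  (1 - expR (- xn n * phi z)) / (xn n * z) @[n --> \oo] --> phi z / z.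
Proof.
move=> z0.
have p0 := tempered_exponent_gt0 eta_gt0 nu_gt0 z0.
have lower n : phi z / z - xn n * phi z ^+ 2 / z <= (1 - expR (- xn n * phi z)) / (xn n * z).
  have -> : (1 - expR (- xn n * phi z)) / (xn n * z) = (1 - expR (- xn n * phi z)) / xn n / z.
    by rewrite invfM mulrA.
  rewrite -mulrBl ler_wpM2r ?invr_ge0 ?(ltW z0)// ler_pdivlMr//.
  set y := xn n * phi z; have y0 : 0 <= y by rewrite mulr_ge0 ?ltW.
  have E : (phi z - xn n * phi z ^+ 2) * xn n = y - y ^+ 2 by rewrite /y; ring.
  have e0 := expR_gt0 (- y).
  have h : expR (- y) * (1 + y) <= 1.
    rewrite -[leRHS](expRxMexpNx_1 y) mulrC ler_wpM2r ?(ltW e0)//.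
    exact: expR_ge1Dx.
  rewrite E mulNr -/y; nra.
apply: (@squeeze_cvgr _ _ _ _ (fun n => phi z / z - xn n * phi z ^+ 2 / z) (fun=> phi z / z)).
- by apply: nearW => n; rewrite lower entrance_laplace_le.
- rewrite -[X in _ --> X]subr0; apply: cvgB; first exact: cvg_cst.
  rewrite -(mul0r (phi z ^+ 2 / z)); under eq_fun do rewrite -mulrA.
  by apply: cvgMl; exact: cvg_harmonic.
- exact: cvg_cst.
Qed.

(** Dominated convergence, with the bound of [entrance_rate_le], whose transform
    is finite because nu < 1. *)
Lemma has_laplace_l0 z : 0 < z -> has_laplace l0 z (phi z / z).
Proof.
move=> z0.
have nu1 : 0 < 1 - nu by rewrite subr_gt0.
have [ik _] := has_laplaceZ (Gamma (1 - nu) / (1 - expR (- 1))) (has_laplace_rl_kernel nu1 z0).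
have hn n := has_laplace_entrance_rate (xn0 n) z0.
have ml : measurable_fun Rpos l0.
  apply: (@measurable_fun_cvg _ _ R _ (fun n => entrance_rate (xn n))).
    by move=> n; exact: has_laplace_measurable (hn n).
  by move=> t; rewrite /= in_itv/= andbT => t0; exact: l0_lim.
have [||||i _ c] := @dominated_convergence _ _ _ mu Rpos (measurable_itv _)
  (fun n t => (expR (- z * t) * entrance_rate (xn n) t)%:E)
  (fun t => (expR (- z * t) * l0 t)%:E) _ _ _ _ ik.
- by move=> n; have [/integrableP[]] := hn n.
- by apply/measurable_EFinP; apply: measurable_funM => //; exact: measurable_expR_lin.
- apply/aeW => t /=; rewrite in_itv/= andbT => t0; apply: cvgn_EFin.
  by apply: cvgMr; exact: l0_lim.
- apply/aeW => t n /=; rewrite in_itv/= andbT => t0.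
  rewrite lee_fin ger0_norm ?(mulr_ge0 (expR_ge0 _) (entrance_rate_ge0 t (xn0 n)))//.
  rewrite ler_wpM2l ?expR_ge0//; apply: le_trans (entrance_rate_le (xn0 n) t0) _.
  have G0 := Gamma_gt0 nu1.
  rewrite /rl_kernel le_eqVlt; apply/orP; left; apply/eqP.
  have -> : 1 - nu - 1 = - nu by ring.
  have e1 : 0 < 1 - expR (- 1 : R) by rewrite subr_gt0 expR_lt1 oppr_lt0.
  by field; rewrite !gt_eqF.
split => //.
have := cvgn_EFin (entrance_laplace_cvg z0).
move: c; under eq_fun do rewrite /= (hn _).2.
by move=> c1 c2; exact: (cvg_unique (@ereal_hausdorff R) c1 c2).
Qed.

(** The inverse transform of ((eta + z)^nu - eta^nu) / z, obtained from
    (eta + z)^nu / z = (eta + z)^(nu - 1) (1 + eta / z). *)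
Definition boundary_density (t : R) : R :=
  expR (- eta * t) * rl_kernel (1 - nu) t +
  eta * conv (fun=> 1) (fun s => expR (- eta * s) * rl_kernel (1 - nu) s) t -
  eta `^ nu.

Let damped := fun s : R => expR (- eta * s) * rl_kernel (1 - nu) s.

Let nu1 : 0 < 1 - nu. Proof. by rewrite subr_gt0. Qed.

Let continuous_damped t : 0 < t -> {for t, continuous damped}.
Proof.
move=> t0; apply: cvgM.
  exact: continuous_expR_lin.
by apply: cvgM; [exact: continuous_powR_gt0|exact: cvg_cst].
Qed.

Let integrable_damped t : mu.-integrable `](0%R:R), t] (EFin \o damped).
Proof.
apply: (@integrable_powR_bound _ _ (1 - nu) (Gamma (1 - nu))^-1) => // s /andP[s0 _].
have G0 := Gamma_gt0 nu1.
rewrite /damped /rl_kernel ger0_norm ?mulr_ge0 ?expR_ge0 ?invr_ge0 ?powR_ge0 ?(ltW G0)//.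
rewrite [leRHS]mulrC ler_piMl ?mulr_ge0 ?powR_ge0 ?invr_ge0 ?(ltW G0)//.
by rewrite expR_le1 mulNr oppr_le0 mulr_ge0 ?ltW.
Qed.

Lemma continuous_boundary_density t : 0 < t -> {for t, continuous boundary_density}.
Proof.
move=> t0; apply: cvgB; last exact: cvg_cst.
apply: cvgD; first exact: continuous_damped.
apply: cvgM; first exact: cvg_cst.
by apply: continuous_primitive => //; exact: continuous_damped.
Qed.

Lemma has_laplace_boundary_density z : 0 < z -> has_laplace boundary_density z (phi z / z).
Proof.
move=> z0; have ze0 : 0 < z + eta by rewrite addr_gt0.
have h1 : has_laplace damped z ((z + eta) `^ (- (1 - nu))).
  by apply: has_laplace_shift; exact: has_laplace_rl_kernel.
have h2 : has_laplace (conv (fun=> 1) damped) z ((z + eta) `^ (- (1 - nu)) / z).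
  apply: (has_laplace_primitive z0 h1) => t t0.
  apply: integrableS (integrable_damped t) => //.
  by apply: subset_itvl; rewrite bnd_simp.
have := has_laplaceB (has_laplaceD h1 (has_laplaceZ eta h2)) (has_laplace_cst (eta `^ nu) z0).
set c := (X in has_laplace _ _ X).
suff -> : c = phi z / z by [].
rewrite /c /tempered_exponent (addrC eta) -(mulr_powRB1 (ltW ze0) nu_gt0) opprB.
by field; rewrite gt_eqF.
Qed.

(** The boundary value is a limit of functions nonincreasing in t, hence
    monotone, so equality of the transforms determines it at every t > 0. *)
Lemma boundary_densityE t : 0 < t -> l0 t = boundary_density t.
Proof.
move=> t0; apply: oppr_inj.
have h f : (forall z, 0 < z -> has_laplace f z (phi z / z)) -> forall j : nat,
    has_laplace (fun s => - f s) (1 + j%:R) (-1 * (phi (1 + j%:R) / (1 + j%:R))).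
  move=> hf j; have j0 : 0 < 1 + j%:R :> R by rewrite ltr_wpDr.
  by apply: eq_has_laplace (has_laplaceZ (-1) (hf _ j0)) => s _; rewrite mulN1r.
apply: (laplace_unique_nondecreasing (h _ has_laplace_l0) (h _ has_laplace_boundary_density)).
- by move=> r s r0 rs; rewrite lerN2 l0_nonincreasing.
- by move=> r r0; apply: cvgN; exact: continuous_boundary_density.
- exact: t0.
Qed.

End boundary_density.

Section density.
Context {R : realType} {d : measure_display} {T : measurableType d}.
Context (P : probability T R).
Local Notation mu := (@lebesgue_measure R).
Variables (X : T -> R) (f : R -> R).
Hypothesis hf : probability_density P X f.

Lemma density_no_atom y : P [set w | X w = y] = 0%E.
Proof.
have [_ _ h] := hf; rewrite (_ : [set w | X w = y] = X @^-1` [set y])// h//.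
by rewrite integral_set1.
Qed.

Hypothesis mX : measurable_fun setT X.
Hypothesis X_ge0 : forall w, 0 <= X w.
Hypothesis f_cvg0 : f x @[x --> 0^'+] --> f 0.

(** For small x the density is within e of f 0 on all of [0, x], hence so is its
    mean over this interval. *)
Lemma density_average_cvg0 :
  fine (P [set w | X w <= n.+1%:R^-1]) / n.+1%:R^-1 @[n --> \oo] --> f 0.
Proof.
have [mf f0 h] := hf.
apply/cvgrPdist_le => e e0.
have /cvgrPdist_le/(_ e e0) := f_cvg0; rewrite near_withinE.
move=> [r /= r0 hr].
have near_f0 (x : R) : 0 <= x -> x < r -> `|f 0 - f x| <= e.
  rewrite le_eqVlt => /predU1P[<- _|x0 xr]; first by rewrite subrr normr0 ltW.
  by apply: hr => //=; rewrite sub0r normrN gtr0_norm.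
have : \forall n \near \oo, n.+1%:R^-1 < r.
  have /cvgrPdist_lt/(_ r r0) := @cvg_harmonic R.
  by apply: filterS => n; rewrite sub0r normrN gtr0_norm// /harmonic invr_gt0.
apply: filterS => n; set x : R := n.+1%:R^-1 => xr.
have x0 : 0 < x by rewrite /x.
have mPx : P [set w | X w <= x] = (\int[mu]_(s in `[0%R, x]) (f s)%:E)%E.
  rewrite -h//; congr (P _); apply/seteqP; split => w /=.
    by move=> Xx; rewrite in_itv/= X_ge0.
  by rewrite in_itv/= => /andP[].
have fin : P [set w | X w <= x] \is a fin_num.
  apply: fin_num_measure.
  by rewrite -[X in measurable X]setTI; exact: mX (measurable_itv `]-oo, x]).
set p := fine _; have pE : P [set w | X w <= x] = p%:E by rewrite fineK.
have mfx : measurable_fun `[0%R, x] (EFin \o f).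
  by apply/measurable_EFinP; exact: measurable_funTS.
have len c : (\int[mu]_(s in `[0%R, x]) c%:E = (c * x)%:E)%E.
  by rewrite integral_cst//= lebesgue_measure_itv/= lte_fin x0 -EFinD subr0 EFinM.
have up : p <= (f 0 + e) * x.
  rewrite -lee_fin -pE mPx -len; apply: ge0_le_integral => //=.
  - by move=> s _; rewrite lee_fin.
  move=> s; rewrite in_itv/= => /andP[s0 sx]; rewrite lee_fin.
  have := near_f0 s s0 (le_lt_trans sx xr); rewrite ler_norml; lra.
have low : f 0 * x <= p + e * x.
  rewrite -lee_fin EFinD -pE mPx -!len -ge0_integralD//=; last 2 first.
  - by move=> s _; rewrite lee_fin.
  - by move=> s _; rewrite lee_fin ltW.
  apply: ge0_le_integral => //=.
  - by move=> s _; rewrite lee_fin.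
  - exact: emeasurable_funD.
  move=> s; rewrite in_itv/= => /andP[s0 sx]; rewrite -EFinD lee_fin.
  have := near_f0 s s0 (le_lt_trans sx xr); rewrite ler_norml; lra.
rewrite distrC ler_norml lerBlDl lerBrDl ler_pdivrMr// ler_pdivlMr//.
lra.
Qed.

End density.

Section mittag_leffler.
Context {R : realType}.

(** Since m alpha + beta = gamma + m, the Gamma factors cancel and the series
    is exponential. *)
Lemma mittag_leffler3_diag (b x : R) : 0 < b ->
  mittag_leffler3 1 b b x = expR x / Gamma b.
Proof.
move=> b0; rewrite /mittag_leffler3 mulrC.
congr (_ / _); rewrite /expR; congr (limn (series _)); apply/funext => m; rewrite /exp_coeff/= mulr1 (addrC b).
have G0 : Gamma (m%:R + b) != 0 by rewrite gt_eqF// Gamma_gt0// ltr_wpDl.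
have m0 : m`!%:R != 0 :> R by rewrite pnatr_eq0 -lt0n fact_gt0.
by field; rewrite G0 m0.
Qed.

End mittag_leffler.

(** * Singular primitives *)

Section powR_bounded.
Context {R : realType}.
Implicit Types f g : R -> R.

(** Growth of order t^(b - 1) at 0, locally uniform on t > 0: the condition
    under which convolutions with Riemann-Liouville kernels are defined and
    continuous. *)
Definition powR_bounded (b : R) f :=
  forall T : R, 0 < T -> exists C, forall t, 0 < t <= T -> `|f t| <= C * t `^ (b - 1).

Lemma powR_boundedD b f g : powR_bounded b f -> powR_bounded b g ->
  powR_bounded b (fun t => f t + g t).
Proof.
move=> bf bg T T0; have [[C hC] [B hB]] := (bf T T0, bg T T0).
exists (C + B) => t tT; apply: le_trans (ler_normD _ _) _.
by rewrite mulrDl lerD ?hC ?hB.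
Qed.

Lemma powR_boundedZ b k f : powR_bounded b f -> powR_bounded b (fun t => k * f t).
Proof.
move=> bf T T0; have [C hC] := bf T T0.
by exists (`|k| * C) => t tT; rewrite normrM -mulrA ler_wpM2l// hC.
Qed.

Lemma powR_bounded0 b : powR_bounded b (fun=> 0).
Proof. by move=> T T0; exists 0 => t _; rewrite normr0 mul0r. Qed.

Lemma powR_bounded_sum b (I : Type) (s : seq I) (f : I -> R -> R) :
  (forall i, powR_bounded b (f i)) -> powR_bounded b (fun t => \sum_(i <- s) f i t).
Proof.
move=> bf; elim: s => [|i s ih].
  by under eq_fun do rewrite big_nil; exact: powR_bounded0.
by under eq_fun do rewrite big_cons; exact: powR_boundedD.
Qed.

Lemma powR_bounded_jump b k l1 l2 (f : int -> R -> R) n :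
  (forall m, powR_bounded b (f m)) -> powR_bounded b (fun t => jump k l1 l2 (f ^~ t) n).
Proof.
by move=> bf; apply: powR_boundedD; apply: powR_boundedZ; exact: powR_bounded_sum.
Qed.

(** As b <= 1, the power t^(b - 1) is bounded below on ]0, T] by its value at
    T. *)
Lemma bounded_powR_bounded b f : b <= 1 ->
  (forall T, 0 < T -> exists C, forall t, 0 < t <= T -> `|f t| <= C) ->
  powR_bounded b f.
Proof.
move=> b1 bf T T0; have [C hC] := bf T T0.
exists (C * T `^ (1 - b)) => t tT; have /andP[t0 tT'] := tT.
apply: le_trans (hC t tT) _; rewrite -mulrA ler_peMr//.
  exact: le_trans (normr_ge0 _) (hC t tT).
rewrite -(opprB 1 b) powRN ler_pdivlMr ?powR_gt0// mul1r.
by rewrite ge0_ler_powR ?subr_ge0// ?nnegrE ltW.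
Qed.

End powR_bounded.

Section vanishing_primitive.
Context {R : realType}.
Local Notation mu := (@lebesgue_measure R).

Lemma primitive_cvg0 (f : R -> R) :
  mu.-integrable `](0%R:R), 1] (EFin \o f) ->
  conv (fun=> 1) f x @[x --> 0^'+] --> 0.
Proof.
move=> fi.
have fi' : mu.-integrable `[(0%R:R), 1] (EFin \o f).
  move: fi => /integrableP[mf fi]; apply/integrableP; split.
    exact/emeasurable_fun_itv_obnd_cbndP.
  by rewrite -integral_itv_obnd_cbnd//; exact: measurableT_comp.
have h := parameterized_integral_cvg_left (@ltr01 R) fi'.
apply: cvg_trans (cvg_at_right_filter h).
apply: near_eq_cvg; near=> x.
have x1 : x <= 1 by near: x; exact: nbhs_right_le.
have mf : measurable_fun `](0%R:R), x] (EFin \o f).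
  apply: measurable_funS (measurable_int _ fi) => //.
  by apply: subset_itvl; rewrite bnd_simp.
rewrite /conv /parameterized_integral /Rintegral; congr fine.
rewrite -integral_itv_obnd_cbnd//.
rewrite -[LHS]integral_itv_bndo_bndc; last first.
  apply: measurable_funS mf => //; first by apply: subset_itvl; rewrite bnd_simp.
by apply: eq_integral => s _; rewrite mul1r.
Unshelve. all: by end_near. Qed.

End vanishing_primitive.

(** * The governing equation *)

Section governing_equation.
Context {R : realType}.
Local Notation mu := (@lebesgue_measure R).
Variables (k : nat) (lambda1 lambda2 eta nu c0 : R).
Hypotheses (eta_gt0 : 0 < eta) (nu_gt0 : 0 < nu) (nu_lt1 : nu < 1).
Hypothesis eta_lt_c0 : eta < c0.
Local Notation rho := (jump_rate k lambda1 lambda2).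
Local Notation jmp := (jump k lambda1 lambda2).
Local Notation kappa := (eta `^ nu - rho).

Variables (W G : int -> R -> R).
Hypothesis cW : forall m t, 0 < t -> {for t, continuous (W m)}.
Hypothesis bW : forall m, powR_bounded nu (W m).
Hypothesis W_laplace : forall m y, c0 <= y -> has_laplace (W m) y (G m y).
Hypothesis G_resolvent : forall n y, c0 <= y ->
  y `^ nu * G n y = unit_mass n + shifted_jump k lambda1 lambda2 kappa (G ^~ y) n.

Definition damped m (s : R) := expR (- eta * s) * W m s.

Definition potential m := conv (fun=> 1) (damped m).

(** The pmf of the time-changed process in terms of the fractional series W; the
    potential is the occupation integral. *)
Definition transient_pmf n t :=
  unit_mass n + jmp (potential ^~ t) n - rho * potential n t.

Let continuous_damped m t : 0 < t -> {for t, continuous (damped m)}.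
Proof.
move=> t0; apply: cvgM; last exact: cW.
exact: continuous_expR_lin.
Qed.

Let integrable_damped m t : mu.-integrable `](0%R:R), t] (EFin \o damped m).
Proof.
have [t0|t0] := ltP 0 t; last first.
  by rewrite set_itv_ge ?bnd_simp -?leNgt//; exact: integrable_set0.
have [C hC] := bW m t0.
apply: (@integrable_powR_bound _ _ nu C) => // s st.
  exact: continuous_damped.
apply: le_trans (hC s st); have /andP[s0 _] := st.
rewrite normrM ger0_norm ?expR_ge0// ler_piMl//.
by rewrite expR_le1 mulNr oppr_le0 mulr_ge0 ?ltW.
Qed.

Lemma continuous_potential m t : 0 < t -> {for t, continuous (potential m)}.
Proof. by move=> t0; apply: continuous_primitive => //; exact: continuous_damped. Qed.

Let c0_gt_eta y : c0 <= y -> 0 < y - eta.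
Proof. by move=> cy; rewrite subr_gt0 (lt_le_trans eta_lt_c0). Qed.

Lemma has_laplace_potential m y : c0 <= y ->
  has_laplace (potential m) (y - eta) (G m y / (y - eta)).
Proof.
move=> cy; apply: has_laplace_primitive; first exact: c0_gt_eta.
  by apply: has_laplace_shift; rewrite subrK; exact: W_laplace.
move=> t t0; apply: integrableS (integrable_damped m t) => //.
by apply: subset_itvl; rewrite bnd_simp.
Qed.

Hypothesis transient_pmf_le1 : forall n t, 0 < t -> `|transient_pmf n t| <= 1.

Let continuous_transient_pmf n t : 0 < t -> {for t, continuous (transient_pmf n)}.
Proof.
move=> t0; apply: cvgB.
  by apply: cvgD; [exact: cvg_cst|apply: cvg_jump => m; exact: continuous_potential].
by apply: cvgM; [exact: cvg_cst|exact: continuous_potential].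
Qed.

Lemma transient_pmf_cvg0 n : transient_pmf n x @[x --> 0^'+] --> transient_pmf n 0.
Proof.
have p0 m : potential m x @[x --> 0^'+] --> potential m 0.
  by rewrite /potential {2}/conv set_itvoo0 Rintegral_set0; exact: primitive_cvg0.
apply: cvgB.
  by apply: cvgD; [exact: cvg_cst|apply: cvg_jump].
by apply: cvgM; [exact: cvg_cst|].
Qed.

(** The generator of S applied to W, so that [transient_pmf] has derivative
    e^(-eta t) times the drift. *)
Definition drift n t := jmp (W ^~ t) n - rho * W n t.

(** The derivative of e^(eta t) times [transient_pmf], that is the function to
    which the fractional integral of the Caputo derivative is applied. *)
Definition tilted_rate n t := eta * (expR (eta * t) * transient_pmf n t) + drift n t.

Let continuous_drift n t : 0 < t -> {for t, continuous (drift n)}.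
Proof.
move=> t0; apply: cvgB; first by apply: cvg_jump => m; exact: cW.
by apply: cvgM; [exact: cvg_cst|exact: cW].
Qed.

Let continuous_tilted_rate n t : 0 < t -> {for t, continuous (tilted_rate n)}.
Proof.
move=> t0; apply: cvgD; last exact: continuous_drift.
apply: cvgM; first exact: cvg_cst.
by apply: cvgM; [exact: continuous_expR_lin|exact: continuous_transient_pmf].
Qed.

Let tilted_rate_bounded n : powR_bounded nu (tilted_rate n).
Proof.
apply: powR_boundedD.
  apply: powR_boundedZ; apply: bounded_powR_bounded; first exact: ltW.
  move=> T T0; exists (expR (eta * T)) => t /andP[t0 tT].
  rewrite normrM ger0_norm ?expR_ge0// -[leRHS]mulr1.
  by rewrite ler_pM ?expR_ge0 ?transient_pmf_le1// ler_expR ler_pM2l.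
apply: powR_boundedD; first exact: powR_bounded_jump.
have E : (fun t => - (rho * W n t)) = (fun t => (- rho) * W n t).
  by apply/funext => t; rewrite mulNr.
by rewrite E; exact: powR_boundedZ.
Qed.

Let is_derive_drift n (t : R) : 0 < t ->
  is_derive t 1 (fun s => jmp (potential ^~ s) n - rho * potential n s)
    (expR (- eta * t) * drift n t).
Proof.
move=> t0.
have hd m : is_derive t 1 (potential m) (damped m t).
  by apply: is_derive_primitive => //; exact: continuous_damped.
have hs (s : seq nat) (f : nat -> int) :
    is_derive t 1 (fun r => \sum_(j <- s) potential (f j) r) (\sum_(j <- s) damped (f j) t).
  elim: s => [|j s ih].
    rewrite big_nil; under eq_fun do rewrite big_nil; exact: is_derive_cst.
  rewrite big_cons; under eq_fun do rewrite big_cons; exact: is_deriveD.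
rewrite /drift /jump; apply: is_derive_eq.
rewrite /GRing.scale/= /damped -!mulr_sumr.
ring.
Qed.

Let is_derive_tilt (pb : R -> R) n (t : R) : 0 < t ->
  (forall s, 0 <= s -> pb s = transient_pmf n s) ->
  is_derive t 1 (fun s => expR (eta * s) * pb s) (tilted_rate n t).
Proof.
move=> t0 pbE.
have hd := is_derive_drift n t0.
have : is_derive t 1 (fun s => expR (eta * s) * (unit_mass n +
    (jmp (potential ^~ s) n - rho * potential n s))) (tilted_rate n t).
  have ht : is_derive t 1 (fun s => expR (eta * s)) (eta * expR (eta * t)).
    by apply: is_derive_eq; rewrite /GRing.scale/=; ring.
  apply: is_derive_eq; rewrite /GRing.scale/= /tilted_rate /transient_pmf.
  have eE : expR (eta * t) * expR (- eta * t) = 1.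
    by rewrite -expRD mulNr subrr expR0.
  transitivity (expR (eta * t) * expR (- eta * t) * drift n t +
      eta * (expR (eta * t) *
        (unit_mass n + jmp (potential ^~ t) n - rho * potential n t))); first by ring.
  by rewrite eE; ring.
apply: near_eq_is_derive; near=> s.
have s0 : 0 <= s by rewrite ltW//; near: s; exact: lt_nbhsr.
by rewrite pbE// /transient_pmf addrA.
Unshelve. all: by end_near. Qed.

Let nu1 : 0 < 1 - nu <= 1. Proof. by rewrite subr_gt0 nu_lt1/= lerBlDr lerDl ltW. Qed.
Let nu2 : 0 < nu <= 1. Proof. by rewrite nu_gt0 ltW. Qed.
Let nu1' : 0 < 1 - nu. Proof. by case/andP: nu1. Qed.

Let derive_tilt (pb : R -> R) n (t : R) : 0 < t ->
  (forall s, 0 <= s -> pb s = transient_pmf n s) ->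
  derive1 (fun s => expR (eta * s) * pb s) t = tilted_rate n t.
Proof.
by move=> t0 pbE; rewrite derive1E; have h := is_derive_tilt t0 pbE; rewrite derive_val.
Qed.

(** The derivative is of order t^(nu - 1) at 0 and the kernel of order
    (t - s)^(-nu), so their product is dominated by a Beta integrand. *)
Lemma tilted_caputo_exists (pb : R -> R) n t : 0 < t ->
  (forall s, 0 <= s -> pb s = transient_pmf n s) ->
  tempered_caputo_exists eta nu pb t.
Proof.
move=> t0 pbE; split.
- apply/(continuous_within_itvP _ t0); split.
  + move=> s; rewrite in_itv/= => /andP[s0 _].
    apply/differentiable_continuous/derivable1_diffP.
    by have h := is_derive_tilt s0 pbE; exact: ex_derive.
  + apply: cvgM; first by apply: cvg_at_right_filter; exact: continuous_expR_lin.
    rewrite (pbE 0 (lexx 0)).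
    apply: cvg_trans (@transient_pmf_cvg0 n).
    apply: near_eq_cvg; near=> s; rewrite pbE//.
  + suff ct : {for t, continuous (fun s => expR (eta * s) * pb s)}.
      by apply: cvg_at_left_filter; exact: ct.
    apply/differentiable_continuous/derivable1_diffP.
    by have h := is_derive_tilt t0 pbE; exact: ex_derive.
- by move=> s /andP[s0 _]; have h := is_derive_tilt s0 pbE; exact: ex_derive.
- have i := integrable_conv nu1 nu2 (@continuous_tilted_rate n) (tilted_rate_bounded n) t0.
  apply: eq_integrable (integrableZl _ (Gamma (1 - nu)) i) => // s.
  rewrite inE/= in_itv/= => /andP[s0 st].
  rewrite -EFinM (derive_tilt s0 pbE) /rl_kernel.
  have -> : 1 - nu - 1 = - nu by ring.
  have G0 := Gamma_gt0 nu1'.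
  by congr EFin; field; rewrite gt_eqF.
Unshelve. all: by end_near. Qed.

Lemma caputo_tilt (pb : R -> R) n t : 0 < t ->
  (forall s, 0 <= s -> pb s = transient_pmf n s) ->
  caputo nu (fun s => expR (eta * s) * pb s) t =
  conv (rl_kernel (1 - nu)) (tilted_rate n) t.
Proof.
move=> t0 pbE; have G0 := Gamma_gt0 nu1'.
have i := integrable_conv nu1 nu2 (@continuous_tilted_rate n) (tilted_rate_bounded n) t0.
rewrite /caputo /conv.
rewrite [X in _ * X](_ : _ = Gamma (1 - nu) *
    \int[mu]_(s in `]0, t[) (rl_kernel (1 - nu) (t - s) * tilted_rate n s)).
  by rewrite mulrA mulVf ?mul1r// gt_eqF.
rewrite -RintegralZl//; apply: eq_Rintegral => s; rewrite inE/= in_itv/= => /andP[s0 st].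
rewrite (derive_tilt s0 pbE) /rl_kernel.
have -> : 1 - nu - 1 = - nu by ring.
by field; rewrite gt_eqF.
Qed.

Lemma eq_shifted_jump (phi psi : int -> R) n : phi =1 psi ->
  shifted_jump k lambda1 lambda2 kappa phi n = shifted_jump k lambda1 lambda2 kappa psi n.
Proof. by move=> /funext ->. Qed.

Let jump_G n y : c0 <= y ->
  jmp (G ^~ y) n - rho * G n y = (y `^ nu - eta `^ nu) * G n y - unit_mass n.
Proof.
by move=> cy; rewrite mulrBl G_resolvent// /shifted_jump; ring.
Qed.

Let has_laplace_drift n y : c0 <= y ->
  has_laplace (drift n) y ((y `^ nu - eta `^ nu) * G n y - unit_mass n).
Proof.
move=> cy; rewrite -jump_G//; apply: has_laplaceB; last by apply: has_laplaceZ; exact: W_laplace.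
by apply: has_laplace_jump => m; exact: W_laplace.
Qed.

Lemma has_laplace_transient_pmf n y : c0 <= y ->
  has_laplace (transient_pmf n) (y - eta)
    ((y `^ nu - eta `^ nu) * G n y / (y - eta)).
Proof.
move=> cy; have z0 := c0_gt_eta cy.
have hp m := has_laplace_potential m cy.
have := has_laplaceB (has_laplaceD (has_laplace_cst (unit_mass n) z0)
  (has_laplace_jump k lambda1 lambda2 n hp)) (has_laplaceZ rho (hp n)).
set c := (X in has_laplace _ _ X).
suff -> : c = (y `^ nu - eta `^ nu) * G n y / (y - eta) by [].
have -> : (y `^ nu - eta `^ nu) * G n y = jmp (G ^~ y) n - rho * G n y + unit_mass n.
  by rewrite jump_G// subrK.
rewrite /c (_ : jmp (fun m => G m y / (y - eta)) n = jmp (G ^~ y) n / (y - eta)).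
  by field; rewrite gt_eqF.
by rewrite mulrC -jumpZ; apply: eq_jump => m; rewrite mulrC.
Qed.

(** The right-hand side of the equation, with the boundary and Mittag-Leffler
    terms in explicit form. *)
Definition equation_rhs n t : R :=
  unit_mass n * (boundary_density eta nu t - expR (- eta * t) * rl_kernel (1 - nu) t)
  + shifted_jump k lambda1 lambda2 kappa (transient_pmf ^~ t) n.

Let continuous_equation_rhs n t : 0 < t -> {for t, continuous (equation_rhs n)}.
Proof.
move=> t0; apply: cvgD.
  apply: cvgM; first exact: cvg_cst.
  apply: cvgB; first exact: continuous_boundary_density.
  apply: cvgM.
    exact: continuous_expR_lin.
  by apply: cvgM; [exact: continuous_powR_gt0|exact: cvg_cst].
apply: cvgD; first by apply: cvg_jump => m; exact: continuous_transient_pmf.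
by apply: cvgM; [exact: cvg_cst|exact: continuous_transient_pmf].
Qed.

Let has_laplace_equation_rhs n y : c0 <= y ->
  has_laplace (equation_rhs n) (y - eta)
    (unit_mass n * ((y `^ nu - eta `^ nu) / (y - eta) - y `^ (- (1 - nu))) +
     (y `^ nu - eta `^ nu) / (y - eta) * (y `^ nu * G n y - unit_mass n)).
Proof.
move=> cy; have z0 := c0_gt_eta cy; have y0 : 0 < y by apply: lt_trans eta_gt0 _; rewrite -subr_gt0.
have hu m := has_laplace_transient_pmf m cy.
have hb := has_laplace_boundary_density eta_gt0 nu_gt0 nu_lt1 z0.
have hk : has_laplace (fun t => expR (- eta * t) * rl_kernel (1 - nu) t) (y - eta)
    (y `^ (- (1 - nu))).
  by apply: has_laplace_shift; rewrite subrK; exact: has_laplace_rl_kernel.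
rewrite /tempered_exponent (addrC eta) subrK in hb.
apply: has_laplaceD; first by apply: has_laplaceZ; exact: has_laplaceB.
rewrite G_resolvent// [unit_mass n + _]addrC addrK.
rewrite (_ : _ * _ = jmp (fun m => (y `^ nu - eta `^ nu) * G m y / (y - eta)) n +
    kappa * ((y `^ nu - eta `^ nu) * G n y / (y - eta))).
  apply: has_laplaceD; first exact: has_laplace_jump.
  exact: has_laplaceZ.
rewrite /shifted_jump mulrDr -jumpZ; congr (_ + _); last by ring.
by apply: eq_jump => m; ring.
Qed.

Let has_laplace_tilted_rate n y : c0 <= y ->
  has_laplace (tilted_rate n) y (eta * ((y `^ nu - eta `^ nu) * G n y / (y - eta)) +
    ((y `^ nu - eta `^ nu) * G n y - unit_mass n)).
Proof.
move=> cy; apply: has_laplaceD; last exact: has_laplace_drift.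
apply: has_laplaceZ.
have := @has_laplace_shift _ (transient_pmf n) (- eta) y _ (has_laplace_transient_pmf n cy).
by rewrite opprK.
Qed.

(** Both sides have, at y = z + eta, the transform
    (y^nu (y^nu - eta^nu) G - y^nu d + eta d y^(nu-1)) / z with d = [n = 0]; for
    the right-hand side this uses the resolvent equation to replace the shifted
    generator applied to G by y^nu G - d. *)
Lemma conv_tilted_rateE n t : 0 < t ->
  conv (rl_kernel (1 - nu)) (tilted_rate n) t = expR (eta * t) * equation_rhs n t.
Proof.
move=> t0.
pose c y := unit_mass n * ((y `^ nu - eta `^ nu) / (y - eta) - y `^ (- (1 - nu))) +
     (y `^ nu - eta `^ nu) / (y - eta) * (y `^ nu * G n y - unit_mass n).
apply: (@laplace_unique_continuous _ _ (fun t => expR (eta * t) * equation_rhs n t)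
  c0 (fun j => c (c0 + j%:R))) => //.
- move=> j; set y := c0 + _; have cy : c0 <= y by rewrite lerDl.
  have z0 := c0_gt_eta cy; have y0 : 0 < y by apply: lt_trans eta_gt0 _; rewrite -subr_gt0.
  have := has_laplace_conv (has_laplace_rl_kernel nu1' y0) (has_laplace_tilted_rate n cy)
    (integrable_conv nu1 nu2 (@continuous_tilted_rate n) (@tilted_rate_bounded n)).
  set e := (X in has_laplace _ _ X); suff -> : e = c y by [].
  rewrite /e /c -(mulr_powRB1 (ltW y0) nu_gt0) opprB.
  by field; rewrite gt_eqF.
- move=> j; set y := c0 + _; have cy : c0 <= y by rewrite lerDl.
  have := @has_laplace_shift _ (equation_rhs n) (- eta) y _ (has_laplace_equation_rhs n cy).
  by rewrite opprK.
- by move=> s s0; exact: (continuous_conv_rl_kernel nu1 nu2 (@continuous_tilted_rate n) (@tilted_rate_bounded n)).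
- by move=> s s0; apply: cvgM; [exact: continuous_expR_lin|exact: continuous_equation_rhs].
Qed.

Lemma tempered_caputo_transient_pmf (pb : R -> R) n t : 0 < t ->
  (forall s, 0 <= s -> pb s = transient_pmf n s) ->
  tempered_caputo eta nu pb t = equation_rhs n t.
Proof.
move=> t0 pbE; rewrite /tempered_caputo (caputo_tilt t0 pbE) conv_tilted_rateE//.
by rewrite mulrA -expRD mulNr addNr expR0 mul1r.
Qed.

End governing_equation.

(** * The time-changed Skellam process *)

Section mean_order.
Context {R : realType} {d : measure_display} {T : measurableType d}.

Lemma has_mean_le (P : probability T R) (f h : T -> R) a b :
  has_mean P f a -> has_mean P h b -> (forall w, f w <= h w) -> a <= b.
Proof.
move=> [fi fa] [hi hb] fh; rewrite -lee_fin -fa -hb.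
by apply: le_integral => // w _; rewrite lee_fin.
Qed.

End mean_order.

Section time_changed_walk.
Context {R : realType} {d : measure_display} {T : measurableType d}.
Context (P : probability T R).
Local Notation mu := (@lebesgue_measure R).
Local Notation Rpos := (`](0%R : R), +oo[%classic).
Variables (k : nat) (lambda1 lambda2 nu eta : R).
Variables (S : R -> T -> int) (L D : R -> T -> R).
Hypotheses (k_gt0 : (0 < k)%N) (l1 : 0 < lambda1) (l2 : 0 < lambda2).
Hypotheses (eta_gt0 : 0 < eta) (nu_gt0 : 0 < nu) (nu_lt1 : nu < 1).
Hypothesis hS : skellam_process_of_order P k lambda1 lambda2 S.
Hypothesis hD : tempered_stable_subordinator P eta nu D.
Hypothesis LE : forall t w, 0 <= t -> L t w = inverse_process D t w.
Hypothesis iSL : independent_processes P S L.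
Hypothesis L_diffuse : forall t y, 0 < t -> P [set w | L t w = y] = 0%E.
Local Notation rho := (jump_rate k lambda1 lambda2).
Local Notation jmp := (jump k lambda1 lambda2).
Local Notation kappa := (eta `^ nu - rho).
Local Notation g := (process_pmf P S).
Local Notation pbar := (process_pmf P (fun t w => S (L t w) w)).

Let g_itv01 n x : 0 <= x -> 0 <= g n x <= 1.
Proof. exact: (process_pmf_itv01 k_gt0 l1 l2 hS). Qed.

Let gE n x : 0 <= x ->
  ((g n x)%:E = \sum_(0 <= b <oo) (joint_pmf k lambda1 lambda2 (n + b%:Z) b%:Z x)%:E)%E.
Proof. exact: (skellam_pmfE k_gt0 l1 l2 hS). Qed.

Let mg n : measurable_fun Rpos (g n).
Proof. exact: (measurable_difference_pmf k_gt0 (ltW l1) (ltW l2) gE). Qed.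

Let g_itv01_gt0 n y : 0 < y -> 0 <= g n y <= 1.
Proof. by move=> y0; rewrite g_itv01// ltW. Qed.

Lemma process_pmf0 n : g n 0 = unit_mass n.
Proof. exact: (difference_pmf0 (ltW l1) (ltW l2) gE). Qed.

Lemma process_pmf_balance n x : 0 <= x ->
  g n x = unit_mass n + jmp (fun m => conv (fun=> 1) (g m) x) n -
          rho * conv (fun=> 1) (g n) x.
Proof.
rewrite le_eqVlt => /predU1P[<-|x0]; last first.
  have := difference_pmf_balance k_gt0 (ltW l1) (ltW l2) g_itv01 gE n x0.
  by move=> <-; rewrite addrK.
have c0 m : conv (fun=> 1) (g m) 0 = 0 by rewrite /conv set_itvoo0 Rintegral_set0.
rewrite process_pmf0 c0 mulr0 subr0 (eq_jump _ _ _ _ c0).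
by rewrite /jump !big1// !mulr0 !addr0.
Qed.

Lemma subordinated_pmf_mean n t : 0 <= t -> has_mean P (fun w => g n (L t w)) (pbar n t).
Proof.
have mS x m : 0 <= x -> measurable [set w | S x w = m].
  by move=> x0; have [] := skellam_law k_gt0 l1 l2 hS m x0.
have rS w x : 0 <= x -> \forall s \near x^'+, S s w = S x w.
  exact: (skellam_right_constant hS).
exact: (subordinated_pmf hD LE mS rS iSL n).
Qed.

Lemma subordinated_pmfE n t : 0 <= t ->
  pbar n t = unit_mass n + jmp (fun m => occupation P D (g m) t) n -
             rho * occupation P D (g n) t.
Proof.
move=> t0.
have occ m : has_mean P (fun w => conv (fun=> 1) (g m) (L t w)) (occupation P D (g m) t).
  exact: (has_mean_occupation eta_gt0 nu_gt0 hD LE L_diffuse (mg m) (g_itv01_gt0 m)).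
apply: has_mean_uniq (subordinated_pmf_mean n t0) _.
have E : (fun w => g n (L t w)) = (fun w => unit_mass n +
    jmp (fun m => conv (fun=> 1) (g m) (L t w)) n + (- rho) * conv (fun=> 1) (g n) (L t w)).
  by apply/funext => w; rewrite process_pmf_balance ?mulNr//; exact: (L_ge0 LE).
have := has_meanD (has_meanD (has_mean_cst P (unit_mass n))
  (has_mean_jump k lambda1 lambda2 n occ)) (has_meanZ (- rho) (occ n)).
by rewrite E mulNr.
Qed.

Lemma subordinated_pmf_le1 n t : 0 <= t -> `|pbar n t| <= 1.
Proof.
move=> t0; have h := subordinated_pmf_mean n t0.
have g01 w := g_itv01 n (L_ge0 LE w t0).
rewrite ler_norml; apply/andP; split.
  apply: le_trans (_ : 0 <= _); first by rewrite oppr_le0.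
  by apply: has_mean_le (has_mean_cst P 0) h _ => w; case/andP: (g01 w).
by apply: has_mean_le h (has_mean_cst P 1) _ => w; case/andP: (g01 w).
Qed.

(** The candidate for the inverse transform of [green]. *)
Definition walk_series m := rl_series nu (fun q => walk_coeff k lambda1 lambda2 kappa q m).

Let C := walk_bound k lambda1 lambda2 kappa.
Let C_gt0 : 0 < C. Proof. exact: walk_bound_gt0 (ltW l1) (ltW l2) _. Qed.
Let walk_le m q : `|walk_coeff k lambda1 lambda2 kappa q m| <= C ^+ q.
Proof. exact: walk_coeff_le (ltW l1) (ltW l2) _ _ _. Qed.

Lemma continuous_walk_series m t : 0 < t -> {for t, continuous (walk_series m)}.
Proof. exact: (continuous_rl_series nu_gt0 C_gt0 (walk_le m)). Qed.

Lemma walk_series_bounded m : powR_bounded nu (walk_series m).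
Proof. by move=> t0; exact: (rl_series_bound nu_gt0 C_gt0 (walk_le m)). Qed.

(** The transform of the pmf of S at the exponent of the subordinator, as a
    function of y = eta + z. *)
Definition green m (y : R) : R := laplace_value (g m) (y `^ nu - eta `^ nu).

Let ig n x : mu.-integrable `](0%R:R), x[ (EFin \o g n).
Proof. exact: (integrable_difference_pmf k_gt0 (ltW l1) (ltW l2) g_itv01 gE). Qed.

Let balance n x (x0 : 0 < x) :=
  difference_pmf_balance k_gt0 (ltW l1) (ltW l2) g_itv01 gE n x0.

Lemma green_resolvent n y : eta `^ nu < y `^ nu ->
  y `^ nu * green n y = unit_mass n + shifted_jump k lambda1 lambda2 kappa (green ^~ y) n.
Proof.
rewrite -subr_gt0 => s0.
have h := laplace_value_resolvent g_itv01 mg ig balance n s0.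
rewrite /shifted_jump addrA -h /green; ring.
Qed.

(** The series for the transform of W and the Neumann expansion of the bounded
    solution of the resolvent equation have the same terms. *)
Lemma has_laplace_walk_series m y : 0 < y -> C + eta `^ nu < y `^ nu ->
  has_laplace (walk_series m) y (green m y).
Proof.
move=> y0 Cy.
have e0 : eta `^ nu < y `^ nu by apply: le_lt_trans Cy; rewrite lerDr ltW.
have Cy' : C < y `^ nu by apply: le_lt_trans Cy; rewrite lerDl powR_ge0.
apply: (has_laplace_rl_series nu_gt0 C_gt0 (walk_le m) y0 Cy').
apply: (@resolvent_expansion _ _ _ _ (ltW l1) (ltW l2) _ _ (green ^~ y)
  (y `^ nu - eta `^ nu)^-1 Cy').
  by move=> n; apply: (laplace_value_le g_itv01 mg); rewrite subr_gt0.
by move=> n; exact: green_resolvent.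
Qed.

(** Beyond c0 the Neumann series converges and the subordinator exponent
    y^nu - eta^nu is positive. *)
Let threshold : exists2 c0, eta < c0 & forall y, c0 <= y ->
  [/\ eta `^ nu < y `^ nu, forall m, has_laplace (walk_series m) y (green m y)
    & forall m, y `^ nu * green m y =
      unit_mass m + shifted_jump k lambda1 lambda2 kappa (green ^~ y) m].
Proof.
have [z z0 hz] := tempered_exponent_unbounded eta_gt0 nu_gt0 (C + 1).
exists (eta + z); first by rewrite ltrDl.
move=> y zy; have y0 : 0 < y by rewrite (lt_le_trans _ zy)// addr_gt0.
have Cy : C + eta `^ nu < y `^ nu.
  apply: (@lt_le_trans _ _ ((eta + z) `^ nu)).
    by move: hz; rewrite /tempered_exponent; lra.
  by apply: ge0_ler_powR; rewrite ?nnegrE ?addr_ge0 ?(ltW nu_gt0) ?(ltW eta_gt0) ?(ltW z0) ?(ltW y0).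
have ey : eta `^ nu < y `^ nu by apply: le_lt_trans Cy; rewrite lerDr ltW.
by split => // m; [exact: has_laplace_walk_series|exact: green_resolvent].
Qed.

(** Both functions of t have transform G / z; the left one is nondecreasing and
    the right one is continuous, which is enough for uniqueness. *)
Lemma occupation_potential m t : 0 <= t ->
  occupation P D (g m) t = potential eta walk_series m t.
Proof.
rewrite le_eqVlt => /predU1P[<-|t0].
  rewrite /potential /conv set_itvoo0 Rintegral_set0 /occupation.
  rewrite (@eq_Rintegral _ _ _ mu _ (fun=> 0)); first by rewrite /Rintegral integral0.
  move=> y; rewrite inE/= in_itv/= andbT => y0.
  by rewrite (sub_cdf0 _ _ hD)// mulr0.
have [c0 ec0 hc0] := threshold.
apply: (@laplace_unique_nondecreasing _ _ _ (c0 - eta)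
  (fun j => green m (c0 + j%:R) / (c0 + j%:R - eta))) => //.
- move=> j; pose y := c0 + j%:R; have cy : c0 <= y by rewrite lerDl.
  rewrite -/y.
  have z0 : 0 < y - eta by rewrite subr_gt0 (lt_le_trans ec0).
  have -> : c0 - eta + j%:R = y - eta by rewrite /y; ring.
  apply: (has_laplace_occupation eta_gt0 nu_gt0 hD (mg m) (g_itv01_gt0 m) z0).
  have -> : tempered_exponent eta nu (y - eta) = y `^ nu - eta `^ nu.
    by rewrite /tempered_exponent (addrC eta) subrK.
  apply: (has_laplace_pmf g_itv01 mg).
  by have [ey _ _] := hc0 y cy; rewrite subr_gt0.
- move=> j; have -> : c0 - eta + j%:R = c0 + j%:R - eta by ring.
  by apply: (has_laplace_potential eta_gt0 nu_gt0 ec0 continuous_walk_series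
    walk_series_bounded (fun m y cy => let: And3 _ h _ := hc0 y cy in h m)); rewrite lerDl.
- by move=> r s _; exact: (occupation_nondecreasing eta_gt0 nu_gt0 hD (mg m) (g_itv01_gt0 m)).
- move=> r r0; exact: (continuous_potential eta_gt0 nu_gt0 continuous_walk_series
    walk_series_bounded).
Qed.

Lemma subordinated_pmf_transient n t : 0 <= t ->
  pbar n t = transient_pmf k lambda1 lambda2 eta walk_series n t.
Proof.
move=> t0; rewrite subordinated_pmfE// /transient_pmf occupation_potential//.
by congr (_ + _ - _); apply: eq_jump => m; exact: occupation_potential.
Qed.

Lemma subordinated_pmf_equation n t : 0 < t ->
  tempered_caputo_exists eta nu (pbar n) t /\
  tempered_caputo eta nu (pbar n) t =
    unit_mass n * (boundary_density eta nu t - expR (- eta * t) * rl_kernel (1 - nu) t) +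
    shifted_jump k lambda1 lambda2 kappa (pbar ^~ t) n.
Proof.
move=> t0; have [c0 ec0 hc0] := threshold.
have W_laplace m y : c0 <= y -> has_laplace (walk_series m) y (green m y).
  by move=> /hc0[].
have resolvent m y : c0 <= y -> y `^ nu * green m y =
    unit_mass m + shifted_jump k lambda1 lambda2 kappa (green ^~ y) m.
  by move=> /hc0[].
have le1 m s : 0 < s -> `|transient_pmf k lambda1 lambda2 eta walk_series m s| <= 1.
  by move=> s0; rewrite -subordinated_pmf_transient ?subordinated_pmf_le1// ltW.
have pE := subordinated_pmf_transient n.
split.
  exact: (tilted_caputo_exists eta_gt0 nu_gt0 nu_lt1 continuous_walk_series
    walk_series_bounded le1 t0 pE).
rewrite (tempered_caputo_transient_pmf eta_gt0 nu_gt0 nu_lt1 ec0 continuous_walk_series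
    walk_series_bounded W_laplace resolvent le1 t0 pE) /equation_rhs; congr (_ + _).
by apply: eq_shifted_jump => m; rewrite subordinated_pmf_transient// ltW.
Qed.

End time_changed_walk.

Theorem proposition4p1 (R : realType) (d : measure_display)
    (T : measurableType d) (P : probability T R)
    (k : nat) (lambda1 lambda2 nu eta : R)
    (S : R -> T -> int) (L : R -> T -> R) (l : R -> R -> R)
    (k_ge1 : (1 <= k)%N) (lambda1_gt0 : 0 < lambda1)
    (lambda2_gt0 : 0 < lambda2) (nu_gt0 : 0 < nu) (nu_lt1 : nu < 1)
    (eta_gt0 : 0 < eta)
    (hS : skellam_process_of_order P k lambda1 lambda2 S)
    (hL : inverse_TSS P eta nu L)
    (hSL : independent_processes P S L)
    (* l x t is the density of L t at x, its value at x = 0 being the limit *)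
    (hl : forall t, 0 < t -> probability_density P (L t) (fun x => l x t))
    (hl0 : forall t, 0 < t -> l x t @[x --> 0^'+] --> l 0 t) :
  let p := process_pmf P S in
  let pbar := process_pmf P (fun t w => S (L t w) w) in
  forall (n : int) (t : R), 0 < t ->
    tempered_caputo_exists eta nu (pbar n) t /\
    tempered_caputo eta nu (pbar n) t =
      p n 0 * l 0 t
      - k%:R * (lambda1 + lambda2) * pbar n t
      + lambda1 * (\sum_(1 <= j < k.+1) pbar (n - j%:Z) t)
      + lambda2 * (\sum_(1 <= j < k.+1) pbar (n + j%:Z) t)
      + eta `^ nu * pbar n t
      - t `^ (- nu) * mittag_leffler3 1 (1 - nu) (1 - nu) (- eta * t) * p n 0.
Proof.
move=> p pbar n t t0.
have [D hD LE] := hL.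
have L_diffuse s y : 0 < s -> P [set w | L s w = y] = 0%E.
  by move=> s0; exact: (density_no_atom (hl s s0) y).
have l0_lim s : 0 < s -> entrance_rate P D m.+1%:R^-1 s @[m --> \oo] --> l 0 s.
  move=> s0; have mL := measurable_L hD LE (ltW s0).
  have := density_average_cvg0 (hl s s0) mL (fun w => L_ge0 LE w (ltW s0)) (hl0 s s0).
  apply: eq_cvgn => m; rewrite /entrance_rate; congr (_ / _).
  have x0 : 0 < m.+1%:R^-1 :> R by [].
  have := inverse_tail eta_gt0 nu_gt0 hD LE L_diffuse (ltW s0) x0.
  set x : R := m.+1%:R^-1 => tailE.
  rewrite [X in P X](_ : _ = ~` [set w | x < L s w]).
    by rewrite probability_setC ?tailE//; exact: (measurable_L_gt hD LE x (ltW s0)).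
  by apply/seteqP; split => w /=; [move=> h; apply/negP; rewrite -leNgt|move=> /negP; rewrite -leNgt].
have [ex ->] := subordinated_pmf_equation k_ge1 lambda1_gt0 lambda2_gt0 eta_gt0 nu_gt0
  nu_lt1 hS hD LE hSL L_diffuse n t0.
split; first exact: ex.
rewrite (boundary_densityE eta_gt0 nu_gt0 nu_lt1 hD l0_lim t0).
have -> : p n 0 = unit_mass n by exact: (process_pmf0 k_ge1 lambda1_gt0 lambda2_gt0 hS).
rewrite mittag_leffler3_diag ?subr_gt0// /rl_kernel.
have -> : 1 - nu - 1 = - nu by ring.
rewrite /shifted_jump /jump /jump_rate -/pbar; ring.
Qed.
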